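(* Let $n\ge 1$, let $\Omega\subset\mathbb{R}^n$ be a bounded, connected, open set with piecewise $C^1$ boundary, and let $Y=\mathbb{R}$, $Z=\mathbb{R}^n$. Let $\mu$ be a compactly supported, positive, finite Radon measure on $\overline\Omega\times Y\times Z$ such that, for all $\phi\in C_c^\infty(\Omega\times Y)$, $$\int_{\Omega\times Y\times Z}\left(\frac{\partial\phi}{\partial x}(x,y)+\frac{\partial \phi}{\partial y}(x,y)\,z\right)d\mu(x,y,z)=0 .$$ Then there are a compactly supported, finite, positive Radon measure $\nu$ on $\mathbb{R}$ and a family of functions $(\varphi_r\colon\Omega\to Y)_{r\in\mathbb{R}}\subset W^{1,\infty}(\Omega)$ such that, for all functions $\phi\in L^1(\mu)$ that are affine in $z$, $$\int_{\Omega\times Y\times Z}\phi\,d\mu=\int_{\mathbb{R}}\int_\Omega\phi(x,\varphi_r(x),D\varphi_r(x))\,dx\,d\nu(r).$$ Additionally, if $r\geq r'$ then $\varphi_r(x)\leq\varphi_{r'}(x)$ for all $x\in\Omega$.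
   Context: $\frac{\partial\phi}{\partial x}=(\frac{\partial\phi}{\partial x_1},\dots,\frac{\partial\phi}{\partial x_n})\in\mathbb{R}^n$ and $z\in\mathbb{R}^n$, so the integral condition is a system of $n$ scalar equations. $C_c^\infty(\Omega\times Y)$ is the set of real-valued, infinitely differentiable functions with compact support in the open set $\Omega\times Y$. A function $\phi(x,y,z)$ is affine in $z$ if $z\mapsto\phi(x,y,z)$ is affine for each $(x,y)$. $D\varphi_r$ denotes the weak derivative of $\varphi_r$, and $W^{1,\infty}(\Omega)$ is the Sobolev space of functions $\Omega\to\mathbb{R}$ with essentially bounded values and weak derivatives (Lipschitz functions). *)

(* Defs.v *)
From HB Require Import structures.
From mathcomp Require Import all_boot all_order all_algebra.
From mathcomp Require Import all_classical all_reals all_analysis.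

Set Implicit Arguments.
Unset Strict Implicit.
Unset Printing Implicit Defensive.
Import Order.TTheory GRing.Theory Num.Theory.
Import numFieldNormedType.Exports.

Local Open Scope classical_set_scope.
Local Open Scope ring_scope.

(* The sigma-algebra on R^n = 'rV[R]_n is generated by the coordinates, as the
   library does for tuples; it is the Borel sigma-algebra. *)
Definition measure_rV_display : measure_display. Proof. by constructor. Qed.

Section measurable_rV.
Context {R : realType} (n : nat).

Let coord (i : 'I_n) (x : 'rV[R]_n) : R := x ord0 i.

Let rV_set0 : g_sigma_preimage coord set0.
Proof. exact: sigma_algebra0. Qed.

Let rV_setC A : g_sigma_preimage coord A -> g_sigma_preimage coord (~` A).
Proof. exact: sigma_algebraC. Qed.

Let rV_bigcup (F : (set 'rV[R]_n)^nat) :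
  (forall i, g_sigma_preimage coord (F i)) ->
  g_sigma_preimage coord (\bigcup_i (F i)).
Proof. exact: sigma_algebra_bigcup. Qed.

HB.instance Definition _ := @isMeasurable.Build measure_rV_display
  'rV[R]_n (g_sigma_preimage coord) rV_set0 rV_setC rV_bigcup.

End measurable_rV.

Section measurable_rV_lemmas.
Context {R : realType}.

Lemma measurable_rV_coord n (i : 'I_n) :
  measurable_fun [set: 'rV[R]_n] (fun x : 'rV[R]_n => x ord0 i).
Proof.
move=> _ Y mY; rewrite setTI; apply: sub_sigma_algebra => /=.
rewrite -bigcup_seq/=; exists i => /=; first by rewrite mem_index_enum.
by exists Y => //; rewrite setTI.
Qed.

Lemma measurable_fun_rV d (T : measurableType d) n (f : T -> 'rV[R]_n) :
  (forall i, measurable_fun setT (fun x => f x ord0 i)) ->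
  measurable_fun setT f.
Proof.
move=> mf _ A mA; rewrite setTI.
move: A mA; apply: smallest_sub.
  split => /=.
  - by rewrite preimage_set0.
  - by move=> A mA; rewrite setTD preimage_setC; exact: measurableC.
  - by move=> F mF; rewrite preimage_bigcup; exact: bigcup_measurable.
rewrite -bigcup_seq; apply: bigcup_sub => i _ A [B mB <-].
by rewrite setTI -comp_preimage -[X in measurable X]setTI; exact: mf.
Qed.

Definition rV_cons n (p : R * 'rV[R]_n) : 'rV[R]_n.+1 :=
  row_mx (const_mx p.1 : 'rV_1) p.2.

Lemma rV_cons0 n (p : R * 'rV[R]_n) : rV_cons p ord0 ord0 = p.1.
Proof.
rewrite (_ : ord0 = @lshift 1 n ord0); last exact/val_inj.
by rewrite /rV_cons (row_mxEl (_ : 'rV_1)) mxE.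
Qed.

Lemma rV_consS n (p : R * 'rV[R]_n) (i : 'I_n) :
  rV_cons p ord0 (lift ord0 i) = p.2 ord0 i.
Proof.
rewrite (_ : lift ord0 i = @rshift 1 n i); last exact/val_inj.
by rewrite /rV_cons (row_mxEr (_ : 'rV_1)).
Qed.

Lemma measurable_rV_cons n : measurable_fun setT (@rV_cons n).
Proof.
apply: measurable_fun_rV => i; case: (unliftP ord0 i) => [j ->|->].
  rewrite (_ : (fun _ => _) = (fun x : 'rV[R]_n => x ord0 j) \o snd).
    by apply: measurableT_comp => //; exact: measurable_rV_coord.
  by apply/funext => p; rewrite rV_consS.
by rewrite (_ : (fun _ => _) = fst)//; apply/funext => p; rewrite rV_cons0.
Qed.

Definition rV_uncons n (x : 'rV[R]_n.+1) : R * 'rV[R]_n :=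
  (x ord0 ord0, \row_j x ord0 (lift ord0 j)).

Lemma rV_consK n : cancel (@rV_cons n) (@rV_uncons n).
Proof.
move=> [a x]; congr pair; first by rewrite rV_cons0.
by apply/rowP => j; rewrite mxE rV_consS.
Qed.

Lemma measurable_rV_uncons n : measurable_fun setT (@rV_uncons n).
Proof.
apply: measurable_fun_pair; first exact: measurable_rV_coord.
apply: measurable_fun_rV => i.
rewrite (_ : (fun _ => _) = (fun x : 'rV[R]_n.+1 => x ord0 (lift ord0 i))).
  exact: measurable_rV_coord.
by apply/funext => x; rewrite mxE.
Qed.

End measurable_rV_lemmas.

Section lebesgue_rV.
Context {R : realType}.
Local Open Scope ereal_scope.

Section step.
Variables (n : nat) (m : {sigma_finite_measure set 'rV[R]_n -> \bar R}).

Definition leb_step : set 'rV[R]_n.+1 -> \bar R :=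
  pushforward (@lebesgue_measure R \x m) (@rV_cons R n).

Let leb_step0 : leb_step set0 = 0.
Proof. by rewrite /leb_step /pushforward preimage_set0 measure0. Qed.

Let leb_step_ge0 A : 0 <= leb_step A.
Proof. exact: (measure_ge0 (lebesgue_measure \x m)). Qed.

Let leb_step_sigma_additive : semi_sigma_additive leb_step.
Proof.
have mcons A : measurable A -> measurable (@rV_cons R n @^-1` A).
  by move=> mA; rewrite -[X in measurable X]setTI; exact: measurable_rV_cons.
move=> F mF tF mUF; rewrite /leb_step /pushforward preimage_bigcup.
apply: (measure_semi_sigma_additive (s := lebesgue_measure \x m)).
- by move=> k; exact: mcons.
- apply/trivIsetP => /= i j _ _ ij; rewrite -preimage_setI.
  by move/trivIsetP : tF => /(_ _ _ _ _ ij) ->//; rewrite preimage_set0.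
- by rewrite -preimage_bigcup; exact: mcons.
Qed.

HB.instance Definition _ := isMeasure.Build _ _ _ leb_step
  leb_step0 leb_step_ge0 leb_step_sigma_additive.

Let leb_step_sigma_finite : sigma_finite setT leb_step.
Proof.
have /sigma_finiteP[F [FT ndF Foo]] := sigma_finiteT (@lebesgue_measure R).
have /sigma_finiteP[G [GT ndG Goo]] := sigma_finiteT m.
exists (fun k => @rV_uncons R n @^-1` (F k `*` G k)).
  rewrite -preimage_bigcup; apply/esym/seteqP; split => // x _.
  have : setT (@rV_uncons R n x).1 by [].
  have : setT (@rV_uncons R n x).2 by [].
  rewrite {1}FT {1}GT => -[k _ Gk] [l _ Fl]; exists (maxn k l) => //; split.
    by apply: (subsetPset _ _ (ndF _ _ (leq_maxr k l))).
  by apply: (subsetPset _ _ (ndG _ _ (leq_maxl k l))).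
move=> k; have [mF Flt] := Foo k; have [mG Glt] := Goo k; split.
  rewrite -[X in measurable X]setTI; apply: measurable_rV_uncons => //.
  exact: measurableX.
rewrite /leb_step /pushforward -comp_preimage.
rewrite (_ : _ \o _ = id) ?preimage_id; last first.
  by apply/funext => p /=; exact: rV_consK.
by rewrite product_measure1E// lte_mul_pinfty// ge0_fin_numE.
Qed.

HB.instance Definition _ := @Measure_isSigmaFinite.Build _ _ _ leb_step
  leb_step_sigma_finite.

End step.

(* n-dimensional Lebesgue measure: Lebesgue measure on R iterated n times. *)
Fixpoint leb (n : nat) : {sigma_finite_measure set 'rV[R]_n -> \bar R} :=
  match n with
  | 0%N => \d_(0%R : 'rV[R]_0)
  | k.+1 => leb_step (leb k)
  end.

Lemma measurable_rV_box n (A : 'I_n -> set R) :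
  (forall i, measurable (A i)) ->
  measurable [set x : 'rV[R]_n | forall i, A i (x ord0 i)].
Proof.
move=> mA; rewrite (_ : mkset _ = \bigcap_(i in [set: 'I_n])
    (fun x : 'rV[R]_n => x ord0 i) @^-1` A i); last first.
  by apply/seteqP; split => x /= Ax i; [move=> _|]; exact: Ax.
apply: fin_bigcap_measurable => // i _.
by have := measurable_rV_coord i measurableT (mA i); rewrite setTI.
Qed.

(* The normalisation that characterises Lebesgue measure on R^n. *)
Lemma leb_box n (A : 'I_n -> set R) : (forall i, measurable (A i)) ->
  leb n [set x | forall i, A i (x ord0 i)] =
  \prod_(i < n) lebesgue_measure (A i).
Proof.
elim: n A => [|n IH] A mA.
  rewrite big_ord0; change (\d_(0%R : 'rV[R]_0)
    [set x : 'rV[R]_0 | forall i, A i (x ord0 i)] = 1 :> \bar R).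
  by rewrite diracE mem_set// => -[].
rewrite big_ord_recl -(IH (fun i => A (lift ord0 i)))//.
transitivity ((lebesgue_measure \x leb n)
    (A ord0 `*` [set x : 'rV[R]_n | forall i, A (lift ord0 i) (x ord0 i)])).
  2: by apply: product_measure1E; [exact: mA|exact: (@measurable_rV_box n (fun i => A (lift ord0 i)))].
change ((lebesgue_measure \x leb n) (@rV_cons R n @^-1`
  [set x | forall i, A i (x ord0 i)]) = (lebesgue_measure \x leb n)
  (A ord0 `*` [set x : 'rV[R]_n | forall i, A (lift ord0 i) (x ord0 i)])).
congr (_ _); apply/seteqP; split => -[a x] /=.
  move=> Aax; split => [|i] /=; first by have := Aax ord0; rewrite rV_cons0.
  by have := Aax (lift ord0 i); rewrite rV_consS.
move=> [/= Aa Ax] i.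
by case: (unliftP ord0 i) => [j ->|->]; rewrite ?rV_cons0 ?rV_consS.
Qed.

End lebesgue_rV.

Section smooth.
Context {R : realType} {V : normedModType R}.

(* All iterated directional derivatives up to order k exist and are continuous;
   in finite dimension this is the usual class C^k. *)
Fixpoint is_Ck (k : nat) (f : V -> R) : Prop :=
  continuous f /\
  if k is k'.+1 then
    forall v, (forall x, derivable f x v) /\ is_Ck k' (fun x => 'D_v f x)
  else True.

Definition is_smooth (f : V -> R) := forall k, is_Ck k f.

Definition fsupport (f : V -> R) : set V := closure [set x | f x != 0].

(* C_c^oo(U), its elements being extended by zero to the whole space *)
Definition test_function (U : set V) (f : V -> R) :=
  [/\ is_smooth f, compact (fsupport f) & fsupport f `<=` U].

Definition C1_on (U : set V) (f : V -> R) :=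
  forall v x, U x -> derivable f x v /\ {for x, continuous (fun y => 'D_v f y)}.

(* A closed piece of a C^1 hypersurface, C^1 up to its edges: the closure of a
   relatively open part V0 `&` {g = 0} of a regular level set of g on U. *)
Definition C1_hypersurface_piece (S : set V) :=
  exists (U V0 : set V) (g : V -> R),
    [/\ open U, open V0 /\ closure V0 `<=` U, C1_on U g,
        forall x, U x -> g x = 0 -> exists v, 'D_v g x != 0
      & S = closure (V0 `&` [set x | g x = 0])].

Definition boundary (A : set V) : set V := closure A `\` interior A.

Definition piecewise_C1_boundary (A : set V) :=
  exists (N : nat) (S : 'I_N -> set V),
    (forall i, C1_hypersurface_piece (S i)) /\
    boundary A = \bigcup_(i in [set: 'I_N]) S i.

End smooth.

Section borel_measures.
Context {R : realType} {T : topologicalType}.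
Local Open Scope ereal_scope.
Implicit Type mu : set T -> \bar R.

Definition is_radon mu :=
  (forall K, compact K -> mu K < +oo) /\
  (forall A, <<s @open T >> A ->
    mu A = ereal_sup [set mu K | K in [set K | compact K /\ K `<=` A]]).

Definition msupport mu : set T :=
  [set x | forall U, open U -> U x -> 0 < mu U].

Definition compactly_supported mu := compact (msupport mu).

End borel_measures.

(* Integrability with respect to the completion of mu. *)
Definition ae_integrable d (T : measurableType d) (R : realType)
    (mu : {measure set T -> \bar R}) (D : set T) (f : T -> \bar R) :=
  exists2 g, mu.-integrable D g & ae_eq mu D f g.

Section sobolev.
Context {R : realType} {n : nat}.
Notation E := 'rV[R]_n.
Implicit Types (Omega : set E) (u : E -> R) (G : E -> E).

Definition locally_integrable_on Omega u :=
  measurable_fun Omega u /\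
  forall K, compact K -> K `<=` Omega -> (leb n).-integrable K (EFin \o u).

(* G is a representative of the weak derivative D u on Omega. *)
Definition is_weak_gradient Omega u G :=
  [/\ locally_integrable_on Omega u,
      forall i, locally_integrable_on Omega (fun x => G x ord0 i)
    & forall psi : E -> R, test_function Omega psi -> forall i,
        \int[leb n]_(x in Omega) (u x * 'D_(delta_mx ord0 i) psi x) =
        - \int[leb n]_(x in Omega) (G x ord0 i * psi x)].

Definition ess_bounded_on (V : normedModType R) Omega (f : E -> V) :=
  exists M : R, {ae leb n, forall x, Omega x -> `|f x| <= M}.

(* An element of W^{1,oo}(Omega) is given by its continuous (locally Lipschitz)
   representative, so that its pointwise values are meaningful. *)
Definition W1infty Omega u :=
  [/\ {within Omega, continuous u}, ess_bounded_on Omega u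
    & exists2 G, is_weak_gradient Omega u G & ess_bounded_on Omega G].

Definition affine_in_z (D : set E) (phi : E * R * E -> R) :=
  forall x y, D x ->
    exists (l : {linear E -> R}) (c : R), forall z, phi (x, y, z) = l z + c.

End sobolev.

(* Main.v *)
From HB Require Import structures.
Require Import Defs.
From mathcomp Require Import all_boot all_order all_algebra.
From mathcomp Require Import all_classical all_reals all_analysis.
From mathcomp Require Import measurable_realfun.
From mathcomp Require Import ring lra.
Import Order.TTheory GRing.Theory Num.Theory.
Import numFieldNormedType.Exports.
Local Open Scope classical_set_scope.
Local Open Scope ring_scope.

(** Write sg for the law of (x, y) under mu on Omega x R, and mz i (x, y) for the
    conditional mean of z_i.  Since the test fields do not depend on z, the
    hypothesis is a statement about sg and mz alone: for every coordinate i,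
    d_i sg + d_y (mz i sg) = 0 in the weak sense.  Read with x as an
    n-dimensional time, this is a continuity equation: the vertical
    distributions of sg are transported with velocity mz, and |mz i| <= M
    because mu has compact support.  On a line, a transport can be followed by
    keeping track of how much mass lies below each particle, so the functions
    phi_r of the theorem are taken to be the quantiles of the vertical
    distributions, which also gives the monotonicity in r.

    Propagation.  Testing with a smoothed box moving with velocity v and a
    smoothed half-line moving with speed n M |v| gives
    sg (Q x (-oo, a)) <= sg ((Q + v) x (-oo, a + n M |v|)) (propagation).
    Beyond |y| <= M the half-line carries all the mass, so the projection of sg
    on Omega is locally invariant under translations; connectedness makes it
    c times Lebesgue measure (dens_constant).  The measure nu is Lebesgue
    measure on [0, c].

    Quantiles.  The averages of sg (. x (-oo, b)) over small balls have a lower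
    limit, the profile at x, which is nondecreasing in b, has total mass c and
    inherits the finite speed.  Hence the quantile u_r (x), the infimum of the
    b at which the profile reaches c - r, is bounded by M, nonincreasing in r and
    locally Lipschitz in x, with a constant that does not depend on r; so it is
    in W^{1,oo} (lipschitz_W1infty).  Comparing averages at different scales
    shows that sg is the image of Lebesgue measure on Omega x [0, c] under
    (x, r) |-> (x, u_r x) (quantile_law).

    Gradients.  It remains to see that D_i u_r (x) = mz i (x, u_r x) almost
    everywhere.  Put w (x, r) = u_r x, and let G be a weak limit of the
    difference quotients of w in the direction e_i; it is the weak derivative of
    w.  By the chain rule the mean of G given (x, w) satisfies the same equation
    as mz i, hence equals it (weak_limit_graph); what is to be excluded is that
    G varies where r |-> w (x, r) is constant.  Monotonicity in r does
    it: let theta be the indicator of r < s0 minus its conditional expectation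
    given (x, w).  As theta is orthogonal to the functions of (x, w), the
    increment w (x + t e_i, r) - w (x, r), integrated against theta, may be
    replaced by w (x + t e_i, r) - w (x + t e_i, s0), which has the sign of
    theta; so forward quotients have nonnegative integrals against theta, and
    backward ones nonpositive integrals (quotient_sign). Both converge to the
    integral of G theta, which therefore vanishes, and G is a function of (x, w)
    (weak_derivative_graph). Countably many test functions then give the
    statement for almost every level at once (weak_gradient_levels).

    Integrals.  A function phi = a(x, y) + b(x, y) . z has the same integral
    under mu as a + b . mz under sg, even if a and b are unbounded
    (affine_average).  The law of sg and Fubini's theorem turn this into
    the integral over r of the integrals of a (x, u_r x) + b (x, u_r x) . D u_r x
    (disintegration). *)

Set Implicit Arguments.
Unset Strict Implicit.
Unset Printing Implicit Defensive.

(** * Pushforwards and Borel sets of R^n *)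

Section pushforward.
Context d1 d2 (T1 : measurableType d1) (T2 : measurableType d2).

(** Image measures carry the measure structure when the function comes bundled
    with its measurability, as produced here. *)
Definition mfun_of (f : T1 -> T2) (mf : measurable_fun setT f) :
    {mfun T1 >-> T2} :=
  HB.pack_for {mfun T1 >-> T2} f (isMeasurableFun.Build _ _ _ _ f mf).

Section push.
Context {R : realType}.

(** A constant of its own, so that finiteness of the image of a finite measure
    can be recorded as an instance. *)
Definition push (m : set T1 -> \bar R) (f : {mfun T1 >-> T2}) : set T2 -> \bar R :=
  pushforward m f.

Section measure.
Variables (m : {measure set T1 -> \bar R}) (f : {mfun T1 >-> T2}).

Let mpre A : measurable A -> measurable (f @^-1` A).
Proof. by move=> mA; rewrite -[X in measurable X]setTI; exact: measurable_funPT. Qed.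

Let push0 : push m f set0 = 0%E.
Proof. by rewrite /push /pushforward preimage_set0 measure0. Qed.

Let push_ge0 A : (0 <= push m f A)%E.
Proof. exact: measure_ge0. Qed.

Let push_sigma_additive : semi_sigma_additive (push m f).
Proof.
move=> F mF tF mUF; rewrite /push /pushforward preimage_bigcup.
apply: measure_semi_sigma_additive.
- by move=> k; exact: mpre.
- apply/trivIsetP => /= i j _ _ ij; rewrite -preimage_setI.
  by move/trivIsetP : tF => /(_ _ _ _ _ ij) ->//; rewrite preimage_set0.
- by rewrite -preimage_bigcup; exact: mpre.
Qed.

HB.instance Definition _ := isMeasure.Build _ _ _ (push m f)
  push0 push_ge0 push_sigma_additive.

End measure.

Section finite.
Variables (m : {finite_measure set T1 -> \bar R}) (f : {mfun T1 >-> T2}).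

Let push_fin : fin_num_fun (push m f).
Proof.
move=> A mA; apply: fin_num_measure.
by rewrite -[X in measurable X]setTI; exact: measurable_funPT.
Qed.

HB.instance Definition _ := Measure_isFinite.Build _ _ _ (push m f) push_fin.
End finite.

End push.

End pushforward.

Section open_measurable.

(** The sets B k are required to belong to M: with M the measurable sets, this
    links a topology to a sigma-algebra defined independently of it, as the
    coordinate sigma-algebra on R^n is. *)
Definition countable_base (T : topologicalType) (M : set_system T) :=
  exists B : nat -> set T,
    (forall k, M (B k)) /\
    forall U x, open U -> U x -> exists k, B k x /\ B k `<=` U.

Lemma countable_base_open (T : topologicalType) (M : set_system T) :
  countable_base M -> M set0 ->
  (forall F : (set T)^nat, (forall k, M (F k)) -> M (\bigcup_k F k)) ->
  forall U, open U -> M U.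
Proof.
move=> [B [MB BU]] M0 Mcup U oU.
rewrite (_ : U = \bigcup_k (if `[< B k `<=` U >] then B k else set0)).
  by apply: Mcup => k; case: ifP => _.
apply/seteqP; split => [x Ux|x [k _]].
  have [k [Bx BkU]] := BU _ _ oU Ux; exists k => //.
  by rewrite asboolT.
by case: ifPn => // /asboolP; exact.
Qed.

Lemma countable_baseX (T1 T2 : topologicalType) (M1 : set_system T1)
    (M2 : set_system T2) (M : set_system (T1 * T2)) :
  (forall A B, M1 A -> M2 B -> M (A `*` B)) ->
  countable_base M1 -> countable_base M2 -> countable_base M.
Proof.
move=> MX [B1 [M1B B1U]] [B2 [M2B B2U]].
exists (fun k => if unpickle k is Some (i, j) then B1 i `*` B2 j
                 else B1 0%N `*` B2 0%N); split.
  by move=> k; case: unpickle => [[i j]|]; exact: MX.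
move=> U [x y] oU Uxy.
have : nbhs (x, y) U by exact: open_nbhs_nbhs.
move=> [[V W] /= [nV nW] VWU].
move: nV nW; rewrite !nbhsE => -[V' [oV' V'x] V'V] [W' [oW' W'y] W'W].
have [i [Bix BiV]] := B1U _ _ oV' V'x; have [j [Bjy BjW]] := B2U _ _ oW' W'y.
exists (pickle (i, j)); rewrite pickleK; split => // -[a b] [/= Ba Bb].
by apply: VWU; split => /=; [apply/V'V/BiV|apply/W'W/BjW].
Qed.

End open_measurable.

Section rV_borel.
Context {R : realType}.

Lemma measurable_ball_R (x e : R) : measurable (ball x e).
Proof. by rewrite ball_itv; exact: measurable_itv. Qed.

Lemma rV_ballE n (x : 'rV[R]_n) (e : R) : 0 < e ->
  ball x e = [set y | forall i, ball (x ord0 i) e (y ord0 i)].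
Proof.
move=> e0; apply/seteqP; split => y /=; first by move=> [_ h] i; exact: h.
by move=> h; split => // i j; rewrite ord1; exact: h.
Qed.

Lemma measurable_ball_rV n (x : 'rV[R]_n) (e : R) : measurable (ball x e).
Proof.
have [e0|e0] := ltP 0 e.
  rewrite rV_ballE//; apply: (measurable_rV_box (A := fun i => ball (x ord0 i) e)) => i.
  exact: measurable_ball_R.
rewrite (_ : ball x e = set0)//; apply/seteqP; split => // y [] /lt_le_trans.
by move/(_ _ e0); rewrite ltxx.
Qed.

Lemma leb_ball n (x : 'rV[R]_n) (e : R) : 0 < e ->
  leb n (ball x e) = ((e *+ 2) ^+ n)%:E.
Proof.
move=> e0; rewrite rV_ballE// (leb_box (A := fun i => ball (x ord0 i) e)); last first.
  by move=> i; exact: measurable_ball_R.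
under eq_bigr do rewrite lebesgue_measure_ball ?ltW//.
by rewrite prodEFin prodr_const card_ord.
Qed.

Lemma countable_base_R : @countable_base R measurable.
Proof.
exists (fun k => if unpickle k is Some (q, i) then
   ball (ratr q : R) (i.+1%:R^-1) else set0); split.
  by move=> k; case: unpickle => [[q i]|//]; exact: measurable_ball_R.
move=> U x oU Ux.
have : nbhs x U by exact: open_nbhs_nbhs.
move=> /nbhs_ballP[e /= e0 eU].
have e20 : 0 < e / 2 by rewrite divr_gt0.
have [i /ltW ie] : exists i, (i.+1%:R^-1 : R) < e / 2.
  have /cvgrPdist_lt/(_ _ e20)[i _ /(_ i (leqnn _))] := @cvg_harmonic R.
  by rewrite sub0r normrN gtr0_norm ?invr_gt0//; exists i.
have i0 : 0 < (i.+1%:R^-1 : R) by rewrite invr_gt0.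
have [q] := @rat_in_itvoo R (x - i.+1%:R^-1) (x + i.+1%:R^-1)
  ltac:(by rewrite ltrD2l gtrN).
rewrite in_itv/= => /andP[q1 q2].
have bq : `|x - ratr q| < i.+1%:R^-1 :> R.
  move: q1 q2; set d : R := i.+1%:R^-1 => q1 q2.
  by rewrite ltr_norml; apply/andP; split; lra.
exists (pickle (q, i)); rewrite pickleK; split => /=; first by rewrite /ball/= distrC.
move=> y; rewrite /ball/= => yq; apply: eU; rewrite /ball/=.
rewrite (_ : x - y = (x - ratr q) + (ratr q - y)); last by ring.
rewrite (le_lt_trans (ler_normD _ _))// (lt_le_trans (ltrD bq yq))//.
by rewrite [leRHS]splitr lerD.
Qed.

Lemma rV_rat_dense n (x : 'rV[R]_n) (e : R) : 0 < e ->
  exists q : 'rV[rat]_n, ball x e (map_mx ratr q).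
Proof.
move=> e0.
have /choice[q qx] : forall i, exists q, ratr q \in `](x ord0 i - e), (x ord0 i + e)[.
  by move=> i; have [//|q] := @rat_in_itvoo R (x ord0 i - e) (x ord0 i + e);
   [rewrite ltrD2l gtrN|exists q].
exists (\row_i q i); rewrite rV_ballE// => i; rewrite !mxE /ball/=.
by have := qx i; rewrite in_itv/= => /andP[? ?]; rewrite ltr_norml; apply/andP; split; lra.
Qed.

Lemma countable_base_rV n : @countable_base 'rV[R]_n measurable.
Proof.
exists (fun k => if unpickle k is Some (q, i) then
   ball (map_mx ratr (q : 'rV[rat]_n) : 'rV[R]_n) (i.+1%:R^-1) else set0); split.
  by move=> k; case: unpickle => [[q i]|//]; exact: measurable_ball_rV.
move=> U x oU Ux.
have : nbhs x U by exact: open_nbhs_nbhs.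
move=> /nbhs_ballP[e /= e0 eU].
have e20 : 0 < e / 2 by rewrite divr_gt0.
have [i /ltW ie] : exists i, (i.+1%:R^-1 : R) < e / 2.
  have /cvgrPdist_lt/(_ _ e20)[i _ /(_ i (leqnn _))] := @cvg_harmonic R.
  by rewrite sub0r normrN gtr0_norm ?invr_gt0//; exists i.
have i0 : 0 < (i.+1%:R^-1 : R) by rewrite invr_gt0.
have [q qx] := rV_rat_dense x i0.
exists (pickle (q, i)); rewrite pickleK; split => /=; first exact: ball_sym.
move=> y yq; apply: eU.
have := ball_triangle (le_ball ie qx) (le_ball ie yq).
by rewrite -splitr.
Qed.

Lemma measurable_bigcup_nat d (T : measurableType d) (F : (set T)^nat) :
  (forall k, measurable (F k)) -> measurable (\bigcup_k F k).
Proof. by move=> mF; apply: bigcup_measurable. Qed.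

Lemma open_measurable_rV n (U : set 'rV[R]_n) : open U -> measurable U.
Proof.
exact: (countable_base_open (countable_base_rV n) measurable0
  (@measurable_bigcup_nat _ _)).
Qed.

Lemma countable_base_rVR n : @countable_base ('rV[R]_n * R)%type measurable.
Proof.
apply: countable_baseX (countable_base_rV n) countable_base_R => A B mA mB.
exact: measurableX.
Qed.

Lemma open_measurable_rVrV n m (U : set ('rV[R]_n * 'rV[R]_m)) :
  open U -> measurable U.
Proof.
have H := @countable_base_open ('rV[R]_n * 'rV[R]_m)%type measurable.
move: U; apply: H => //; last exact: measurable_bigcup_nat.
apply: countable_baseX (countable_base_rV n) (countable_base_rV m) => A B mA mB.
exact: measurableX.
Qed.

Lemma countable_base_rVRrV n :
  @countable_base ('rV[R]_n * R * 'rV[R]_n)%type measurable.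
Proof.
apply: countable_baseX (countable_base_rVR n) (countable_base_rV n) => A B mA mB.
exact: measurableX.
Qed.

Lemma closed_measurable_rV n (U : set 'rV[R]_n) : closed U -> measurable U.
Proof.
by move=> /closed_openC/open_measurable_rV/measurableC; rewrite setCK.
Qed.

Lemma continuous_measurable_rV n (f : 'rV[R]_n -> R) : continuous f ->
  measurable_fun setT f.
Proof.
move=> cf; apply: (measurability _ (RGenOpens.measurableE R)) => _ [_ [a [b ->] <-]].
rewrite setTI; apply: open_measurable_rV; apply: open_comp; last exact: interval_open.
by move=> x _; exact: cf.
Qed.

Lemma measurable_rV_sigma n : @measurable _ 'rV[R]_n =
  <<s [set B | exists2 A : 'I_n -> set R, forall i, measurable (A i) &
       B = [set x : 'rV[R]_n | forall i, A i (x ord0 i)] ] >>.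
Proof.
apply/seteqP; split; last first.
  apply: smallest_sub; first exact: sigma_algebra_measurable.
  by move=> _ [A mA ->]; exact: measurable_rV_box.
apply: smallest_sub; first exact: smallest_sigma_algebra.
rewrite -bigcup_seq; apply: bigcup_sub => i _ A [B mB <-].
apply: sub_sigma_algebra; exists (fun j => if j == i then B else setT).
  by move=> j; case: ifP.
apply/seteqP; split => x /=.
  by move=> [_ Bx] j; case: ifPn => // /eqP ->.
by move=> /(_ i); rewrite eqxx.
Qed.

(** Boxes are stable under intersection, and balls, being boxes for the sup
    norm, exhaust the space. *)
Lemma measure_unique_rV n (m1 m2 : {measure set 'rV[R]_n -> \bar R}) :
  (forall A : 'I_n -> set R, (forall i, measurable (A i)) ->
    m1 [set x | forall i, A i (x ord0 i)] = m2 [set x | forall i, A i (x ord0 i)]) ->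
  (forall k, m1 (ball (0%R : 'rV[R]_n) k.+1%:R%R) < +oo)%E ->
  forall A, measurable A -> m1 A = m2 A.
Proof.
move=> m12 m1oo.
apply: (@measure_unique _ R _ _ (fun k => ball (0 : 'rV[R]_n) k.+1%:R)
  (measurable_rV_sigma n)) => //.
- move=> _ _ [A mA ->] [B mB ->]; exists (fun i => A i `&` B i).
    by move=> i; exact: measurableI.
  apply/seteqP; split => x /=; first by move=> [Ax Bx] i; split.
  by move=> ABx; split => i; have [] := ABx i.
- move=> k; exists (fun i => ball ((0 : 'rV[R]_n) ord0 i) k.+1%:R); last by rewrite rV_ballE.
  by move=> i; exact: measurable_ball_R.
- apply/seteqP; split => // x _.
  have [k xk] : exists k : nat, `|x| < k.+1%:R.
    exists (Num.truncn `|x|); exact: truncnS_gt.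
  by exists k => //; rewrite mx_norm_ball/ball_/= sub0r normrN.
- by move=> _ [A mA ->]; exact: m12.
Qed.

Lemma measurable_rV_add n (v : 'rV[R]_n) :
  measurable_fun [set: 'rV[R]_n] (fun x : 'rV[R]_n => x + v).
Proof.
apply: measurable_fun_rV => i; under eq_fun do rewrite mxE.
by apply: measurable_funD => //; exact: measurable_rV_coord.
Qed.

Lemma lebesgue_measure_translation (v : R) (A : set R) : measurable A ->
  lebesgue_measure ((fun t => t + v) @^-1` A) = lebesgue_measure A.
Proof.
have mv : measurable_fun setT (fun t : R => t + v) by exact: measurable_funD.
move=> mA; transitivity (pushforward lebesgue_measure
  ((fun t : R => t + v) : _ -> measurableTypeR R) A) => //.
apply/esym/lebesgue_measure_unique => //= _ [[a b]] _ <-.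
rewrite /pushforward.
rewrite (_ : _ @^-1` _ = `](a - v), (b - v)]%classic); last first.
  by apply/seteqP; split => x /=; rewrite !in_itv/= ltrBlDr lerBrDr.
rewrite !lebesgue_measure_itv/= !lte_fin ltrD2r; case: ifPn => // _.
by rewrite -!EFinB; congr EFin; ring.
Qed.

(** Translations permute the boxes and act on each side separately. *)
Lemma leb_translation n (v : 'rV[R]_n) (A : set 'rV[R]_n) : measurable A ->
  leb n ((fun x => x + v) @^-1` A) = leb n A.
Proof.
have mv : measurable_fun [set: 'rV[R]_n] (fun x : 'rV[R]_n => x + v).
  exact: measurable_rV_add.
move: A; apply: (@measure_unique_rV n 
  (push (leb n) (mfun_of mv)) (leb n)) => /=.
  move=> A mA; rewrite /push /pushforward.
  rewrite [X in leb n X = _](_ : _ = [set x : 'rV[R]_n |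
     forall i, [set t | A i (t + v ord0 i)] (x ord0 i)]); last first.
    by apply/seteqP; split => x /= h i; have := h i; rewrite mxE.
  have mA' i : measurable [set t | A i (t + v ord0 i)].
    rewrite -[X in measurable X]setTI.
    have mi : measurable_fun setT (fun t : R => t + v ord0 i) by exact: measurable_funD.
    exact: (mi measurableT _ (mA i)).
  rewrite (leb_box (A := A))// (leb_box (A := fun i => [set t | A i (t + v ord0 i)]))//.
  by apply: eq_bigr => i _; exact: lebesgue_measure_translation.
move=> k; rewrite /push /pushforward.
rewrite [X in leb n X](_ : _ = ball (- v) k.+1%:R); last first.
  by apply/seteqP; split => x; rewrite /= !mx_norm_ball /ball_/= sub0r -opprD addrC.
by rewrite leb_ball ?ltry.
Qed.

End rV_borel.

(** * Bounded measurable functions *)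

Section bounded_measurable.
Context d (T : measurableType d) (R : realType).
Implicit Types (f g : T -> R) (A : set T).

(** Against a finite measure every such function is integrable, so that
    integrals below are real numbers and linear without side conditions. *)
Definition bmf f := measurable_fun setT f /\ exists C, forall x, `|f x| <= C.

Lemma bmf_meas f : bmf f -> measurable_fun setT f. Proof. by case. Qed.

Lemma bmf_cst (c : R) : bmf (fun=> c).
Proof. by split; [exact: measurable_cst|exists `|c|]. Qed.

Lemma bmfD f g : bmf f -> bmf g -> bmf (fun x => f x + g x).
Proof.
move=> [mf [C fC]] [mg [D gD]]; split; first exact: measurable_funD.
by exists (C + D) => x; rewrite (le_trans (ler_normD _ _))// lerD.
Qed.

Lemma bmfM f g : bmf f -> bmf g -> bmf (fun x => f x * g x).
Proof.
move=> [mf [C fC]] [mg [D gD]]; split; first exact: measurable_funM.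
by exists (C * D) => x; rewrite normrM ler_pM.
Qed.

Lemma bmfN f : bmf f -> bmf (fun x => - f x).
Proof.
move=> [mf [C fC]]; split; first exact: measurableT_comp.
by exists C => x; rewrite normrN.
Qed.

Lemma bmfB f g : bmf f -> bmf g -> bmf (fun x => f x - g x).
Proof. by move=> hf hg; apply: bmfD => //; exact: bmfN. Qed.

Lemma bmf_indic A : measurable A -> bmf (\1_A).
Proof.
move=> mA; split; first exact: measurable_indic.
by exists 1 => x; rewrite indicE; case: (_ \in _); rewrite ?normr1 ?normr0.
Qed.

Lemma bmf_sum (I : Type) (s : seq I) (F : I -> T -> R) :
  (forall i, bmf (F i)) -> bmf (fun x => \sum_(i <- s) F i x).
Proof.
move=> bF; elim: s => [|i s IH].
  by under eq_fun do rewrite big_nil; exact: bmf_cst.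
by under eq_fun do rewrite big_cons; exact: bmfD.
Qed.

End bounded_measurable.

Lemma bmf_comp d1 d2 (T1 : measurableType d1) (T2 : measurableType d2)
    (R : realType) (f : T2 -> R) (p : T1 -> T2) :
  bmf f -> measurable_fun setT p -> bmf (f \o p).
Proof.
move=> [mf [C fC]] mp; split; first exact: measurableT_comp.
by exists C => x; exact: fC.
Qed.

Section bounded_integral.
Context d (T : measurableType d) (R : realType)
  (m : {finite_measure set T -> \bar R}).
Implicit Types (f g : T -> R) (A : set T).

Lemma bmf_integrable A f : measurable A -> bmf f -> m.-integrable A (EFin \o f).
Proof.
move=> mA [mf [C fC]]; apply: measurable_bounded_integrable => //.
- by rewrite -ge0_fin_numE// fin_num_measure.
- exact: measurable_funTS.
- exists C; split; first exact: num_real.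
  by move=> D CD x _ /=; rewrite (le_trans (fC x))// ltW.
Qed.

Lemma bintD f g : bmf f -> bmf g ->
  \int[m]_x (f x + g x) = \int[m]_x f x + \int[m]_x g x.
Proof. by move=> hf hg; apply: RintegralD => //; exact: bmf_integrable. Qed.

Lemma bintB f g : bmf f -> bmf g ->
  \int[m]_x (f x - g x) = \int[m]_x f x - \int[m]_x g x.
Proof. by move=> hf hg; apply: RintegralB => //; exact: bmf_integrable. Qed.

Lemma bintZl c f : bmf f -> \int[m]_x (c * f x) = c * \int[m]_x f x.
Proof. by move=> hf; apply: RintegralZl => //; exact: bmf_integrable. Qed.

Lemma bintN f : bmf f -> \int[m]_x (- f x) = - \int[m]_x f x.
Proof.
move=> hf; rewrite -mulN1r -bintZl//.
by apply: eq_Rintegral => x _; rewrite mulN1r.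
Qed.

Lemma bint_sum (I : Type) (s : seq I) (F : I -> T -> R) :
  (forall i, bmf (F i)) ->
  \int[m]_x (\sum_(i <- s) F i x) = \sum_(i <- s) \int[m]_x F i x.
Proof.
move=> bF; elim: s => [|i s IH].
  rewrite big_nil; under eq_Rintegral do rewrite big_nil.
  by rewrite Rintegral_cst// mul0r.
rewrite big_cons -IH -bintD//; last exact: bmf_sum.
by apply: eq_Rintegral => x _; rewrite big_cons.
Qed.

Lemma bint_cst c : \int[m]_x c = c * fine (m setT).
Proof. by rewrite Rintegral_cst. Qed.

Lemma bint_le f g : bmf f -> bmf g -> (forall x, f x <= g x) ->
  \int[m]_x f x <= \int[m]_x g x.
Proof. by move=> hf hg fg; apply: le_Rintegral => //; exact: bmf_integrable. Qed.

Lemma bint_norm f : bmf f -> `|\int[m]_x f x| <= \int[m]_x `|f x|.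
Proof. by move=> hf; apply: le_normr_Rintegral => //; exact: bmf_integrable. Qed.

Lemma bmf_norm f : bmf f -> bmf (fun x => `|f x|).
Proof.
move=> [mf [C fC]]; split; first exact: measurableT_comp.
by exists C => x; rewrite normr_id.
Qed.

Lemma bint_norm_le f (C : R) : bmf f -> (forall x, `|f x| <= C) ->
  `|\int[m]_x f x| <= C * fine (m setT).
Proof.
move=> hf fC; rewrite (le_trans (bint_norm hf))// -bint_cst.
by apply: bint_le => //; [exact: bmf_norm|exact: bmf_cst].
Qed.

Lemma bint_indic A : measurable A -> \int[m]_x (\1_A x) = fine (m A).
Proof. by move=> mA; rewrite /Rintegral integral_indic// setIT. Qed.

Lemma bint_indicM A f : measurable A -> 
  \int[m]_x (f x * \1_A x) = \int[m]_(x in A) f x.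
Proof.
move=> mA; rewrite [RHS]Rintegral_mkcond; apply: eq_Rintegral => x _.
by rewrite patchE indicE; case: (_ \in _); rewrite ?mulr1 ?mulr0.
Qed.

Lemma bint_EFin A f : measurable A -> bmf f ->
  (\int[m]_(x in A) f x)%:E = (\int[m]_(x in A) (f x)%:E)%E.
Proof.
move=> mA hf; rewrite /Rintegral fineK//.
by apply: integrable_fin_num => //; exact: bmf_integrable.
Qed.

Lemma bint_cvg (f_ : (T -> R)^nat) f (C : R) :
  (forall k, measurable_fun setT (f_ k)) -> (forall k x, `|f_ k x| <= C) ->
  (forall x, f_ ^~ x @ \oo --> f x) ->
  \int[m]_x f_ k x @[k --> \oo] --> \int[m]_x f x.
Proof.
move=> mf fC ff.
have C0 : bmf (fun x : T => C) by exact: bmf_cst.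
apply: fine_cvg; rewrite /= fineK; last first.
  apply: integrable_fin_num => //; apply: bmf_integrable => //; split.
    by apply: (measurable_fun_cvg (h := f_)) => // x _; exact: ff.
  exists C => x; have /cvg_norm fx := ff x.
  rewrite -(cvg_lim _ fx)//; apply: limr_le; first by apply/cvg_ex; eexists; exact: fx.
  by apply: nearW => k /=; exact: fC.
apply: (@dominated_cvg _ _ _ m _ measurableT (fun k x => (f_ k x)%:E) _ (EFin \o cst C)) => //.
- by move=> k; exact/measurable_EFinP.
- by move=> x _; apply: cvg_EFin; [exact: nearW|exact: ff].
- exact: bmf_integrable.
- by move=> k x _ /=; rewrite lee_fin.
Qed.

End bounded_integral.

Lemma bint_push d1 d2 (T1 : measurableType d1) (T2 : measurableType d2)
    (R : realType) (m : {finite_measure set T1 -> \bar R})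
    (p : {mfun T1 >-> T2}) (f : T2 -> R) : bmf f ->
  \int[push m p]_y f y = \int[m]_x f (p x).
Proof.
move=> hf; rewrite /Rintegral /push integral_pushforward//.
- exact/measurable_EFinP/bmf_meas.
- by rewrite preimage_setT; apply: (bmf_integrable _ measurableT); exact: bmf_comp.
Qed.

Section bounded_fubini.
Context d1 d2 (T1 : measurableType d1) (T2 : measurableType d2) (R : realType).
Variables (m1 : {finite_measure set T1 -> \bar R})
  (m2 : {finite_measure set T2 -> \bar R}).

(** The product with its finiteness recorded as an instance. *)
Definition finite_prod : set (T1 * T2) -> \bar R := (m1 \x m2)%E.

HB.instance Definition _ := Measure.on finite_prod.

Let fprod_fin : fin_num_fun finite_prod.
Proof.
move=> A mA; rewrite ge0_fin_numE//.
rewrite (@le_lt_trans _ _ (finite_prod (setT `*` setT))%E)//.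
  by apply: le_measure => //; rewrite ?inE//; exact: measurableX.
rewrite /finite_prod product_measure1E//.
by rewrite -ge0_fin_numE ?mule_ge0// fin_numM// fin_num_measure.
Qed.

HB.instance Definition _ := Measure_isFinite.Build _ _ _ finite_prod fprod_fin.

Lemma bmf_section1 (f : T1 * T2 -> R) x : bmf f -> bmf (fun y => f (x, y)).
Proof.
move=> [mf [C fC]]; split; last by exists C => y; exact: fC.
by apply: (measurableT_comp mf); exact: measurable_pair1.
Qed.

Lemma bmf_section2 (f : T1 * T2 -> R) y : bmf f -> bmf (fun x => f (x, y)).
Proof.
move=> [mf [C fC]]; split; last by exists C => x; exact: fC.
by apply: (measurableT_comp mf); exact: measurable_pair2.
Qed.

Lemma bmf_int2 (f : T1 * T2 -> R) : bmf f -> bmf (fun y => \int[m1]_x f (x, y)).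
Proof.
move=> hf; split; last first.
  have [_ [C fC]] := hf; exists (C * fine (m1 setT)) => x.
  by apply: bint_norm_le => //; exact: bmf_section2.
have := measurable_fubini_G (bmf_integrable finite_prod measurableT hf).
move=> mF; rewrite /Rintegral.
by apply: measurableT_comp => //.
Qed.

Lemma bint_fubini1 (f : T1 * T2 -> R) : bmf f ->
  \int[finite_prod]_z f z = \int[m1]_x \int[m2]_y f (x, y).
Proof.
move=> hf; rewrite {1}/Rintegral /finite_prod.
rewrite -(integral12_prod_meas1 (bmf_integrable finite_prod measurableT hf)).
rewrite /fubini_F /Rintegral; congr fine; apply: eq_integral => x _.
rewrite fineK//; apply: integrable_fin_num => //.
by apply: (bmf_integrable _ measurableT); exact: bmf_section1.
Qed.

Lemma bint_fubini2 (f : T1 * T2 -> R) : bmf f ->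
  \int[finite_prod]_z f z = \int[m2]_y \int[m1]_x f (x, y).
Proof.
move=> hf; rewrite {1}/Rintegral /finite_prod.
rewrite -(integral21_prod_meas1 (bmf_integrable finite_prod measurableT hf)).
rewrite /fubini_G /Rintegral; congr fine; apply: eq_integral => x _.
rewrite fineK//; apply: integrable_fin_num => //.
by apply: (bmf_integrable _ measurableT); exact: bmf_section2.
Qed.

End bounded_fubini.

(** * Duality and weak limits of bounded functions *)

Section finite_restriction.
Context d (T : measurableType d) {R : realType} (m : {finite_measure set T -> \bar R}).
Variables (D : set T) (mD : measurable D).

Definition frestr : set T -> \bar R := mrestr m mD.

HB.instance Definition _ := Measure.on frestr.

Let frestr_fin : fin_num_fun frestr.
Proof. by move=> A mA; rewrite /frestr /mrestr fin_num_measure//; exact: measurableI. Qed.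

HB.instance Definition _ := Measure_isFinite.Build _ _ _ frestr frestr_fin.

End finite_restriction.

Section determining.
Context {R : realType}.

(** Used in place of generating pi-systems because it passes to products and, by
    a limit, from all quadrants to the rational ones. *)
Definition determining d (T : measurableType d) (G : set_system T) :=
  G `<=` measurable /\ forall m1 m2 : {finite_measure set T -> \bar R},
    (forall A, G A -> m1 A = m2 A) -> forall A, measurable A -> m1 A = m2 A.

Section product.
Context d1 d2 (T1 : measurableType d1) (T2 : measurableType d2).

(** One factor at a time: for a fixed B in the second class, A |-> m (A x B) is
    a finite measure, to which the first class applies. *)
Lemma determiningX (G1 : set_system T1) (G2 : set_system T2) :
  determining G1 -> determining G2 ->
  determining [set C : set (T1 * T2) | exists A B, [/\ G1 A, G2 B & C = A `*` B]].
Proof.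
move=> [mG1 dG1] [mG2 dG2]; split.
  by move=> _ [A [B [GA GB ->]]]; apply: measurableX; [exact: mG1|exact: mG2].
move=> m1 m2 m12.
have h1 B : G2 B -> forall A, measurable A -> m1 (A `*` B) = m2 (A `*` B).
  move=> GB A mA.
  have mB : measurable ([set: T1] `*` B) by apply: measurableX => //; exact: mG2.
  have e (m : {finite_measure set (T1 * T2)%type -> \bar R}) A' :
      push (frestr m mB) (mfun_of measurable_fst) A' = m (A' `*` B).
    rewrite /push /pushforward /= /frestr /mrestr; congr (m _).
    by apply/seteqP; split => -[a b] /=; tauto.
  rewrite -2!e; apply: dG1 => // A' GA'.
  by transitivity (m1 (A' `*` B)); [exact: e|rewrite m12; [exact/esym/e|exists A', B]].
have h2 A B : measurable A -> measurable B -> m1 (A `*` B) = m2 (A `*` B).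
  move=> mA' mB.
  have mA : measurable (A `*` [set: T2]) by exact: measurableX.
  have e (m : {finite_measure set (T1 * T2)%type -> \bar R}) B' :
      push (frestr m mA) (mfun_of measurable_snd) B' = m (A `*` B').
    rewrite /push /pushforward /= /frestr /mrestr; congr (m _).
    by apply/seteqP; split => -[a b] /=; tauto.
  rewrite -2!e; apply: dG2 => // B' GB'.
  by transitivity (m1 (A `*` B')); [exact: e|rewrite h1//; exact/esym/e].
apply: (@measure_unique _ R _
  [set C : set (T1 * T2) | exists A B, [/\ measurable A, measurable B & C = A `*` B]]
  (fun=> setT)).
- rewrite measurable_prod_measurableType; congr (<<s _ >>).
  apply/seteqP; split => C /=.
    by move=> [A mA [B mB <-]]; exists A, B.
  by move=> [A [B [mA mB ->]]]; exists A => //; exists B.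
- move=> _ _ [A [B [mA mB ->]]] [A' [B' [mA' mB' ->]]].
  exists (A `&` A'), (B `&` B'); split; [exact: measurableI..|].
  by rewrite setXI.
- by move=> _; exists setT, setT; split => //; rewrite setXTT.
- by rewrite bigcup_const.
- by move=> _ [A [B [mA mB ->]]]; exact: h2.
- by move=> _; rewrite -ge0_fin_numE// fin_num_measure.
Qed.

End product.

Lemma determining_measurable d (T : measurableType d) :
  determining (@measurable _ T).
Proof. by split. Qed.

Lemma determining_R : determining [set A : set R | exists a, A = [set x | x < a]].
Proof.
have E a : [set x | x < a] = `]-oo, a[%classic :> set R.
  by apply/seteqP; split => x; rewrite /= in_itv.
split; first by move=> _ [a ->]; rewrite E.
move=> m1 m2 m12.
apply: (@measure_unique _ R _ (@RGenInftyO.G R) (fun k => `]-oo, k%:R[%classic)).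
- exact: RGenInftyO.measurableE.
- move=> _ _ [a ->] [b ->]; exists (Num.min a b).
  by apply/seteqP; split => x; rewrite /= !in_itv/= lt_min => /andP.
- by move=> k; exists k%:R.
- apply/seteqP; split => // x _; exists (Num.truncn `|x|).+1 => //=.
  by rewrite in_itv/= (le_lt_trans (ler_norm _))// truncnS_gt.
- by move=> _ [a ->]; rewrite -E; apply: m12; exists a.
- by move=> k; rewrite -ge0_fin_numE// fin_num_measure.
Qed.

(** A half-space is an increasing union of quadrants, whose other corners tend
    to infinity. *)
Lemma determining_rV n : determining [set A : set 'rV[R]_n |
  exists a : 'I_n -> R, A = [set x | forall i, x ord0 i < a i]].
Proof.
have mG (a : 'I_n -> R) : measurable [set x : 'rV[R]_n | forall i, x ord0 i < a i].
  have mi i : measurable [set t : R | t < a i].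
    have -> : [set t : R | t < a i] = `]-oo, (a i)[%classic; last by [].
    by apply/seteqP; split => t; rewrite /= in_itv.
  exact: (measurable_rV_box mi).
split; first by move=> _ [a ->]; exact: mG.
move=> m1 m2 m12.
set G := [set A | exists _, _] in m12 *.
apply: (@measure_unique _ R _ G (fun k => [set x | forall i, x ord0 i < k%:R])).
- apply/seteqP; split; last first.
    apply: smallest_sub; first exact: sigma_algebra_measurable.
    by move=> _ [a ->]; exact: mG.
  apply: smallest_sub; first exact: smallest_sigma_algebra.
  rewrite -bigcup_seq; apply: bigcup_sub => i _ A [B mB <-]; rewrite setTI.
  have : (@RGenInftyO.G R).-sigma.-measurable B by rewrite -RGenInftyO.measurableE.
  move: B {mB}; apply: smallest_sub.
    split => /=.
    + by rewrite preimage_set0; exact: sigma_algebra0.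
    + by move=> C mC; rewrite setTD preimage_setC -setTD; exact: sigma_algebraCD.
    + by move=> F mF; rewrite preimage_bigcup; exact: sigma_algebra_bigcup.
  move=> _ [a ->] /=.
  rewrite (_ : _ @^-1` _ = \bigcup_k
    [set x : 'rV[R]_n | forall j, x ord0 j < if j == i then a else k%:R]).
    apply: sigma_algebra_bigcup => k; apply: sub_sigma_algebra.
    by exists (fun j => if j == i then a else k%:R).
  apply/seteqP; split => x /=; rewrite in_itv/=.
    move=> xa; exists (Num.truncn `|x|).+1 => //= j; case: ifPn => [/eqP ->//|_].
    rewrite (le_lt_trans (ler_norm _))// (le_lt_trans _ (truncnS_gt _))//.
    rewrite [leRHS]mx_normrE; exact: (le_bigmax _ _ (ord0, j)).
  by move=> [k _ /(_ i)]; rewrite eqxx.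
- move=> _ _ [a ->] [b ->]; exists (fun i => Num.min (a i) (b i)).
  apply/seteqP; split => x /=.
    by move=> [xa xb] i; rewrite lt_min xa xb.
  by move=> h; split => i; have := h i; rewrite lt_min => /andP[].
- by move=> k; exists (fun=> k%:R).
- apply/seteqP; split => // x _; exists (Num.truncn `|x|).+1 => //= i.
  rewrite (le_lt_trans (ler_norm _))// (le_lt_trans _ (truncnS_gt _))//.
  by rewrite [leRHS]mx_normrE; exact: (le_bigmax _ _ (ord0, i)).
- exact: m12.
- by move=> k; rewrite -ge0_fin_numE//; apply: fin_num_measure; exact: mG.
Qed.

End determining.

Section density.
Context d (T : measurableType d) (R : realType) (m : {measure set T -> \bar R}).
Local Open Scope ereal_scope.
(** The proofs of integrability and positivity are arguments, so that the finite
    measure structure can be inferred from them. *)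
Definition density_of (f : T -> \bar R) of m.-integrable setT f & (forall x, 0 <= f x) :
  set T -> \bar R := fun A => \int[m]_(x in A) f x.

Variables (f : T -> \bar R) (intf : m.-integrable setT f) (f0 : forall x, 0 <= f x).
Local Notation density := (density_of intf f0).

Let density0 : density set0 = 0. Proof. exact: integral_set0. Qed.
Let density_ge0 A : 0 <= density A. Proof. exact: integral_ge0. Qed.
Let density_sigma_additive : semi_sigma_additive density.
Proof.
by apply: semi_sigma_additive_nng_induced => //; exact: (measurable_int m).
Qed.

HB.instance Definition _ := isMeasure.Build _ _ _ density
  density0 density_ge0 density_sigma_additive.

Let density_fin : fin_num_fun density.
Proof.
move=> A mA; apply: integrable_fin_num => //; exact: integrableS intf.
Qed.

HB.instance Definition _ := Measure_isFinite.Build _ _ _ density density_fin.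

End density.

Section ae_zero.
Context d (T : measurableType d) (R : realType) (m : {measure set T -> \bar R}).
Local Open Scope ereal_scope.

(** The positive and the negative part of the difference are densities of two
    finite measures which agree on the determining class. *)
Lemma ae_eq_determining (G : set_system T) (D : set T) (f g : T -> R) :
  @determining R _ T G -> measurable D ->
  m.-integrable D (EFin \o f) -> m.-integrable D (EFin \o g) ->
  (forall A, G A -> \int[m]_(x in A `&` D) (f x)%:E = \int[m]_(x in A `&` D) (g x)%:E) ->
  {ae m, forall x, D x -> f x = g x}.
Proof.
move=> [mG dG] mD intf intg fg.
pose H := (fun x => (f x)%:E - (g x)%:E) \_ D.
have iH : m.-integrable setT H.
  by apply/(integrable_mkcond _ mD).1; exact: integrableB.
have HA A : G A -> \int[m]_(x in A) H x = 0.
  move=> GA; have mA := mG _ GA.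
  rewrite /H -integral_mkcondr integralB.
  - by rewrite fg// subee//; apply: integrable_fin_num => //;
      [exact: measurableI|apply: integrableS intg => //; exact: measurableI].
  - exact: measurableI.
  - by apply: integrableS intf => //; exact: measurableI.
  - by apply: integrableS intg => //; exact: measurableI.
have iHp : m.-integrable setT H^\+ by exact: integrable_funepos.
have iHn : m.-integrable setT H^\- by exact: integrable_funeneg.
have pn A : measurable A -> \int[m]_(x in A) H^\+ x = \int[m]_(x in A) H^\- x.
  move=> mA; rewrite -[LHS]/(density_of iHp (fun x => @funepos_ge0 _ _ H x) A).
  rewrite -[RHS]/(density_of iHn (fun x => @funeneg_ge0 _ _ H x) A).
  move: A mA; apply: dG => A GA /=.
  have := HA A GA; rewrite integralE => /eqP; rewrite sube_eq ?add0e//.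
  - by move=> /eqP.
  - apply: integrable_fin_num; [exact: mG|by apply: integrableS iHp => //; exact: mG].
have : ae_eq m setT H (cst 0).
  apply: integral_ae_eq => // A _ mA.
  rewrite integral0 integralE pn// subee//; apply: integrable_fin_num => //.
  exact: integrableS iHn.
apply: filterS => x /= /(_ I) + Dx; rewrite /H patchE mem_set// => /eqP.
by rewrite -EFinB eqe subr_eq0 => /eqP.
Qed.

End ae_zero.

Section restr_integral.
Context d (T : measurableType d) {R : realType} (m : {measure set T -> \bar R}).
Variables (D : set T) (mD : measurable D).
Local Open Scope ereal_scope.

Lemma ge0_integral_mrestr (f : T -> \bar R) : measurable_fun setT f ->
  (forall x, 0 <= f x) -> \int[mrestr m mD]_x f x = \int[m]_(x in D) f x.
Proof.
move=> mf f0.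
rewrite (@ge0_negligible_integral _ _ _ (mrestr m mD) setT (~` D))//.
- rewrite setTD setCK; apply: eq_measure_integral => A mA AD.
  by rewrite -[LHS]/(m (A `&` D)) setIidl.
- exact: measurableC.
- by rewrite -[LHS]/(m (~` D `&` D)) setICl measure0.
Qed.

Lemma integrable_mrestr (f : T -> \bar R) : measurable_fun setT f ->
  (mrestr m mD).-integrable setT f <-> m.-integrable D f.
Proof.
move=> mf; split => /integrableP[_ h]; apply/integrableP; split => //.
- exact: measurable_funTS.
- by rewrite -ge0_integral_mrestr//; exact: measurableT_comp.
- by rewrite ge0_integral_mrestr//; exact: measurableT_comp.
Qed.

Lemma integral_mrestr (f : T -> \bar R) : measurable_fun setT f ->
  \int[mrestr m mD]_x f x = \int[m]_(x in D) f x.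
Proof.
move=> mf; rewrite [LHS]integralE [RHS]integralE; congr (_ - _).
- by rewrite ge0_integral_mrestr//; exact: measurable_funepos.
- by rewrite ge0_integral_mrestr//; exact: measurable_funeneg.
Qed.

End restr_integral.

Section dominated_density.
Context d (T : measurableType d) (R : realType).
Variables (m l : {finite_measure set T -> \bar R}) (C : R).
Hypothesis lm : forall A, measurable A -> (l A <= C%:E * m A)%E.

(** The Radon-Nikodym derivative f exceeds C only on a null set, since the
    integral of f - C over the set where f > C is at most 0. Truncating f at C
    makes the bound hold everywhere. *)
Lemma dominated_density : 0 <= C -> exists2 g : T -> R,
  measurable_fun setT g /\ (forall x, 0 <= g x <= C) &
  forall A, measurable A -> fine (l A) = \int[m]_(x in A) g x.
Proof.
move=> C0.
have dom : l `<< m.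
  move=> N N0 A mA AN; apply/eqP; rewrite -measure_le0.
  by rewrite (le_trans (lm mA))// (N0 _ mA AN) mule0.
have [f [f0 intf lf]] := radon_nikodym_finite dom.
have mf := measurable_int _ intf.
pose g x := fine (mine (f x) C%:E).
have mg : measurable_fun setT g.
  by apply: measurableT_comp => //; exact: measurable_mine.
have gE x : (g x)%:E = mine (f x) C%:E.
  rewrite /g fineK// ge0_fin_numE; last by rewrite le_min f0 lee_fin.
  by rewrite gt_min ltry orbT.
have gC x : 0 <= g x <= C.
  by rewrite -!lee_fin gE le_min f0 lee_fin C0/= ge_min lexx orbT.
exists g => // A mA.
suff -> : l A = (\int[m]_(x in A) (g x)%:E)%E by [].
rewrite lf//; apply: ae_eq_integral => //.
- exact: measurable_funTS.
- exact/measurable_EFinP/measurable_funTS.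
suff : m [set x | C%:E < f x]%E = 0%E.
  move=> N0; exists [set x | C%:E < f x]%E; split => //.
    by rewrite -[X in measurable X]setTI; exact: emeasurable_fun_o_infty.
  move=> x /=; apply: contra_notP => /negP; rewrite -leNgt => fC _.
  by rewrite gE; apply/esym/min_idPl.
have mA' : measurable [set x | C%:E < f x]%E.
  by rewrite -[X in measurable X]setTI; exact: emeasurable_fun_o_infty.
have itf B : measurable B -> m.-integrable B f by move=> mB; exact: integrableS intf.
have itC B : measurable B -> m.-integrable B (cst C%:E).
  by move=> mB; apply: (bmf_integrable _ mB); exact: bmf_cst.
have fC_ge0 x : (C%:E < f x)%E -> (0 <= f x - C%:E)%E.
  by move=> /ltW fx; rewrite sube_ge0// fin_numE.
have : ae_eq m [set x | C%:E < f x]%E (fun x => f x - C%:E)%E (cst 0%E).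
  apply/(ae_eq_integral_abs m mA' _).1.
    apply: emeasurable_funB; exact: measurable_funTS.
  transitivity (\int[m]_(x in [set x | C%:E < f x]) (f x - C%:E))%E.
    apply: eq_integral => x; rewrite inE /= => fx.
    by rewrite gee0_abs//; exact: fC_ge0.
  apply/eqP; rewrite eq_le; apply/andP; split; last first.
    by apply: integral_ge0 => x fx; exact: fC_ge0.
  rewrite integralB//; [|exact: itf|exact: itC].
  rewrite -lf// integral_cst// sube_le0 ?lm//.
move=> [N [mN N0 hN]]; apply: (subset_measure0 mA' mN) => // x Ax.
apply: hN => /= /(_ Ax) h; move: (Ax : (C%:E < f x)%E).
have : (f x - C%:E + C%:E = 0 + C%:E)%E by rewrite h.
by rewrite subeK// add0e => ->; rewrite ltxx.
Qed.

End dominated_density.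

Section L1_dual.
Context d (T : measurableType d) (R : realType).
Variables (m : {finite_measure set T -> \bar R}) (La : (T -> R) -> R) (C : R).
Hypothesis C0 : 0 <= C.
Hypothesis LaD : forall h1 h2, bmf h1 -> bmf h2 ->
  La (fun x => h1 x + h2 x) = La h1 + La h2.
Hypothesis LaZ : forall c h, bmf h -> La (fun x => c * h x) = c * La h.
Hypothesis La_le : forall h, bmf h -> `|La h| <= C * \int[m]_x `|h x|.

Let norm_indic A : measurable A -> \int[m]_x `|\1_A x| = fine (m A).
Proof.
move=> mA; rewrite -bint_indic//; apply: eq_Rintegral => x _.
by rewrite ger0_norm// indicE.
Qed.

(** The shift by C m makes the set function nonnegative, so that the theory of
    positive measures applies to it. *)
Let ulim A : R := La (\1_A) + C * fine (m A).

Let ulim_ge0 A : measurable A -> 0 <= ulim A.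
Proof.
move=> mA; have := La_le (bmf_indic R mA); rewrite norm_indic// ler_norml => /andP[h _].
by rewrite /ulim; lra.
Qed.

Let ulim_le A : measurable A -> ulim A <= (C + C) * fine (m A).
Proof.
move=> mA; have := La_le (bmf_indic R mA); rewrite norm_indic// ler_norml => /andP[_ h].
by rewrite /ulim mulrDl; lra.
Qed.

Let l (A : set T) : \bar R := (if `[< measurable A >] then ulim A else 0)%:E.

Let lE A : measurable A -> l A = (ulim A)%:E.
Proof. by move=> mA; rewrite /l asboolT. Qed.

Let l0 : l set0 = 0%E.
Proof.
rewrite lE//; congr EFin; apply/eqP; rewrite eq_le ulim_ge0// andbT.
by rewrite (le_trans (ulim_le _))// measure0 mulr0.
Qed.

Let l_ge0 A : (0 <= l A)%E.
Proof. by rewrite /l; case: ifP => // /asboolP mA; rewrite lee_fin ulim_ge0. Qed.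

Let ulimU A B : measurable A -> measurable B -> A `&` B = set0 ->
  ulim (A `|` B) = ulim A + ulim B.
Proof.
move=> mA mB AB0; rewrite /ulim.
have -> : \1_(A `|` B) = (fun x => \1_A x + \1_B x) :> (T -> R).
  apply/funext => x; rewrite !indicE in_setU.
  case: (boolP (x \in A)) => xA; case: (boolP (x \in B)) => xB; rewrite ?addr0 ?add0r//.
  by move: xA xB; rewrite !inE => xA xB; have : (A `&` B) x by []; rewrite AB0.
rewrite LaD; [|exact: bmf_indic..].
by rewrite measureU// fineD ?fin_num_measure// mulrDr addrACA.
Qed.

Let l_sigma_additive : semi_sigma_additive l.
Proof.
move=> F mF tF mUF.
pose S k := \big[setU/set0]_(i < k) F i.
have mS k : measurable (S k) by exact: bigsetU_measurable.
have lS k : (\sum_(0 <= i < k) l (F i))%E = (ulim (S k))%:E.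
  rewrite big_mkord /S; elim: k => [|k IH].
    by rewrite !big_ord0 -lE// l0.
  rewrite !big_ord_recr/= IH ulimU; [by rewrite lE|exact: bigsetU_measurable|exact: mF|].
  apply/seteqP; split => // x [Sx Fx].
  move: Sx; rewrite -bigcup_mkord => -[i /= ik Fix].
  have /trivIsetP/(_ i k I I) : trivIset setT F by [].
  by rewrite neq_ltn ik => /(_ isT) h; have : (F i `&` F k) x by []; rewrite h.
pose V := \bigcup_i F i.
have VS k : S k `<=` V by rewrite /S -bigcup_mkord => x [i _ Fix]; exists i.
under eq_fun do rewrite lS.
rewrite lE//; apply: cvg_EFin; first exact: nearW.
have split_V k : ulim V = ulim (S k) + ulim (V `\` S k).
  rewrite -ulimU//; [|exact: measurableD|by apply/seteqP; split => // x [? []]].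
  by rewrite setDUK.
have mVS k : fine (m (V `\` S k)) = fine (m V) - fine (m (S k)).
  rewrite measureD//; last by rewrite -ge0_fin_numE// fin_num_measure.
  rewrite setIidr// fineB// fin_num_measure//.
have mScvg : fine (m (S k)) @[k --> \oo] --> fine (m V).
  apply: fine_cvg; rewrite fineK ?fin_num_measure//.
  have := @measure_semi_sigma_additive _ _ _ m F mF tF mUF.
  under eq_fun => k.
    rewrite (_ : (\sum_(0 <= i < k) m (F i))%E = m (S k)); last first.
      by rewrite big_mkord /S measure_bigsetU.
    over.
  by [].
apply/cvgrPdist_le => e e0.
have C10 : 0 < C + C + 1 by rewrite ltr_wpDl// addr_ge0.
have eC : 0 < e / (C + C + 1) by rewrite divr_gt0.
have /cvgrPdist_le/(_ _ eC) := mScvg.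
apply: filterS => k hk /=.
rewrite (split_V k) addrC addKr ger0_norm; last by apply: ulim_ge0; exact: measurableD.
rewrite (le_trans (ulim_le _))//; first exact: measurableD.
rewrite mVS (le_trans (ler_norm _))// normrM.
rewrite (@le_trans _ _ ((C + C + 1) * (e / (C + C + 1))))//.
  by rewrite ler_pM// ger0_norm ?addr_ge0// lerDl.
by rewrite mulrC divfK// gt_eqF.
Qed.

HB.instance Definition _ := isMeasure.Build _ _ _ l l0 l_ge0 l_sigma_additive.

Let l_fin : fin_num_fun l.
Proof. by []. Qed.

HB.instance Definition _ := Measure_isFinite.Build _ _ _ l l_fin.

Import HBSimple.

(** The bound by the L^1 norm makes A |-> La 1_A + C m A a measure below 2 C m,
    hence given by a density; simple functions are dense in L^1, for which La is
    continuous. *)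
Lemma L1_dual : exists2 g : T -> R,
  measurable_fun setT g /\ (forall x, `|g x| <= C) &
  forall h, bmf h -> La h = \int[m]_x (g x * h x).
Proof.
have lm A : measurable A -> (l A <= (C + C)%:E * m A)%E.
  move=> mA; rewrite lE// -(fineK (fin_num_measure m _ mA)) -EFinM lee_fin.
  exact: ulim_le.
have [g' [mg' g0C'] gl'] := dominated_density lm (addr_ge0 C0 C0).
pose g x := g' x - C.
have mg : measurable_fun setT g by exact: measurable_funB.
have gC x : `|g x| <= C.
  by have /andP[? ?] := g0C' x; rewrite ler_norml /g; apply/andP; split; lra.
have bg' : bmf g'.
  by split => //; exists (C + C) => x; have /andP[? ?] := g0C' x; rewrite ger0_norm.
exists g => //.
have bg : bmf g by split => //; exists C.
have hindic A : measurable A -> La (\1_A) = \int[m]_x (g x * \1_A x).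
  move=> mA; have := gl' _ mA; rewrite -[X in fine X]/(l A) lE//= /ulim => e.
  have -> : \int[m]_x (g x * \1_A x) = \int[m]_x (g' x * \1_A x) - \int[m]_x (C * \1_A x).
    rewrite -bintB.
    - by apply: eq_Rintegral => x _; rewrite mulrBl.
    - by apply: bmfM => //; exact: bmf_indic.
    - by apply: bmfM; [exact: bmf_cst|exact: bmf_indic].
  rewrite [X in X - _]bint_indicM// -e bintZl; last exact: bmf_indic.
  by rewrite bint_indic// addrK.
pose P h := bmf h /\ La h = \int[m]_x (g x * h x).
have P0 : P (fun=> 0).
  split; first exact: bmf_cst.
  under eq_Rintegral do rewrite mulr0.
  rewrite bint_cst mul0r.
  have -> : (fun=> 0 : R) = (fun x : T => 0 * (cst 0 x)) by apply/funext => x; rewrite mul0r.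
  by rewrite LaZ ?mul0r//; exact: bmf_cst.
have PD h1 h2 : P h1 -> P h2 -> P (fun x => h1 x + h2 x).
  move=> [b1 e1] [b2 e2]; split; first exact: bmfD.
  rewrite LaD// e1 e2 -bintD; [|exact: bmfM..].
  by apply: eq_Rintegral => x _; rewrite mulrDr.
have PZ c h : P h -> P (fun x => c * h x).
  move=> [b1 e1]; split; first by apply: bmfM => //; exact: bmf_cst.
  rewrite LaZ// e1 -bintZl; last exact: bmfM.
  by apply: eq_Rintegral => x _; rewrite mulrCA.
have Psfun (h : {sfun T >-> R}) : P h.
  have -> : (h : T -> R) = fun x => \sum_(y <- finmap.enum_fset (fset_set (range h))) y * \1_(h @^-1` [set y]) x.
    by apply/funext => x; rewrite [LHS]fimfunE fsbig_finite.
  elim: (finmap.enum_fset _) => [|y s IH].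
    rewrite (_ : (fun x : T => _) = (fun=> 0))//; apply/funext => x; exact: big_nil.
  rewrite (_ : (fun x : T => _) = (fun x => y * \1_(h @^-1` [set y]) x +
    \sum_(y <- s) y * \1_(h @^-1` [set y]) x)); last first.
    by apply/funext => x; rewrite big_cons.
  apply: PD => //; apply: PZ; split; first exact: bmf_indic.
  exact: hindic.
move=> h bh.
have [hs [ihs hsh hs0]] := approximation_sfun_integrable measurableT
  (bmf_integrable m measurableT bh).
apply/eqP; rewrite -subr_eq0 -normr_le0; apply/ler_addgt0Pr => e e0; rewrite add0r.
have D0 : 0 < 2 * C + 1 by rewrite ltr_wpDl// mulr_ge0.
have hs0' : \int[m]_x `|h x - hs j x| @[j --> \oo] --> 0 by exact: (fine_cvg hs0).
have eD : 0 < e / (2 * C + 1) by rewrite divr_gt0.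
have /cvgrPdist_le/(_ _ eD)[j _ /(_ j (leqnn _))] := hs0'.
rewrite sub0r normrN ger0_norm; last by apply: Rintegral_ge0.
move=> hj; have [bj ej] := Psfun (hs j).
have bB : bmf (fun x => h x - hs j x) by exact: bmfB.
have -> : La h = La (hs j) + La (fun x => h x - hs j x).
  by rewrite -LaD//; congr La; apply/funext => x; rewrite addrC subrK.
have -> : \int[m]_x (g x * h x) =
    \int[m]_x (g x * hs j x) + \int[m]_x (g x * (h x - hs j x)).
  rewrite -bintD; [|exact: bmfM|exact: bmfM].
  by apply: eq_Rintegral => x _; rewrite -mulrDr addrC subrK.
rewrite ej opprD addrACA subrr add0r (le_trans (ler_normB _ _))//.
have h1 := La_le bB.
have h2 : `|\int[m]_x (g x * (h x - hs j x))| <= C * \int[m]_x `|h x - hs j x|.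
  rewrite (le_trans (bint_norm _ _))//; first exact: bmfM.
  rewrite -bintZl; last exact: bmf_norm.
  apply: bint_le; [apply: bmf_norm; exact: bmfM|apply: bmfM; [exact: bmf_cst|exact: bmf_norm]|].
  by move=> x; rewrite normrM ler_wpM2r.
rewrite (le_trans (lerD h1 h2))// -mulrDl -mulr2n -mulr_natl.
rewrite (@le_trans _ _ ((2 * C + 1) * (e / (2 * C + 1))))//; last first.
  by rewrite mulrC divfK// gt_eqF.
rewrite ler_pM//; first by rewrite mulr_ge0.
  exact: Rintegral_ge0.
by rewrite lerDl.
Qed.

End L1_dual.

(** The functional h |-> E[f h(p)] is bounded by C times the L^1 norm of h under
    the image measure. *)
Lemma conditional_expectation d1 d2 (T1 : measurableType d1)
    (T2 : measurableType d2) (R : realType)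
    (m : {finite_measure set T1 -> \bar R}) (p : {mfun T1 >-> T2})
    (f : T1 -> R) (C : R) :
  measurable_fun setT f -> (forall x, `|f x| <= C) -> 0 <= C ->
  exists2 g : T2 -> R, measurable_fun setT g /\ (forall x, `|g x| <= C) &
  forall h, bmf h -> \int[m]_x (f x * h (p x)) = \int[push m p]_y (g y * h y).
Proof.
move=> mf fC C0; have bf : bmf f by split => //; exists C.
have bp h : bmf h -> bmf (fun x => h (p x)).
  by move=> bh; apply: (bmf_comp bh); exact: measurable_funPT.
apply: (@L1_dual _ _ _ (push m p) (fun h => \int[m]_x (f x * h (p x)))) => //.
- move=> h1 h2 b1 b2; rewrite -bintD; [|by apply: bmfM => //; exact: bp..].
  by apply: eq_Rintegral => x _; rewrite mulrDr.
- move=> c h bh; rewrite -bintZl; last by apply: bmfM => //; exact: bp.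
  by apply: eq_Rintegral => x _; rewrite mulrCA.
- move=> h bh; have bn := bmf_norm bh.
  rewrite bint_push// -bintZl; last exact: (bp _ _ bn).
  rewrite (le_trans (bint_norm _ _))//; first by apply: bmfM => //; exact: bp.
  apply: bint_le; [apply: bmf_norm; apply: bmfM => //; exact: bp| |].
    by apply: bmfM; [exact: bmf_cst|exact: (bp _ _ bn)].
  by move=> x; rewrite normrM ler_wpM2r.
Qed.

Section weak_star.
Context d (T : measurableType d) (R : realType).
Variables (m : {finite_measure set T -> \bar R}) (U : set_system nat).
Hypothesis UU : UltraFilter U.

Lemma ultra_cvg_bounded (a : nat -> R) (C : R) : (forall k, `|a k| <= C) ->
  exists l : R, a k @[k --> U] --> l.
Proof.
move=> aC.
have cK : compact `[(- C), C]%classic by exact: segment_compact.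
have : (a @ U) `[(- C), C]%classic.
  by apply: nearW => k /=; rewrite in_itv/= -ler_norml.
move=> /cK[p [_ clp]]; exists p => N Np.
have [//|UN] := in_ultra_setVsetC (a @^-1` N) UU.
by have [q [? ?]] := clp _ _ (UN : (a @ U) (~` N)) Np.
Qed.

(** The integrals against a fixed h are bounded, so they converge along an
    ultrafilter, with no subsequence to extract; their limit is a functional of
    h bounded by C times the L^1 norm. *)
Lemma weak_star (f_ : (T -> R)^nat) (C : R) :
  (forall k, measurable_fun setT (f_ k)) -> (forall k x, `|f_ k x| <= C) ->
  0 <= C -> exists2 g : T -> R,
  measurable_fun setT g /\ (forall x, `|g x| <= C) &
  forall h, bmf h -> \int[m]_x (f_ k x * h x) @[k --> U] --> \int[m]_x (g x * h x).
Proof.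
move=> mf fC C0.
have bf k : bmf (f_ k) by split => //; exists C.
pose La h := lim (\int[m]_x (f_ k x * h x) @[k --> U]).
have La_cvg h : bmf h -> \int[m]_x (f_ k x * h x) @[k --> U] --> La h.
  move=> bh; have [D hD] := bh.2.
  have [|l hl] := @ultra_cvg_bounded (fun k => \int[m]_x (f_ k x * h x))
    (C * D * fine (m setT)).
    move=> k; apply: bint_norm_le; first exact: bmfM.
    by move=> x; rewrite normrM ler_pM.
  by rewrite /La (cvg_lim _ hl).
have [||h bh|g hg gE] := @L1_dual _ _ _ m La C C0; last first.
- by exists g => // h bh; rewrite -gE//; exact: La_cvg.
- have hc : `|\int[m]_x (f_ k x * h x)| @[k --> U] --> `|La h|.
    by apply: cvg_norm; exact: La_cvg.
  rewrite -(cvg_lim _ hc)//; apply: limr_le; first by apply/cvg_ex; eexists; exact: hc.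
  apply: nearW => k /=; rewrite (le_trans (bint_norm _ _))//; first exact: bmfM.
  rewrite -bintZl; last exact: bmf_norm.
  apply: bint_le; [apply: bmf_norm; exact: bmfM|apply: bmfM; [exact: bmf_cst|exact: bmf_norm]|].
  by move=> x; rewrite normrM ler_wpM2r.
- move=> c h bh; apply: cvg_lim => //.
  under eq_fun => k.
    under eq_Rintegral do rewrite mulrCA.
    rewrite bintZl; [over|exact: bmfM].
  by apply: cvgMr; exact: La_cvg.
- move=> h1 h2 b1 b2; apply: cvg_lim => //.
  under eq_fun => k.
    under eq_Rintegral do rewrite mulrDr.
    rewrite bintD; [over|exact: bmfM|exact: bmfM].
  by apply: cvgD; exact: La_cvg.
Qed.

End weak_star.

(** * Smooth bumps *)

Section directional_derivatives.
Context {R : realType} {V W : normedModType R}.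

(** Reduces directional derivatives to derivatives of functions of a real
    variable, for which the chain rule is known. *)
Lemma is_derive_line (f : V -> W) (x v : V) (df : W) :
  is_derive x v f df <-> is_derive (0 : R) 1 (fun h : R => f (h *: v + x)) df.
Proof.
have E : (fun h : R => h^-1 *: ((f \o shift x) (h *: v) - f x)) =
  (fun h : R => h^-1 *: (((fun h : R => f (h *: v + x)) \o shift 0) (h *: 1) -
     f (0 *: v + x))).
  by apply/funext => h; rewrite /= scale0r add0r addr0 /GRing.scale/= mulr1.
by split=> -[d1 d2]; (split; [move: d1; rewrite /derivable E|move: d2; rewrite /derive E]).
Qed.

End directional_derivatives.

Section smooth_closure.
Context {R : realType}.
Implicit Types V : normedModType R.

Lemma is_Ck_S V k (f : V -> R) : is_Ck k.+1 f -> is_Ck k f.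
Proof.
elim: k f => [|k IH] f; first by case.
move=> [cf h]; split => // v; have [dv Cv] := h v; split => //; exact: IH.
Qed.

Lemma is_Ck_continuous V k (f : V -> R) : is_Ck k f -> continuous f.
Proof. by case: k => [|k] []. Qed.

Lemma is_Ck_cst V k (c : R) : is_Ck k (fun _ : V => c).
Proof.
elim: k c => [|k IH] c; first by split => // x; exact: cvg_cst.
split; first by move=> x; exact: cvg_cst.
move=> v; split; first by move=> x; exact: derivable_cst.
rewrite (_ : 'D_v _ = fun=> 0); first exact: IH.
by apply/funext => x; rewrite derive_cst.
Qed.

Lemma is_CkD V k (f g : V -> R) : is_Ck k f -> is_Ck k g ->
  is_Ck k (fun x => f x + g x).
Proof.
elim: k f g => [|k IH] f g [cf hf] [cg hg].
  by split => // x; apply: cvgD; [exact: cf|exact: cg].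
split; first by move=> x; apply: cvgD; [exact: cf|exact: cg].
move=> v; have [dfv Cfv] := hf v; have [dgv Cgv] := hg v.
split; first by move=> x; exact: derivableD.
rewrite (_ : (fun x => _) = fun x => 'D_v f x + 'D_v g x); first exact: IH.
by apply/funext => x; rewrite deriveD.
Qed.

Lemma is_CkM V k (f g : V -> R) : is_Ck k f -> is_Ck k g ->
  is_Ck k (fun x => f x * g x).
Proof.
elim: k f g => [|k IH] f g hf hg.
  split => // x; apply: cvgM; first exact: (is_Ck_continuous hf).
  exact: (is_Ck_continuous hg).
split.
  move=> x; apply: cvgM; first exact: (is_Ck_continuous hf).
  exact: (is_Ck_continuous hg).
move=> v; have [dfv Cfv] := hf.2 v; have [dgv Cgv] := hg.2 v.
split; first by move=> x; exact: derivableM.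
rewrite (_ : (fun x => _) = fun x => f x * 'D_v g x + g x * 'D_v f x).
  by apply: is_CkD; apply: IH => //; exact: is_Ck_S.
by apply/funext => x; rewrite deriveM.
Qed.

Lemma is_Ck_linear V (W : normedModType R) k (p : {linear V -> W}) (f : W -> R) :
  continuous p -> is_Ck k f -> is_Ck k (f \o p).
Proof.
move=> cp; elim: k f => [|k IH] f [cf hf].
  by split => // x; apply: continuous_comp; [exact: cp|exact: cf].
split; first by move=> x; apply: continuous_comp; [exact: cp|exact: cf].
move=> v; have [dfv Cfv] := hf (p v).
have D x : is_derive x v (f \o p) ('D_(p v) f (p x)).
  apply/is_derive_line.
  have /is_derive_line : is_derive (p x) (p v) f ('D_(p v) f (p x)).
    exact/derivableP/dfv.
  by rewrite (_ : (fun h : R => (f \o p) (h *: v + x)) = fun h => f (h *: p v + p x));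
    [|apply/funext => h /=; rewrite linearP].
split; first by move=> x; have [] := D x.
rewrite (_ : (fun x => _) = 'D_(p v) f \o p); first exact: IH.
by apply/funext => x; have [] := D x.
Qed.

Lemma is_Ck_shift V k (f : V -> R) c : is_Ck k f -> is_Ck k (fun x => f (x + c)).
Proof.
have sc : continuous (fun x : V => x + c).
  by move=> x; apply: cvgD; [exact: cvg_id|apply: cvg_cst].
have cs (g : V -> R) : continuous g -> continuous (fun x => g (x + c)).
  by move=> cg x; apply: (@continuous_comp _ _ _ (fun x => x + c) g); [exact: sc|exact: cg].
elim: k f => [|k IH] f hf; first by split => //; apply: cs; exact: (is_Ck_continuous hf).
split; first by apply: cs; exact: (is_Ck_continuous hf).
move=> v; have [dfv Cfv] := hf.2 v.
have D x : is_derive x v (fun x => f (x + c)) ('D_v f (x + c)).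
  apply/is_derive_line.
  have /is_derive_line : is_derive (x + c) v f ('D_v f (x + c)) by exact/derivableP/dfv.
  by under eq_fun do rewrite addrA.
split; first by move=> x; have [] := D x.
rewrite (_ : 'D_v _ = fun x => 'D_v f (x + c)); first by apply: (IH ('D_v f)); exact: Cfv.
by apply/funext => x; have [] := D x.
Qed.

(** Smoothness in one variable with the derivatives given as a sequence: this
    form allows the induction on the order in the composition below, where all
    the derivatives of the outer function occur. *)
Definition smooth1 (f : R -> R) := exists2 D : nat -> R -> R, D 0%N = f &
  forall k (t : R), is_derive t (1 : R) (D k) (D k.+1 t).

Lemma is_derive_comp_line V (th : R -> R) (g : V -> R) x v dth dg :
  is_derive (g x) 1 th dth -> is_derive x v g dg ->
  is_derive x v (th \o g) (dth * dg).
Proof.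
move=> hth /is_derive_line hg; apply/is_derive_line.
have := @is_derive1_comp R th (fun h : R => g (h *: v + x)) 0 dth dg.
by rewrite scale0r add0r => /(_ hth hg).
Qed.

Lemma is_derive_continuous (f df : R -> R) :
  (forall t, is_derive t (1 : R) f (df t)) -> continuous f.
Proof.
move=> df' t; apply: differentiable_continuous.
by apply/derivable1_diffP; case: (df' t).
Qed.

Lemma smooth1_continuous (D : nat -> R -> R) :
  (forall k (t : R), is_derive t (1 : R) (D k) (D k.+1 t)) -> forall k, continuous (D k).
Proof. by move=> hD k; exact: is_derive_continuous (hD k). Qed.

Lemma is_smooth_comp V (th : R -> R) (g : V -> R) : smooth1 th -> is_smooth g ->
  is_smooth (th \o g).
Proof.
move=> [D <- hD] sg k; have {sg} := sg k.
move: (0%N) => j; elim: k j g => [|k IH] j g hg.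
  split => // x; apply: continuous_comp; first exact: (is_Ck_continuous hg).
  exact: smooth1_continuous.
split.
  move=> x; apply: continuous_comp; first exact: (is_Ck_continuous hg).
  exact: smooth1_continuous.
move=> v; have [dgv Cgv] := hg.2 v.
have E x : is_derive x v (D j \o g) (D j.+1 (g x) * 'D_v g x).
  by apply: is_derive_comp_line => //; exact/derivableP.
split; first by move=> x; have [] := E x.
rewrite (_ : (fun x => _) = fun x => (D j.+1 \o g) x * 'D_v g x).
  by apply: is_CkM => //; apply: IH; exact: is_Ck_S.
by apply/funext => x; have [] := E x.
Qed.

Lemma is_smooth_id : is_smooth (fun x : R => x).
Proof.
case=> [|k]; first by split => // x; exact: cvg_id.
split; first by move=> x; exact: cvg_id.
move=> v; split; first by move=> x; exact: derivable_id.
rewrite (_ : (fun x => _) = fun=> v); first exact: is_Ck_cst.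
by apply/funext => x; rewrite derive_id.
Qed.

Lemma smooth1_smooth (th : R -> R) : smooth1 th -> is_smooth th.
Proof. by move=> h; have := is_smooth_comp h is_smooth_id. Qed.

Lemma is_smoothM V (f g : V -> R) : is_smooth f -> is_smooth g ->
  is_smooth (fun x => f x * g x).
Proof. by move=> sf sg k; exact: is_CkM. Qed.

Lemma is_smoothD V (f g : V -> R) : is_smooth f -> is_smooth g ->
  is_smooth (fun x => f x + g x).
Proof. by move=> sf sg k; exact: is_CkD. Qed.

Lemma is_smooth_cst V (c : R) : is_smooth (fun _ : V => c).
Proof. by move=> k; exact: is_Ck_cst. Qed.

Lemma is_smooth_affine V (g : V -> R) (a b : R) : is_smooth g ->
  is_smooth (fun x => a * g x + b).
Proof.
move=> sg; apply: is_smoothD; last exact: is_smooth_cst.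
by apply: is_smoothM => //; exact: is_smooth_cst.
Qed.

Lemma is_smooth_prod V (I : Type) (s : seq I) (F : I -> V -> R) :
  (forall i, is_smooth (F i)) -> is_smooth (fun x => \prod_(i <- s) F i x).
Proof.
move=> sF; elim: s => [|i s IH].
  by under eq_fun do rewrite big_nil; exact: is_smooth_cst.
by under eq_fun do rewrite big_cons; exact: is_smoothM.
Qed.

Lemma is_smooth_fst V (W : normedModType R) (f : V -> R) : is_smooth f ->
  is_smooth (fun p : V * W => f p.1).
Proof.
by move=> sf k; apply: (@is_Ck_linear _ _ k fst) => // p; exact: cvg_fst.
Qed.

Lemma is_smooth_snd V (W : normedModType R) (f : W -> R) : is_smooth f ->
  is_smooth (fun p : V * W => f p.2).
Proof.
by move=> sf k; apply: (@is_Ck_linear _ _ k snd) => // p; exact: cvg_snd.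
Qed.

Lemma is_smooth_coord n (i : 'I_n) : is_smooth (fun x : 'rV[R]_n => x ord0 i).
Proof.
have lin : linear (fun x : 'rV[R]_n => x ord0 i) by move=> a x y; rewrite !mxE.
pose p : {linear 'rV[R]_n -> R} := HB.pack (fun x : 'rV[R]_n => x ord0 i)
  (GRing.isLinear.Build _ _ _ _ _ lin).
move=> k; apply: (@is_Ck_linear _ _ k p (fun t => t)); last exact: is_smooth_id.
by move=> x; exact: coord_continuous.
Qed.

Lemma is_smooth_derive V (f : V -> R) v : is_smooth f -> is_smooth ('D_v f).
Proof. by move=> sf k; have [_ /(_ v)[]] := sf k.+1. Qed.

Lemma is_smooth_derivable V (f : V -> R) x v : is_smooth f -> derivable f x v.
Proof. by move=> sf; have [_ /(_ v)[]] := sf 1%N. Qed.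

Lemma is_smooth_continuous V (f : V -> R) : is_smooth f -> continuous f.
Proof. by move=> sf; have [] := sf 0%N. Qed.

Lemma measurable_derivative (f df : R -> R) : is_smooth f ->
  (forall t, is_derive t (1 : R) f (df t)) -> measurable_fun setT df.
Proof.
move=> sf df'; have -> : df = 'D_1 f.
  by apply/funext => t; rewrite (@derive_val _ _ _ _ _ _ _ (df' t)).
by apply: continuous_measurable_fun; apply: is_smooth_continuous; exact: is_smooth_derive.
Qed.

End smooth_closure.

Section flat_function.
Context {R : realType}.
Implicit Types (p : {poly R}) (t : R).

(** This family is stable under differentiation, including at 0, and contains
    the flat function exp(-1/t). *)
Definition flatp p t := if 0 < t then p.[t^-1] * expR (- t^-1) else 0.

(** The derivative of p(1/t) exp(-1/t) is (1/t)^2 (p - p')(1/t) exp(-1/t). *)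
Definition flatp_deriv p := 'X^2 * (p - p^`()).

Lemma expn_expR_le (s : R) k : 0 <= s -> s ^+ k * expR (- s) <= k`!%:R.
Proof.
move=> s0; rewrite expRN ler_pdivrMr ?expR_gt0//.
case: k => [|k]; first by rewrite expr0 fact0 mul1r -[leLHS]expR0 ler_expR.
have := expR_ge1Dxn k s0; rewrite -lerBrDl => h.
rewrite mulrC -ler_pdivrMr ?ltr0n ?fact_gt0//.
by rewrite (le_trans h)// lerBlDr lerDl.
Qed.

Lemma flatp_bounded p : exists2 C, 0 <= C & forall t, `|flatp p t| <= C.
Proof.
exists (\sum_(i < size p) `|p`_i| * i`!%:R).
  by apply: sumr_ge0 => i _; rewrite mulr_ge0.
move=> t; rewrite /flatp; case: ifPn => [t0|_]; last first.
  by rewrite normr0; apply: sumr_ge0 => i _; rewrite mulr_ge0.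
rewrite horner_coef mulr_suml (le_trans (ler_norm_sum _ _ _))//.
apply: ler_sum => i _; rewrite -mulrA normrM ler_wpM2l//.
rewrite ger0_norm; last by rewrite mulr_ge0 ?expR_ge0// exprn_ge0// invr_ge0 ltW.
by apply: expn_expR_le; rewrite invr_ge0 ltW.
Qed.

Lemma is_derive_flatp p t : is_derive t 1 (flatp p) (flatp (flatp_deriv p) t).
Proof.
have [t0|t0|<-] := ltgtP 0 t.
- have V : is_derive t 1 (fun s : R => s^-1) (- t ^- 2).
    have tn0 : id t != 0 :> R by rewrite gt_eqF.
    apply: DeriveDef; first exact: (derivableV tn0 (@derivable_id _ _ _ _)).
    by rewrite (deriveV tn0 (@derivable_id _ _ _ _)) derive_id /GRing.scale/= mulr1.
  have A : is_derive t 1 (fun s : R => p.[s^-1] * expR (- s^-1))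
      (flatp (flatp_deriv p) t).
    have P : is_derive t 1 (fun s : R => p.[s^-1]) (p^`().[t^-1] * - t ^- 2).
      exact: (@is_derive1_comp R (horner p) (fun s => s^-1) t _ _ (is_derive_poly p _) V).
    have E : is_derive t 1 (fun s : R => expR (- s^-1)) (expR (- t^-1) * (t ^- 2)).
      apply: (is_derive1_comp (f := expR) (g := fun s => - s^-1)).
      have := @is_deriveN _ _ _ _ _ _ _ V; by rewrite opprK.
    have := is_deriveM P E.
    rewrite /flatp t0 /flatp_deriv !hornerE /GRing.scale/= => h.
    apply: (is_derive_eq h).
    by rewrite exprVn; ring.
  have nE : {near t, flatp p =1 (fun s : R => p.[s^-1] * expR (- s^-1))}.
    have := lt_nbhsr t0.
    by apply: filterS => s /= s0; rewrite /flatp s0.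
  by apply: (near_eq_is_derive (f := (fun s : R => p.[s^-1] * expR (- s^-1)))) => //;
    rewrite ?oner_neq0//; apply: filterS nE => s ->.
- have nE : {near t, (fun=> 0) =1 flatp p}.
    have := lt_nbhsl t0.
    by apply: filterS => s /= s0; rewrite /flatp ltNge (ltW s0).
  rewrite [X in is_derive _ _ _ X]/flatp ltNge (ltW t0)/=.
  by apply: (near_eq_is_derive (f := fun=> 0)) => //; rewrite ?oner_neq0.
- rewrite {2}/flatp ltxx.
  have [C C0 hC] := flatp_bounded ('X^2 * p).
  suff H : h^-1 *: ((flatp p \o shift 0) (h *: 1) - flatp p 0) @[h --> 0^'] --> (0 : R).
    by apply: DeriveDef; [apply/cvg_ex; exists 0; exact: H|exact/cvg_lim/H].
  have C1 : 0 < C + 1 by rewrite ltr_wpDl.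
  apply/cvgrPdist_le => e e0; near=> h.
  rewrite sub0r normrN /= addr0 {2}/flatp ltxx subr0 /GRing.scale/= mulr1.
  (* Dividing by h is multiplying p by X: near 0 the quotient is h times a bounded
     function of the same family. *)
  have -> : h^-1 * flatp p h = h * flatp ('X^2 * p) h.
    rewrite /flatp; case: ifPn => h0; last by rewrite !mulr0.
    by rewrite hornerM hornerXn expr2 !mulrA divff ?gt_eqF// mul1r.
  rewrite normrM (@le_trans _ _ (`|h| * (C + 1)))//.
    by rewrite ler_wpM2l// (le_trans (hC h))// lerDl.
  rewrite -ler_pdivlMr// ltW//; near: h; apply: dnbhs0_lt.
  by rewrite divr_gt0.
Unshelve. all: by end_near. Qed.

Lemma smooth1_flatp p : smooth1 (flatp p).
Proof.
exists (fun k => flatp (iter k flatp_deriv p)) => // k t.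
exact: is_derive_flatp.
Qed.

Definition flat t := flatp 1 t.
Definition flat' t := flatp (flatp_deriv 1) t.

Lemma is_derive_flat t : is_derive t 1 flat (flat' t).
Proof. exact: is_derive_flatp. Qed.

Lemma smooth1_flat : smooth1 flat. Proof. exact: smooth1_flatp. Qed.

Lemma flatE t : flat t = if 0 < t then expR (- t^-1) else 0.
Proof. by rewrite /flat /flatp hornerE mul1r. Qed.

Lemma flat_le0 t : t <= 0 -> flat t = 0.
Proof. by move=> t0; rewrite flatE ltNge t0. Qed.

Lemma flat_ge0 t : 0 <= flat t.
Proof. by rewrite flatE; case: ifP => // _; exact: expR_ge0. Qed.

Lemma flat_le1 t : flat t <= 1.
Proof.
rewrite flatE; case: ifPn => // t0.
by rewrite -expR0 ler_expR oppr_le0 invr_ge0 ltW.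
Qed.

Lemma flat'_ge0 t : 0 <= flat' t.
Proof.
rewrite /flat' /flatp /flatp_deriv; case: ifPn => // t0.
rewrite derivC subr0 mulr1 hornerXn mulr_ge0 ?expR_ge0// exprn_ge0//.
by rewrite invr_ge0 ltW.
Qed.

Lemma flat'_bounded : exists2 C, 0 <= C & forall t, `|flat' t| <= C.
Proof. exact: flatp_bounded. Qed.

Lemma flat_ge_flat1 t : 1 <= t -> flat 1 <= flat t.
Proof.
move=> t1; have t0 : 0 < t by rewrite (lt_le_trans ltr01).
by rewrite !flatE ltr01 t0 ler_expR lerN2 lef_pV2// posrE.
Qed.

Lemma continuous_flat : continuous flat.
Proof. exact/is_smooth_continuous/smooth1_smooth/smooth1_flat. Qed.

Lemma measurable_flat : measurable_fun setT flat.
Proof. by apply: continuous_measurable_fun; exact: continuous_flat. Qed.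

Lemma cvg_flat_scale t :
  flat (k.+1%:R * t) @[k --> \oo] --> (if 0 < t then 1 else 0 : R).
Proof.
case: ifPn => [t0|t0]; last first.
  rewrite (_ : (fun _ => _) = fun=> 0); first exact: cvg_cst.
  apply/funext => k; rewrite flat_le0// mulr_ge0_le0//; rewrite leNgt//.
have e1 : expR (- (t^-1 * 0)) = 1 :> R by rewrite mulr0 oppr0 expR0.
rewrite -[X in _ --> X]e1.
rewrite (_ : (fun _ => _) = fun k : nat => expR (- (t^-1 * k.+1%:R^-1))); last first.
  apply/funext => k; rewrite flatE mulr_gt0//; congr expR; congr (- _).
  by rewrite invfM mulrC.
apply: continuous_cvg; first exact: continuous_expR.
apply: cvgN; apply: cvgMr; exact: cvg_harmonic.
Qed.

End flat_function.

Section half_lines.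
Context {R : realType}.

Definition below (a : R) : set R := [set y | y < a].

Lemma measurable_below a : measurable (below a).
Proof.
have -> : below a = `]-oo, a[%classic by apply/seteqP; split => y; rewrite /= in_itv.
exact: measurable_itv.
Qed.

Lemma below_mono a b : a <= b -> below a `<=` below b.
Proof. by move=> ab y /= ya; exact: lt_le_trans ab. Qed.

End half_lines.

Section cutoff.
Context {R : realType}.

(** Equal to 1 on [-N, N], where y^2 - N^2 <= 0, and to 0 as soon as y^2 - N^2
    >= 1, because flat is nondecreasing there and flat 1 = 1/e; the factors e
    are this normalisation. *)
Definition cutoff (N : R) (y : R) : R :=
  flat (1 - expR 1 * flat (y ^+ 2 - N ^+ 2)) * expR 1.

Lemma cutoff1 (N y : R) : `|y| <= N -> cutoff N y = 1.
Proof.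
move=> yN; rewrite /cutoff (flat_le0 (t := y ^+ 2 - N ^+ 2)).
  by rewrite mulr0 subr0 flatE ltr01 invr1 -expRD addNr expR0.
rewrite subr_le0 -(real_normK (num_real y)) ler_sqr ?nnegrE//.
by rewrite (le_trans _ yN).
Qed.

Lemma cutoff0 (N y : R) : N ^+ 2 + 1 <= y ^+ 2 -> cutoff N y = 0.
Proof.
move=> yN; rewrite /cutoff flat_le0 ?mul0r// subr_le0.
have : flat 1 <= flat (y ^+ 2 - N ^+ 2) by apply: flat_ge_flat1; rewrite lerBrDl.
rewrite flatE ltr01 invr1 expRN => h.
by rewrite -ler_pdivrMl ?expR_gt0// mulr1.
Qed.

Lemma smooth_cutoff (N : R) : is_smooth (cutoff N).
Proof.
apply: is_smoothM; last exact: is_smooth_cst.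
apply: (is_smooth_comp (th := flat)); first exact: smooth1_flat.
rewrite (_ : (fun x => _) = fun y : R => - expR 1 * flat (y ^+ 2 - N ^+ 2) + 1); last first.
  by apply/funext => y; rewrite addrC mulNr.
apply: is_smooth_affine; apply: (is_smooth_comp (th := flat)); first exact: smooth1_flat.
apply: is_smoothD; last exact: is_smooth_cst.
by apply: is_smoothM; exact: is_smooth_id.
Qed.

End cutoff.

Section boxbump.
Context {R : realType} {n : nat}.
Implicit Types (l h x : 'rV[R]_n).

Definition obox l h : set 'rV[R]_n :=
  [set x | forall i, l ord0 i < x ord0 i < h ord0 i].
Definition cbox l h : set 'rV[R]_n :=
  [set x | forall i, l ord0 i <= x ord0 i <= h ord0 i].

Lemma measurable_obox l h : measurable (obox l h).
Proof.
apply: (@measurable_rV_box R n (fun i => [set t | l ord0 i < t < h ord0 i])) => i.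
have -> : [set t | l ord0 i < t < h ord0 i] = `]l ord0 i, h ord0 i[%classic.
  by apply/seteqP; split => t; rewrite /= in_itv.
exact: measurable_itv.
Qed.

(** Smooth functions increasing to the indicator of an open box. *)
Definition boxbump l h (k : nat) x : R :=
  \prod_(i < n) (flat (k.+1%:R * (x ord0 i - l ord0 i)) *
                 flat (k.+1%:R * (h ord0 i - x ord0 i))).

Lemma bump_ge0 l h k x : 0 <= boxbump l h k x.
Proof. by apply: prodr_ge0 => i _; rewrite mulr_ge0 ?flat_ge0. Qed.

Lemma bump_le1 l h k x : boxbump l h k x <= 1.
Proof.
apply: prodr_ile1 => i _.
by rewrite mulr_ge0 ?flat_ge0//= mulr_ile1 ?flat_ge0 ?flat_le1.
Qed.

Lemma bump_out l h k x : ~ obox l h x -> boxbump l h k x = 0.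
Proof.
move=> /existsNP[i] /negP; rewrite negb_and -!leNgt => hi.
rewrite /boxbump (bigD1 i)//=; case/orP: hi => hi.
  by rewrite (flat_le0 (t := _ * (x ord0 i - _))) ?mul0r// mulr_ge0_le0// subr_le0.
by rewrite (flat_le0 (t := _ * (h ord0 i - _))) ?mulr0 ?mul0r// mulr_ge0_le0// subr_le0.
Qed.

Lemma smooth_bump l h k : is_smooth (boxbump l h k).
Proof.
apply: is_smooth_prod => i; apply: is_smoothM.
  apply: (is_smooth_comp (th := flat)); first exact: smooth1_flat.
  under eq_fun do rewrite mulrBr -mulrN; apply: is_smooth_affine.
  exact: is_smooth_coord.
apply: (is_smooth_comp (th := flat)); first exact: smooth1_flat.
rewrite (_ : (fun x => _) = fun x : 'rV[R]_n => - k.+1%:R * x ord0 i + k.+1%:R * h ord0 i).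
  by apply: is_smooth_affine; exact: is_smooth_coord.
by apply/funext => x; rewrite mulrBr addrC mulNr.
Qed.

Lemma differentiable_bump l h k x : differentiable (boxbump l h k) x.
Proof.
have D i : differentiable (fun x => flat (k.+1%:R * (x ord0 i - l ord0 i)) *
                 flat (k.+1%:R * (h ord0 i - x ord0 i))) x.
  have F t : differentiable (@flat R) t.
    by apply/derivable1_diffP; have [] := is_derive_flat t.
  apply: differentiableM.
    apply: (differentiable_comp (g := flat)) => //.
    apply: differentiableM => //; apply: differentiableB => //.
    exact: differentiable_coord.
  apply: (differentiable_comp (g := flat)) => //.
  apply: differentiableM => //; apply: differentiableB => //.
  exact: differentiable_coord.
rewrite /boxbump; elim: (index_enum _) => [|i s IH].
  by under eq_fun do rewrite big_nil.
by under eq_fun do rewrite big_cons; exact: differentiableM.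
Qed.

Lemma cbox_compact l h : compact (cbox l h).
Proof.
rewrite (_ : cbox l h = [set x | forall i, `[l ord0 i, h ord0 i]%classic (x ord0 i)]).
  by apply: (@rV_compact _ _ (fun i => `[l ord0 i, h ord0 i]%classic)) => i; exact: segment_compact.
by apply/seteqP; split => x /= hx i; have := hx i; rewrite in_itv.
Qed.

Lemma cbox_closed l h : closed (cbox l h).
Proof. by apply: compact_closed; [exact: norm_hausdorff|exact: cbox_compact]. Qed.

Lemma bump_test (Omega : set 'rV[R]_n) l h k : cbox l h `<=` Omega ->
  test_function Omega (boxbump l h k).
Proof.
move=> lh; have sub : fsupport (boxbump l h k) `<=` cbox l h.
  rewrite /fsupport; have /closure_id -> := @cbox_closed l h.
  apply: closure_subset => x /= /eqP bx i.
  have [/(_ i)/andP[/ltW -> /ltW ->]//|ob] := pselect (obox l h x).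
  by exfalso; apply: bx; exact: bump_out.
split; first exact: smooth_bump.
- apply: (@subclosed_compact _ _ (cbox l h)) => //; last exact: cbox_compact.
  exact: closed_closure.
- exact: subset_trans sub lh.
Qed.

Lemma cvg_bump l h x : boxbump l h k x @[k --> \oo] --> (\1_(obox l h) x : R).
Proof.
have [ox|ox] := pselect (obox l h x); last first.
  rewrite indicE memNset//=.
  rewrite (_ : (fun _ => _) = fun=> 0); first exact: cvg_cst.
  by apply/funext => k; exact: bump_out.
rewrite indicE mem_set//=.
have F i : flat (k.+1%:R * (x ord0 i - l ord0 i)) *
    flat (k.+1%:R * (h ord0 i - x ord0 i)) @[k --> \oo] --> (1 * 1 : R).
  have /andP[lx xh] := ox i; apply: cvgM.
    by have := @cvg_flat_scale R (x ord0 i - l ord0 i); rewrite subr_gt0 lx.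
  by have := @cvg_flat_scale R (h ord0 i - x ord0 i); rewrite subr_gt0 xh.
rewrite /boxbump; elim: (index_enum _) => [|i s IH].
  by under eq_fun do rewrite big_nil; exact: cvg_cst.
under eq_fun do rewrite big_cons.
have -> : 1%:R = 1 * 1 * 1%:R :> R by rewrite !mulr1.
exact: cvgM.
Qed.

End boxbump.

(** * Averaging out the velocities *)

Section support.
Context {R : realType} {n : nat}.
Notation X := ('rV[R]_n * R * 'rV[R]_n)%type.
Variable mu : {finite_measure set X -> \bar R}.

(** The complement of the support is null because the topology has a
    countable base of measurable sets. *)
Lemma compact_support_bound : compactly_supported mu ->
  exists2 M : R, 0 < M & mu.-negligible [set p : X | M < `|p|].
Proof.
move=> csupp; have [M [_ hM]] := compact_bounded csupp.
exists (`|M| + 1); first by rewrite ltr_wpDl.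
have [B [mB BU]] := @countable_base_rVRrV R n.
pose N := \bigcup_k (if mu (B k) == 0%E then B k else set0).
have mN k : measurable (if mu (B k) == 0%E then B k else set0).
  by case: ifP => _; [exact: mB|exact: measurable0].
apply: (negligibleS _ (_ : mu.-negligible N)); last first.
  apply: negligible_bigcup => k; case: ifPn => [/eqP Bk0|_].
    by apply/negligibleP.
  exact: negligible_set0.
move=> p /= Mp.
have np : ~ msupport mu p.
  have MM : M < `|M| + 1 by rewrite (le_lt_trans (ler_norm _))// ltrDl.
  by move=> /(hM _ MM) /= pM; move: Mp; rewrite ltNge pM.
have [U [oU Up U0]] : exists U : set X, [/\ open U, U p & mu U = 0%E].
  move/existsNP : np => [U /not_implyP[oU /not_implyP[Up /negP]]].
  by rewrite -leNgt measure_le0 => /eqP; exists U.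
have [k [Bkp BkU]] := BU _ _ oU Up.
exists k => //.
suff -> : mu (B k) == 0%E by [].
apply/eqP/(subset_measure0 (mB k) _ BkU U0).
exact: (countable_base_open (@countable_base_rVRrV R n) measurable0
  (@measurable_bigcup_nat _ _)).
Qed.

End support.

(** The set that carries the measure sg below. *)
Lemma measurable_slab (R : realType) n (Omega : set 'rV[R]_n) (M : R) : measurable Omega ->
  measurable [set p : 'rV[R]_n * R | Omega p.1 /\ `|p.2| <= M].
Proof.
move=> mO; have -> : [set p : 'rV[R]_n * R | Omega p.1 /\ `|p.2| <= M] =
  Omega `*` [set y | `|y| <= M] by [].
apply: measurableX => //.
have -> : [set y : R | `|y| <= M] = `[- M, M]%classic.
  by apply/seteqP; split => y; rewrite /= in_itv/= ler_norml.
exact: measurable_itv.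
Qed.

(** Here sg is the law of (x, y), and mz i the conditional mean of z_i; the test
    functions are restricted to products psi(x) chi(y), where chi need not have
    compact support since sg is carried by |y| <= M. *)
Section continuity_equation.
Context {R : realType} {n : nat} (Omega : set 'rV[R]_n).
Notation E := 'rV[R]_n.
Notation ER := ('rV[R]_n * R)%type.
Variables (sg : {finite_measure set ER -> \bar R}) (mz : 'I_n -> ER -> R) (M : R).

Definition transported :=
  [/\ open Omega, 0 < M,
      sg (~` [set p | Omega p.1 /\ `|p.2| <= M]) = 0%E,
      (forall i, measurable_fun setT (mz i) /\ forall p, `|mz i p| <= M) &
      forall (psi : E -> R) (chi dchi : R -> R), test_function Omega psi ->
        is_smooth chi -> (forall y : R, is_derive y (1 : R) chi (dchi y)) ->
        (exists C, forall y, `|chi y| <= C /\ `|dchi y| <= C) ->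
        forall i, \int[sg]_p ('D_(delta_mx ord0 i) psi p.1 * chi p.2 +
                     psi p.1 * dchi p.2 * mz i p) = 0].

End continuity_equation.

Section test_functions.
Context {R : realType} {n : nat}.
Notation E := 'rV[R]_n.
Implicit Types psi : E -> R.

Lemma continuous_compact_support_bounded psi (K : set E) : continuous psi ->
  compact K -> (forall x, ~ K x -> psi x = 0) -> exists C, forall x, `|psi x| <= C.
Proof.
move=> cpsi cK psi0.
have [|C [_ hC]] := @compact_bounded _ _ (psi @` K).
  by apply: continuous_compact => //; exact: continuous_subspaceT.
exists (`|C| + 1) => x; have [Kx|Kx] := pselect (K x).
  by apply: (hC (`|C| + 1)); [rewrite (le_lt_trans (ler_norm _))// ltrDl|exists x].
by rewrite psi0// normr0 addr_ge0.
Qed.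

Lemma fsupport_out psi x : ~ fsupport psi x -> psi x = 0.
Proof.
move=> nx; apply/eqP/negPn/negP => px; apply: nx.
by apply: subset_closure.
Qed.

Lemma derive_fsupport_out psi v x : ~ fsupport psi x -> 'D_v psi x = 0.
Proof.
move=> nx.
have oC : open (~` fsupport psi) by apply: closed_openC; exact: closed_closure.
have nC : nbhs x (~` fsupport psi) by exact: open_nbhs_nbhs.
rewrite (@near_eq_derive _ _ _ psi (cst 0)) ?derive_cst//.
by apply: filterS nC => y /= /fsupport_out.
Qed.

Lemma test_function_bmf Omega psi : test_function Omega psi -> bmf psi.
Proof.
move=> [spsi cK _]; split.
  by apply: continuous_measurable_rV; exact: is_smooth_continuous.
apply: (continuous_compact_support_bounded (is_smooth_continuous spsi) cK).
exact: fsupport_out.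
Qed.

Lemma test_function_derive_bmf Omega psi v : test_function Omega psi -> bmf ('D_v psi).
Proof.
move=> [spsi cK _]; have sD := is_smooth_derive v spsi; split.
  by apply: continuous_measurable_rV; exact: is_smooth_continuous.
apply: (continuous_compact_support_bounded (is_smooth_continuous sD) cK).
by move=> x; exact: derive_fsupport_out.
Qed.

(** Cutting chi off beyond |y| <= N gives a compactly supported product without
    changing it where the measure lives. *)
Lemma test_function_prod Omega psi (chi : R -> R) N : test_function Omega psi ->
  is_smooth chi -> test_function (Omega `*` setT)
    (fun p : E * R => psi p.1 * (chi p.2 * cutoff N p.2)).
Proof.
move=> [spsi cK KO] schi.
pose K := fsupport psi `*` `[- (`|N| + 1), `|N| + 1]%classic.
have cKK : compact K by apply: compact_setX => //; exact: segment_compact.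
have clK : closed K by apply: compact_closed => //; exact: norm_hausdorff.
have sub : fsupport (fun p : E * R => psi p.1 * (chi p.2 * cutoff N p.2)) `<=` K.
  rewrite /fsupport; have /closure_id -> := clK.
  apply: closure_subset => -[x y] /= /eqP nz; split => /=.
    have [//|/fsupport_out p0] := pselect (fsupport psi x).
    by exfalso; apply: nz; rewrite p0 mul0r.
  rewrite in_itv/= -ler_norml leNgt; apply/negP => Ny; apply: nz.
  rewrite cutoff0 ?mulr0//.
  rewrite -(real_normK (num_real y)) -(real_normK (num_real N)).
  rewrite (@le_trans _ _ ((`|N| + 1) ^+ 2))//.
    by rewrite sqrrD1 lerD2r -mulr_natl lerDl mulr_ge0.
  by rewrite ler_sqr ?nnegrE// ?ltW// addr_ge0.
split.
- apply: is_smoothM; first exact: is_smooth_fst.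
  by apply: (@is_smooth_snd _ _ _ (fun y => chi y * cutoff N y)); apply: is_smoothM => //; exact: smooth_cutoff.
- by apply: (@subclosed_compact _ _ K) => //; exact: closed_closure.
- by move=> p /sub[/= /KO].
Qed.

Lemma is_derive_fst_prod psi (kap : R -> R) x y v :
  derivable psi x v -> 
  is_derive (x, y) (v, 0) (fun p : E * R => psi p.1 * kap p.2) ('D_v psi x * kap y).
Proof.
move=> dpsi; apply/is_derive_line => /=.
have /is_derive_line h : is_derive x v psi ('D_v psi x) by exact/derivableP.
under eq_fun do rewrite scaler0 add0r.
apply: (is_derive_eq (@is_deriveM _ _ _ (fun=> kap y) 0 (1 : R) _ _ h (is_derive_cst _ _ _))).
by rewrite scaler0 add0r /GRing.scale/= mulrC.
Qed.

Lemma is_derive_snd_prod psi (kap : R -> R) x (y : R) dkap :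
  is_derive y (1 : R) kap dkap -> 
  is_derive (x, y) (0, 1) (fun p : E * R => psi p.1 * kap p.2) (psi x * dkap).
Proof.
move=> /is_derive_line h; apply/is_derive_line => /=.
under eq_fun do rewrite scaler0 add0r.
have := @is_deriveM _ _ (fun=> psi x) _ 0 (1 : R) _ _ (is_derive_cst _ _ _) h.
by rewrite scaler0 addr0.
Qed.

End test_functions.

Section transport_of_measure.
Context {R : realType} {n : nat} (Omega : set 'rV[R]_n).
Notation E := 'rV[R]_n.
Notation ER := ('rV[R]_n * R)%type.
Notation X := ('rV[R]_n * R * 'rV[R]_n)%type.
Variables (mu : {finite_measure set X -> \bar R}) (M : R).
Hypothesis mD : measurable (Omega `*` setT `*` setT : set X).

Definition base_measure : {finite_measure set X -> \bar R} := frestr mu mD.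

Definition base_law : {finite_measure set ER -> \bar R} :=
  push base_measure (mfun_of (@measurable_fst _ _ ER E)).

(** Replaces z_i, which is bounded by M only almost everywhere, by a function
    bounded everywhere. *)
Definition clamp (t : R) := Num.max (- M) (Num.min M t).

Lemma clampE t : `|t| <= M -> clamp t = t.
Proof.
rewrite ler_norml => /andP[? ?].
by rewrite /clamp; rewrite (min_idPr _)// (max_idPr _).
Qed.

Lemma clamp_le t : 0 < M -> `|clamp t| <= M.
Proof.
move=> M0; rewrite /clamp ler_norml le_max lexx/= ge_max ge_min lexx/= andbT.
by rewrite lerNl (le_trans _ (ltW M0))// oppr_le0 ltW.
Qed.

Lemma measurable_clamp i : measurable_fun setT (fun p : X => clamp (p.2 ord0 i)).
Proof.
apply: measurable_maxr; first exact: measurable_cst.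
apply: measurable_minr; first exact: measurable_cst.
apply: (measurableT_comp (f := fun x : E => x ord0 i) (g := snd)) => //.
exact: measurable_rV_coord.
Qed.

Lemma norm_rV_le (x : E) i : `|x ord0 i| <= `|x|.
Proof. by rewrite [leRHS]mx_normrE; exact: (le_bigmax _ _ (ord0, i)). Qed.

Hypothesis M0 : 0 < M.
Hypothesis muM : mu.-negligible [set p : X | M < `|p|].
Hypothesis oO : open Omega.
Hypothesis weak_eq : forall phi : ER -> R, test_function (Omega `*` setT) phi ->
    forall i : 'I_n, \int[mu]_(p in Omega `*` setT `*` setT)
        ('D_(delta_mx ord0 i, 0) phi p.1 + 'D_(0, 1) phi p.1 * p.2 ord0 i) = 0.

Lemma bint_base (f : X -> R) : measurable_fun setT f ->
  \int[base_measure]_p f p = \int[mu]_(p in Omega `*` setT `*` setT) f p.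
Proof.
move=> mf; rewrite /Rintegral /base_measure /frestr integral_mrestr//.
exact/measurable_EFinP.
Qed.

(** The conditional mean mz i exists because z_i is bounded; the equation
    depends on z linearly through psi chi' z_i, where z_i may be replaced by mz
    i. *)
Lemma transport_of_measure : exists mz : 'I_n -> ER -> R,
  transported Omega base_law mz M /\ forall i h, bmf h ->
   \int[base_measure]_p (clamp (p.2 ord0 i) * h p.1) = \int[base_law]_q (mz i q * h q).
Proof.
have /choice[mz hmz] : forall i, exists g : ER -> R,
   (measurable_fun setT g /\ (forall x, `|g x| <= M)) /\
   forall h, bmf h -> \int[base_measure]_p (clamp (p.2 ord0 i) * h p.1) = \int[base_law]_y (g y * h y).
  move=> i; have [g g1 g2] := @conditional_expectation _ _ _ _ R base_measure
    (mfun_of (@measurable_fst _ _ ER E)) _ M (measurable_clamp i)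
    (fun p => clamp_le _ M0) (ltW M0).
  by exists g.
exists mz; split; last by move=> i h; exact: (hmz i).2.
split => //.
- pose A := ~` [set p : ER | Omega p.1 /\ `|p.2| <= M].
  have mA : measurable A
    by apply: measurableC; apply: measurable_slab; exact: open_measurable_rV.
  have mA' : measurable ((fst : X -> ER) @^-1` A).
    by have := @measurable_fst _ _ ER E measurableT _ mA; rewrite setTI.
  change (mu ((fst : X -> ER) @^-1` A `&` (Omega `*` setT `*` setT)) = 0%E).
  apply/negligibleP; first exact: measurableI.
  apply: negligibleS muM => -[[x y] z] /= [/not_andP[Ox|/negP yM] [[Ox' _] _]]//.
  rewrite -ltNge in yM; rewrite (lt_le_trans yM)//.
  by rewrite !prod_normE /= !le_max lexx orbT.
- by move=> i; exact: (hmz i).1.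
move=> psi chi dchi tpsi schi hchi [C hC] i.
have spsi : is_smooth psi by case: tpsi.
(* The margin 1 makes the cutoff constant in a neighbourhood of every y with |y|
   <= M, so that the derivatives agree there as well. *)
pose N := M + 1.
pose kap y := chi y * cutoff N y.
have skap : is_smooth kap by apply: is_smoothM => //; exact: smooth_cutoff.
have dkap (y : R) : is_derive y (1 : R) kap ('D_1 kap y).
  by apply/derivableP; exact: is_smooth_derivable.
have := weak_eq (test_function_prod N tpsi schi) i.
pose F1 (p : X) := 'D_(delta_mx ord0 i) psi p.1.1 * kap p.1.2 +
   psi p.1.1 * 'D_1 kap p.1.2 * p.2 ord0 i.
pose F2 (p : X) := 'D_(delta_mx ord0 i) psi p.1.1 * chi p.1.2 +
   clamp (p.2 ord0 i) * (psi p.1.1 * dchi p.1.2).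
have mdchi : measurable_fun setT dchi by exact: measurable_derivative hchi.
have mchi : measurable_fun setT chi.
  by apply: continuous_measurable_fun; exact: is_smooth_continuous.
have b1 : bmf (fun q : ER => 'D_(delta_mx ord0 i) psi q.1).
  exact: (bmf_comp (test_function_derive_bmf _ tpsi) (@measurable_fst _ _ _ _)).
have b2 : bmf (fun q : ER => psi q.1).
  exact: (bmf_comp (test_function_bmf tpsi) (@measurable_fst _ _ _ _)).
have b3 : bmf (fun q : ER => chi q.2).
  apply: (bmf_comp (f := chi)); last exact: measurable_snd.
  by split => //; exists C => y; have [] := hC y.
have b4 : bmf (fun q : ER => dchi q.2).
  apply: (bmf_comp (f := dchi)); last exact: measurable_snd.
  by split => //; exists C => y; have [] := hC y.
have b5 : bmf (fun p : X => clamp (p.2 ord0 i)).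
  by split; [exact: measurable_clamp|exists M => p; exact: clamp_le].
have bA : bmf (fun q : ER => 'D_(delta_mx ord0 i) psi q.1 * chi q.2) by exact: bmfM.
have bB : bmf (fun q : ER => psi q.1 * dchi q.2) by exact: bmfM.
have lift (h : ER -> R) : bmf h -> bmf (fun p : X => h p.1).
  by move=> bh; exact: (bmf_comp bh (@measurable_fst _ _ _ _)).
have bF2 : bmf F2 by apply: bmfD; [exact: (lift _ bA)|apply: bmfM => //; exact: (lift _ bB)].
have mkap : measurable_fun setT kap.
  by apply: continuous_measurable_fun; exact: is_smooth_continuous.
have mdkap : measurable_fun setT ('D_1 kap).
  by apply: continuous_measurable_fun; apply: is_smooth_continuous; exact: is_smooth_derive.
have m12 : measurable_fun setT (fun p : X => p.1.2).
  exact: (measurableT_comp measurable_snd measurable_fst).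
have mF1 : measurable_fun setT F1.
  apply: measurable_funD; apply: measurable_funM.
  - exact: (bmf_meas (lift _ b1)).
  - exact: (measurableT_comp mkap m12).
  - apply: measurable_funM; first exact: (bmf_meas (lift _ b2)).
    exact: (measurableT_comp mdkap m12).
  - apply: (measurableT_comp (f := fun x : E => x ord0 i)); first exact: measurable_rV_coord.
    exact: measurable_snd.
under eq_Rintegral => p _.
  have -> : 'D_(delta_mx ord0 i, 0) (fun p => psi p.1 * kap p.2) p.1 + 
      'D_(0, 1) (fun p => psi p.1 * kap p.2) p.1 * p.2 ord0 i = F1 p.
    case: p => -[x y] z /=.
    have d1 : derivable psi x (delta_mx ord0 i) by exact: is_smooth_derivable.
    have h1 := @is_derive_fst_prod _ _ psi kap x y (delta_mx ord0 i) d1.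
    have h2 := @is_derive_snd_prod _ _ psi kap x y _ (dkap y).
    by rewrite (@derive_val _ _ _ _ _ _ _ h1) (@derive_val _ _ _ _ _ _ _ h2).
  over.
have -> : \int[mu]_(p in Omega `*` setT `*` setT) F1 p =
    \int[mu]_(p in Omega `*` setT `*` setT) F2 p.
  congr fine; apply: ae_eq_integral => //.
  - exact/measurable_EFinP/measurable_funTS.
  - by apply/measurable_EFinP/measurable_funTS; exact: bmf_meas bF2.
  apply: negligibleS muM => -[[x y] z] /= /not_implyP[_ ne].
  rewrite ltNge; apply/negP => zM; apply: ne; congr EFin.
  have yM : `|y| <= M by rewrite (le_trans _ zM)// !prod_normE /= !le_max lexx orbT.
  have ziM : `|z ord0 i| <= M.
    rewrite (le_trans (norm_rV_le z i))// (le_trans _ zM)// !prod_normE /= le_max lexx orbT//.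
  have yN : `|y| < N by rewrite (le_lt_trans yM)// ltrDl.
  rewrite /F1 /F2 /= clampE// /kap cutoff1 ?ltW// mulr1; congr (_ + _).
  suff -> : 'D_1 kap y = dchi y by rewrite mulrC.
  rewrite (@near_eq_derive _ _ _ _ chi) ?(@derive_val _ _ _ _ _ _ _ (hchi y))//.
  have : nbhs y [set t | `|t| < N].
    apply: open_nbhs_nbhs; split => //.
    apply: (@open_comp _ _ (fun t : R => `|t|) [set t | t < N]); last exact: open_lt.
    by move=> t _; exact: norm_continuous.
  by apply: filterS => t /= tN; rewrite /kap cutoff1 ?mulr1// ltW.
rewrite -bint_base; last exact: bmf_meas.
rewrite /F2 bintD; [|exact: (lift _ bA)|by apply: bmfM => //; exact: (lift _ bB)].
have /= -> := (hmz i).2 _ bB; move=> <-.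
have bm : bmf (mz i) by split; [exact: (hmz i).1.1|exists M; exact: (hmz i).1.2].
rewrite bintD//; last by apply: bmfM.
congr (_ + _); first by rewrite /base_law bint_push.
by apply: eq_Rintegral => q _; rewrite mulrC.
Qed.

End transport_of_measure.

(** * Propagation of mass *)

Section propagation.
Context {R : realType} {n : nat} (Omega : set 'rV[R]_n).
Notation E := 'rV[R]_n.
Notation ER := ('rV[R]_n * R)%type.
Variables (sg : {finite_measure set ER -> \bar R}) (mz : 'I_n -> ER -> R) (M : R).
Hypothesis tr : transported Omega sg mz M.

Lemma bmz i : bmf (mz i).
Proof. by case: tr => _ _ _ /(_ i)[mm hM] _; split => //; exists M. Qed.

Lemma boxbump_translate (l h v x : E) k s :
  boxbump (l + s *: v) (h + s *: v) k x = boxbump l h k (x - s *: v).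
Proof.
apply: eq_bigr => i _; rewrite !mxE; congr (flat (_ * _) * flat (_ * _)); ring.
Qed.

Lemma derive_boxbump_translate (l h v w x : E) k s :
  'D_w (boxbump (l + s *: v) (h + s *: v) k) x = 'D_w (boxbump l h k) (x - s *: v).
Proof.
have d : derivable (boxbump l h k) (x - s *: v) w.
  by apply: diff_derivable; exact: differentiable_bump.
have /is_derive_line H : is_derive (x - s *: v) w (boxbump l h k)
  ('D_w (boxbump l h k) (x - s *: v)) by exact/derivableP.
suff H' : is_derive x w (boxbump (l + s *: v) (h + s *: v) k)
  ('D_w (boxbump l h k) (x - s *: v)) by rewrite (@derive_val _ _ _ _ _ _ _ H').
apply/is_derive_line; under eq_fun do rewrite boxbump_translate -addrA.
exact: H.
Qed.

Lemma derive_sum_coord (f : E -> R) (x v : E) : differentiable f x ->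
  'D_v f x = \sum_i v ord0 i * 'D_(delta_mx ord0 i) f x.
Proof.
move=> df; rewrite deriveE// {1}(row_sum_delta v) linear_sum /=.
by apply: eq_bigr => i _; rewrite linearZ /= deriveE.
Qed.

(** The directional derivatives of bumps are combinations of partial
    derivatives, because bumps are differentiable in the strong sense. *)
Lemma transported_direction (l h v : E) k (chi dchi : R -> R) :
  cbox l h `<=` Omega ->
  is_smooth chi -> (forall y : R, is_derive y (1 : R) chi (dchi y)) ->
  (exists C, forall y, `|chi y| <= C /\ `|dchi y| <= C) ->
  \int[sg]_p ('D_v (boxbump l h k) p.1 * chi p.2 +
     boxbump l h k p.1 * dchi p.2 * \sum_i v ord0 i * mz i p) = 0.
Proof.
move=> lhO schi hchi [C hC]; have tb := bump_test k lhO.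
case: tr => _ _ _ _ /(_ _ _ _ tb schi hchi (ex_intro _ C hC)) eqn.
have mdchi : measurable_fun setT dchi by exact: measurable_derivative hchi.
have mchi : measurable_fun setT chi.
  by apply: continuous_measurable_fun; exact: is_smooth_continuous.
have b1 w : bmf (fun q : ER => 'D_w (boxbump l h k) q.1).
  exact: (bmf_comp (test_function_derive_bmf _ tb) (@measurable_fst _ _ _ _)).
have b2 : bmf (fun q : ER => boxbump l h k q.1).
  exact: (bmf_comp (test_function_bmf tb) (@measurable_fst _ _ _ _)).
have b3 : bmf (fun q : ER => chi q.2).
  apply: (bmf_comp (f := chi)); last exact: measurable_snd.
  by split => //; exists C => y; have [] := hC y.
have b4 : bmf (fun q : ER => dchi q.2).
  apply: (bmf_comp (f := dchi)); last exact: measurable_snd.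
  by split => //; exists C => y; have [] := hC y.
transitivity (\int[sg]_p \sum_i v ord0 i * ('D_(delta_mx ord0 i) (boxbump l h k) p.1 * chi p.2 +
    boxbump l h k p.1 * dchi p.2 * mz i p)).
  apply: eq_Rintegral => p _.
  rewrite derive_sum_coord; last exact: differentiable_bump.
  rewrite mulr_suml mulr_sumr -big_split/=; apply: eq_bigr => i _; ring.
rewrite (@bint_sum _ _ _ sg _ _ (fun i p => v ord0 i * ('D_(delta_mx ord0 i) (boxbump l h k) p.1 * chi p.2 +
    boxbump l h k p.1 * dchi p.2 * mz i p))).
  apply: big1 => i _; rewrite bintZl ?eqn ?mulr0//.
  by apply: bmfD; [exact: bmfM|apply: bmfM; [exact: bmfM|exact: bmz]].
move=> i; apply: bmfM; first exact: bmf_cst.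
by apply: bmfD; [exact: bmfM|apply: bmfM; [exact: bmfM|exact: bmz]].
Qed.

(** Let F(s) be the right-hand side with s v in place of v. Adding the transport
    equation to the derivative of F leaves the integral of bump * (- chi') * (n
    M |v| - v . mz), which is nonnegative since |mz i| <= M. So F is
    nondecreasing on [0, 1]. *)
Lemma propagation_smooth (l h v : E) k (chi dchi : R -> R) :
  (forall s, 0 <= s <= 1 -> cbox (l + s *: v) (h + s *: v) `<=` Omega) ->
  is_smooth chi -> (forall y : R, is_derive y (1 : R) chi (dchi y)) ->
  (forall y, 0 <= chi y) -> (forall y, dchi y <= 0) ->
  (exists C, forall y, `|chi y| <= C /\ `|dchi y| <= C) ->
  \int[sg]_p (boxbump l h k p.1 * chi p.2) <=
  \int[sg]_p (boxbump (l + v) (h + v) k p.1 * chi (p.2 - n%:R * M * `|v|)).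
Proof.
move=> lhO schi hchi chi0 dchi0 [C hC].
set La := n%:R * M * `|v|.
have M0 : 0 < M by case: tr.
have La0 : 0 <= La by rewrite !mulr_ge0// ltW.
have C0 : 0 <= C by rewrite (le_trans _ (hC 0).1).
pose f (s : R) (p : ER) := boxbump l h k (p.1 - s *: v) * chi (p.2 - s * La).
pose df (s : R) (p : ER) := - 'D_v (boxbump l h k) (p.1 - s *: v) * chi (p.2 - s * La)
  - La * (boxbump l h k (p.1 - s *: v) * dchi (p.2 - s * La)).
have lh01 : (0 <= (0 : R) <= 1) by rewrite lexx ler01.
have tb : test_function Omega (boxbump l h k).
  by apply: bump_test; have := lhO 0 lh01; rewrite scale0r !addr0.
have mdchi : measurable_fun setT dchi by exact: measurable_derivative hchi.
have mchi : measurable_fun setT chi.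
  by apply: continuous_measurable_fun; exact: is_smooth_continuous.
have bb := test_function_bmf tb.
have bd := test_function_derive_bmf v tb.
have m1 s : measurable_fun setT (fun p : ER => p.1 - s *: v).
  apply: (measurableT_comp (f := fun x : E => x - s *: v)); last exact: measurable_fst.
  exact: measurable_rV_add.
have m2 s : measurable_fun setT (fun p : ER => p.2 - s * La).
  by apply: measurable_funB; [exact: measurable_snd|exact: measurable_cst].
have bchi : bmf chi by split => //; exists C => y; have [] := hC y.
have bdchi : bmf dchi by split => //; exists C => y; have [] := hC y.
have bf s : bmf (f s).
  by apply: bmfM; [exact: (bmf_comp bb (m1 s))|exact: (bmf_comp bchi (m2 s))].
have b1 s : bmf (fun p : ER => - 'D_v (boxbump l h k) (p.1 - s *: v) * chi (p.2 - s * La)).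
  apply: bmfM; last exact: (bmf_comp bchi (m2 s)).
  by apply: bmfN; exact: (bmf_comp bd (m1 s)).
have b2 s : bmf (fun p : ER => boxbump l h k (p.1 - s *: v) * dchi (p.2 - s * La)).
  by apply: bmfM; [exact: (bmf_comp bb (m1 s))|exact: (bmf_comp bdchi (m2 s))].
have bdf s : bmf (df s).
  by apply: bmfB; [exact: b1|apply: bmfM; [exact: bmf_cst|exact: b2]].
have D s p : is_derive s (1 : R) (f ^~ p) (df s p).
  have D1 : is_derive s (1 : R) (fun s : R => boxbump l h k (p.1 - s *: v))
      (- 'D_v (boxbump l h k) (p.1 - s *: v)).
    apply/is_derive_line.
    have dN : is_derive (p.1 - s *: v) (- v) (boxbump l h k) (- 'D_v (boxbump l h k) (p.1 - s *: v)).
      apply: DeriveDef.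
        by apply: diff_derivable; exact: differentiable_bump.
      by rewrite deriveE ?linearN -?deriveE//; exact: differentiable_bump.
    move/is_derive_line : dN; congr (is_derive _ _ _ _); apply/funext => t.
    congr boxbump; rewrite (_ : t *: (1 : R) = t); last exact: mulr1.
    by rewrite scalerN scalerDl opprD addrCA.
  have D2 : is_derive s (1 : R) (fun s : R => chi (p.2 - s * La)) (dchi (p.2 - s * La) * - La).
    apply: (@is_derive1_comp R chi (fun s : R => p.2 - s * La)) => //.
    have := is_deriveB (is_derive_cst p.2 s (1:R)) (@is_deriveM _ _ _ _ s (1:R) _ _ (is_derive_id s (1:R)) (is_derive_cst La s (1:R))).
    by move=> h'; apply: (is_derive_eq h'); rewrite scaler0 !add0r /GRing.scale/= mulr1.
  apply: (is_derive_eq (is_deriveM D1 D2)).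
  rewrite /df /GRing.scale/=; ring.
have [Cd hCd] : exists Cd, forall s p, `|df s p| <= Cd.
  have [_ [B1 hB1]] := bb; have [_ [B2 hB2]] := bd.
  exists (B2 * C + La * (B1 * C)) => s p.
  have [c1 c2] := hC (p.2 - s * La).
  rewrite /df (le_trans (ler_normB _ _))// (normrM La) (ger0_norm La0) !normrM normrN; apply: lerD.
    by apply: ler_pM.
  by apply: ler_wpM2l => //; apply: ler_pM.
pose F s := \int[sg]_p f s p.
have Cd0 : 0 <= Cd by rewrite (le_trans _ (hCd 0 (0, 0))).
have dF s : is_derive s (1 : R) F (\int[sg]_p df s p).
  have Is : `](s - 1), (s + 1)[%classic s by rewrite /= in_itv/= ltrBlDr ltrDl ltr01.
  have d1 (x : R) (p : ER) : partial1of2 f x p = df x p.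
    by rewrite partial1of2E (@derive_val _ _ _ _ _ _ _ (D x p)).
  have h1 x : `](s - 1), (s + 1)[%classic x -> sg.-integrable setT (EFin \o f x).
    by move=> _; exact: bmf_integrable.
  have h2 (x : R) (y : ER) : `](s - 1), (s + 1)[%classic x -> setT y -> derivable (f^~ y) x 1.
    by move=> _ _; have [] := D x y.
  have h3 : sg.-integrable setT (EFin \o (fun=> Cd)).
    by apply: (bmf_integrable _ measurableT); exact: bmf_cst.
  have h4 (x : R) (y : ER) : `](s - 1), (s + 1)[%classic x -> setT y -> `|partial1of2 f x y| <= (fun=> Cd) y.
    by move=> _ _; rewrite d1.
  have dd := derivable_under_integral measurableT Is h1 h2 (fun=> Cd0) h3 h4.
  have de := differentiation_under_integral measurableT Is h1 h2 (fun=> Cd0) h3 h4.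
  apply: DeriveDef; first exact: dd.
  by rewrite -derive1E de; apply: eq_Rintegral => p _; rewrite d1.
have F0 : F 0 = \int[sg]_p (boxbump l h k p.1 * chi p.2).
  by apply: eq_Rintegral => p _; rewrite /f scale0r mul0r !subr0.
have F1 : F 1 = \int[sg]_p (boxbump (l + v) (h + v) k p.1 * chi (p.2 - La)).
  apply: eq_Rintegral => p _; rewrite /f scale1r mul1r; congr (_ * _).
  by have := boxbump_translate l h v p.1 k 1; rewrite scale1r.
rewrite -F0 -F1.
have pos s : 0 <= s <= 1 -> 0 <= \int[sg]_p df s p.
  move=> s01.
  have smooth_s : is_smooth (fun y => chi (y - s * La)) by move=> j; exact: is_Ck_shift.
  have der_s (y : R) : is_derive y (1 : R) (fun y => chi (y - s * La)) (dchi (y - s * La)).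
    apply/is_derive_line.
    have /is_derive_line := hchi (y - s * La).
    by under eq_fun do rewrite addrA.
  have := @transported_direction _ _ v k (fun y => chi (y - s * La))
    (fun y => dchi (y - s * La)) (lhO s s01) smooth_s der_s.
  have /[swap]/[apply] eq0 : exists C0 : R, forall y, `|chi (y - s * La)| <= C0 /\ `|dchi (y - s * La)| <= C0.
    by exists C => y; exact: hC.
  pose X (p : ER) := 'D_v (boxbump l h k) (p.1 - s *: v) * chi (p.2 - s * La) +
      boxbump l h k (p.1 - s *: v) * dchi (p.2 - s * La) * \sum_i v ord0 i * mz i p.
  have bS : bmf (fun p : ER => \sum_i v ord0 i * mz i p).
    apply: (@bmf_sum _ _ _ _ _ (fun i p => v ord0 i * mz i p)) => i.
    by apply: bmfM; [exact: bmf_cst|exact: bmz].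
  have bX : bmf X.
    apply: bmfD; last by apply: bmfM; [exact: b2|exact: bS].
    by apply: bmfM; [exact: (bmf_comp bd (m1 s))|exact: (bmf_comp bchi (m2 s))].
  have X0 : \int[sg]_p X p = 0.
    rewrite -[RHS]eq0; apply: eq_Rintegral => p _.
    by rewrite /X derive_boxbump_translate boxbump_translate.
  have -> : \int[sg]_p df s p = \int[sg]_p (df s p + X p) by rewrite [RHS](bintD sg (bdf s) bX) X0 addr0.
  apply: Rintegral_ge0 => p _.
  have -> : df s p + X p = boxbump l h k (p.1 - s *: v) * - dchi (p.2 - s * La) *
     (La - \sum_i v ord0 i * mz i p) by rewrite /df /X; ring.
  rewrite !mulr_ge0 ?bump_ge0 ?oppr_ge0// subr_ge0 (le_trans (ler_norm _))//.
  rewrite (le_trans (ler_norm_sum _ _ _))// /La.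
  rewrite (@le_trans _ _ (\sum_(i < n) `|v| * M))//.
    apply: ler_sum => i _; rewrite normrM ler_pM//; first exact: norm_rV_le.
    by case: tr => _ _ _ /(_ i)[_ ->].
  by rewrite sumr_const card_ord -[leLHS]mulr_natl mulrAC mulrA.
(* Mean value theorem: F(1) - F(0) is a value of the derivative. *)
have [|c c01 e] := @MVT_segment R F (fun s => \int[sg]_p df s p) 0 1 ler01.
- by apply: continuous_subspaceT; exact: is_derive_continuous dF.
- rewrite -subr_ge0 e subr0 mulr1; apply: pos.
  by move: c01; rewrite in_itv.
Qed.

(** Limit of the smooth version, as the bumps increase to the indicator of the
    box and flat (k (a - y)) to that of the half-line. *)
Lemma propagation (l h v : E) (a : R) :
  (forall s, 0 <= s <= 1 -> cbox (l + s *: v) (h + s *: v) `<=` Omega) ->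
  (sg (obox l h `*` below a) <=
   sg (obox (l + v)%R (h + v)%R `*` below (a + n%:R * M * `|v|)%R))%E.
Proof.
move=> lhO; set La := n%:R * M * `|v|.
pose ch k (y : R) := flat (k.+1%:R * (a - y)).
pose dch k (y : R) := flat' (k.+1%:R * (a - y)) * - k.+1%:R.
have [C C0 hC] := @flat'_bounded R.
have sch k : is_smooth (ch k).
  apply: (is_smooth_comp (th := flat)); first exact: smooth1_flat.
  rewrite (_ : (fun y => _) = fun y : R => - k.+1%:R * y + k.+1%:R * a).
    by apply: is_smooth_affine; exact: is_smooth_id.
  by apply/funext => y; rewrite mulrBr addrC mulNr.
have dchE k (y : R) : is_derive y (1 : R) (ch k) (dch k y).
  apply: (@is_derive1_comp R flat (fun y => k.+1%:R * (a - y))); first exact: is_derive_flat.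
  have h1 := is_deriveM (is_derive_cst (k.+1%:R : R) y (1:R))
    (is_deriveB (is_derive_cst a y (1:R)) (is_derive_id y (1:R))).
  by apply: (is_derive_eq h1); rewrite scaler0 addr0 sub0r /GRing.scale/= mulrN mulr1.
have ineq k := @propagation_smooth l h v k (ch k) (dch k) lhO (sch k) (dchE k).
have cv l' h' b : \int[sg]_p (boxbump l' h' k p.1 * flat (k.+1%:R * (b - p.2))) @[k --> \oo]
    --> fine (sg (obox l' h' `*` below b)).
  rewrite -bint_indic; last exact: measurableX (measurable_obox _ _) (measurable_below _).
  apply: (@bint_cvg _ _ _ sg _ _ 1).
  - move=> k; apply: measurable_funM.
      apply: (measurableT_comp (f := boxbump l' h' k)); last exact: measurable_fst.
      by apply: continuous_measurable_rV; apply: is_smooth_continuous; exact: smooth_bump.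
    apply: (measurableT_comp (f := flat)); first exact: measurable_flat.
    apply: measurable_funM; first exact: measurable_cst.
    by apply: measurable_funB; [exact: measurable_cst|exact: measurable_snd].
  - move=> k p; rewrite normrM !ger0_norm ?flat_ge0 ?bump_ge0//.
    by rewrite mulr_ile1 ?flat_ge0 ?bump_ge0 ?flat_le1 ?bump_le1.
  - move=> [x y] /=.
    have -> : \1_(obox l' h' `*` below b) (x, y) =
       \1_(obox l' h') x * (if 0 < b - y then 1 else 0) :> R.
      rewrite subr_gt0 !indicE in_setX /= [(y \in _)](_ : _ = (y < b)); last first.
        by apply/idP/idP; rewrite inE.
      by case: (_ \in _); case: (_ < _); rewrite ?mulr1 ?mulr0 ?mul0r.
    by apply: cvgM; [exact: cvg_bump|exact: cvg_flat_scale].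
have c1 := cv l h a; have c2 := cv (l + v) (h + v) (a + La).
have mX l' h' b : measurable (obox l' h' `*` below b : set ER).
  by apply: measurableX; [exact: measurable_obox|exact: measurable_below].
rewrite -(fineK (fin_num_measure sg _ (mX l h a))).
rewrite -(fineK (fin_num_measure sg _ (mX (l + v) (h + v) (a + La)))) lee_fin.
apply: (ler_cvg_to c1 c2); apply: nearW => k.
have := ineq k; rewrite -/La => /(_ _ _ _) ineqk.
have -> : \int[sg]_p (boxbump (l + v) (h + v) k p.1 * flat (k.+1%:R * (a + La - p.2))) =
  \int[sg]_p (boxbump (l + v) (h + v) k p.1 * ch k (p.2 - La)).
  by apply: eq_Rintegral => p _; rewrite /ch; congr (_ * flat (_ * _)); ring.
apply: ineqk.
- by move=> y; exact: flat_ge0.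
- by move=> y; rewrite /dch mulrN oppr_le0 mulr_ge0// flat'_ge0.
- exists (1 + C * k.+1%:R) => y; split.
    by rewrite ger0_norm ?flat_ge0// (le_trans (flat_le1 _))// lerDl mulr_ge0.
  by rewrite normrM normrN (ger0_norm (ler0n _ _)) (@le_trans _ _ (C * k.+1%:R)) ?ler_wpM2r ?lerDr.
Qed.

End propagation.

(** * Averages at small scales *)

Section liminf_lemmas.
Context {R : realType}.
Local Open Scope ereal_scope.
Implicit Types u v : (\bar R)^nat.

Lemma limn_einfE u : limn_einf u = ereal_sup (range (einfs u)).
Proof. by rewrite limn_einf_lim; apply/cvg_lim => //; exact: cvg_einfs_sup. Qed.

Lemma limn_einf_mono u v N : (forall k, (N <= k)%N -> u k <= v k) ->
  limn_einf u <= limn_einf v.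
Proof.
move=> uv; rewrite !limn_einfE; apply: ge_ereal_sup => _ [k _ <-].
apply: (@le_trans _ _ (einfs v (maxn k N))); last by apply: ereal_sup_ubound; exists (maxn k N).
apply: le_ereal_inf_tmp => _ [j /= kj <-].
apply: (le_trans _ (uv j _)).
  by apply: ereal_inf_lbound; exists j => //=; rewrite (leq_trans _ kj)// leq_maxl.
by rewrite (leq_trans _ kj)// leq_maxr.
Qed.

Lemma limn_einf_cst (l : \bar R) : limn_einf (fun=> l) = l.
Proof.
have h : (fun=> l : \bar R) @ \oo --> l by exact: cvg_cst.
by rewrite is_cvg_limn_einfE; [exact/cvg_lim|apply/cvg_ex; exists l].
Qed.

Lemma le_limn_einf u l N : (forall k, (N <= k)%N -> l <= u k) -> l <= limn_einf u.
Proof. by move=> lu; have := @limn_einf_mono (fun=> l) u N lu; rewrite limn_einf_cst. Qed.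

Lemma limn_einf_le u l N : (forall k, (N <= k)%N -> u k <= l) -> limn_einf u <= l.
Proof. by move=> lu; have := @limn_einf_mono u (fun=> l) N lu; rewrite limn_einf_cst. Qed.

Lemma measurable_fun_limn_einf d (T : measurableType d) (D : set T) (f : (T -> \bar R)^nat) :
  measurable D ->
  (forall k, measurable_fun D (f k)) -> measurable_fun D (fun x => limn_einf (f ^~ x)).
Proof.
move=> mD mf; apply: (emeasurable_fun_cvg (fun k x => einfs (f ^~ x) k)).
  by move=> k; exact: measurable_fun_einfs.
by move=> x Dx; rewrite limn_einfE; exact: cvg_einfs_sup.
Qed.

End liminf_lemmas.

Section inner_sets.
Context {R : realType} {n : nat}.
Notation E := 'rV[R]_n.
Implicit Types (U : set E).

(** The points lying at distance larger than e from the complement. *)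
Definition inner (e : R) U : set E := [set x | exists2 rho, e < rho & ball x rho `<=` U].

Lemma ball_normP (x y : E) (e : R) : ball x e y <-> `|x - y| < e.
Proof. by rewrite mx_norm_ball. Qed.

Lemma inner_open e U : 0 <= e -> open (inner e U).
Proof.
move=> e0; rewrite openE => x [rho erho xU].
have r0 : 0 < (rho - e) / 2 by rewrite divr_gt0// subr_gt0.
apply/nbhs_ballP; exists ((rho - e) / 2) => //= y /ball_normP xy.
exists ((rho + e) / 2); first lra.
move=> z /ball_normP yz; apply: xU; apply/ball_normP.
rewrite -(subrK y x) -addrA (le_lt_trans (ler_normD _ _))//; lra.
Qed.

Lemma inner_sub e U : 0 <= e -> inner e U `<=` U.
Proof.
move=> e0 x [rho erho]; apply; apply: ballxx; exact: le_lt_trans erho.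
Qed.

Lemma inner_mono e e' U : e <= e' -> inner e' U `<=` inner e U.
Proof. by move=> ee x [rho erho xU]; exists rho => //; exact: le_lt_trans erho. Qed.

Lemma inner_ball e U x z : inner e U x -> ball x e z -> U z.
Proof. by move=> [rho /ltW erho xU] xz; apply: xU; exact: (le_ball erho). Qed.

Lemma inner_inner e e' U x z : inner (e + e') U x -> ball x e z -> inner e' U z.
Proof.
move=> [rho erho xU] /ball_normP xz; exists (rho - e); first lra.
move=> w /ball_normP zw; apply: xU; apply/ball_normP.
rewrite -(subrK z x) -addrA (le_lt_trans (ler_normD _ _))//; lra.
Qed.

Definition eps (k : nat) : R := k.+1%:R^-1.

Lemma eps_gt0 k : 0 < eps k. Proof. by rewrite invr_gt0. Qed.

Lemma eps_small (e : R) : 0 < e -> exists N, forall k, (N <= k)%N -> eps k < e.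
Proof.
move=> e0; have /cvgrPdist_lt/(_ _ e0)[N _ hN] := @cvg_harmonic R.
by exists N => k /hN; rewrite sub0r normrN gtr0_norm ?invr_gt0.
Qed.

Lemma eps_le k j : (k <= j)%N -> eps j <= eps k.
Proof. by move=> kj; rewrite lef_pV2 ?posrE// ler_nat. Qed.

Lemma bigcup_inner U (C : R) : 0 < C -> open U -> \bigcup_k inner (C * eps k) U = U.
Proof.
move=> C0 oU; apply/seteqP; split => [x [k _]|x Ux].
  by apply: inner_sub; rewrite mulr_ge0// ltW// eps_gt0.
have : nbhs x U by exact: open_nbhs_nbhs.
move=> /nbhs_ballP[e /= e0 eU].
have [k /(_ k (leqnn k)) kC] := eps_small (divr_gt0 e0 C0).
by exists k => //; exists e => //; rewrite mulrC -ltr_pdivlMr.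
Qed.

Lemma ball_measurable (x : E) (e : R) : measurable (ball x e).
Proof. exact: measurable_ball_rV. Qed.

Lemma norm_le_coord (x : E) (e : R) : 0 <= e -> (forall i, `|x ord0 i| <= e) -> `|x| <= e.
Proof.
move=> e0 h; rewrite [leLHS]mx_normrE; apply/bigmax_leP; split => // -[i j] _ /=.
by rewrite ord1.
Qed.

Lemma obox_ball (x : E) (e : R) : 0 < e ->
  obox (x - const_mx e) (x + const_mx e) = ball x e.
Proof.
move=> e0; rewrite rV_ballE//; apply/seteqP; split => y /= h i; have := h i;
  rewrite /ball/= !mxE.
  by move=> /andP[? ?]; rewrite ltr_norml; apply/andP; split; lra.
by rewrite ltr_norml => /andP[? ?]; apply/andP; split; lra.
Qed.

Lemma cbox_ball (x y : E) (e : R) : 0 < e ->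
  cbox (x - const_mx e) (x + const_mx e) y -> `|x - y| <= e.
Proof.
move=> e0 h; apply: norm_le_coord; first exact: ltW.
move=> i; have := h i; rewrite !mxE => /andP[? ?].
by rewrite ler_norml; apply/andP; split; lra.
Qed.

End inner_sets.

Section averages.
Context {R : realType} {n : nat} (Omega : set 'rV[R]_n).
Notation E := 'rV[R]_n.
Notation ER := ('rV[R]_n * R)%type.
Variables (sg : {finite_measure set ER -> \bar R}) (mz : 'I_n -> ER -> R) (M : R).
Hypothesis tr : transported Omega sg mz M.

(** The Lipschitz constant of the vertical displacement: n coordinates, each
    with velocity at most M. *)
Definition speed : R := n%:R * M.
Notation L := speed.

Lemma speed_ge0 : 0 <= L.
Proof. by case: tr => _ /ltW M0 _ _ _; rewrite mulr_ge0. Qed.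

Lemma measurableXb (B : set E) (a : R) : measurable B -> measurable (B `*` below a).
Proof. by move=> mB; apply: measurableX => //; exact: measurable_below. Qed.

Lemma sg_mono (A B : set E) a b : measurable A -> measurable B -> A `<=` B -> a <= b ->
  (sg (A `*` below a) <= sg (B `*` below b))%E.
Proof.
move=> mA mB AB ab; apply: le_measure; rewrite ?inE//; try exact: measurableXb.
by move=> [x y] [/= Ax ya]; split; [exact: AB|exact: (below_mono ab)].
Qed.

(** Balls of the sup norm are boxes, and those along the segment stay in the
    convex ball around x0. *)
Lemma ball_propagation (x0 x x' : E) (rho e a : R) :
  ball x0 rho `<=` Omega -> 0 < e -> `|x0 - x| + e < rho -> `|x0 - x'| + e < rho ->
  (sg (ball x e `*` below a) <= sg (ball x' e `*` below (a + L * `|x - x'|)%R))%E.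
Proof.
move=> x0O e0 xr x'r.
have := @propagation _ _ _ _ _ _ tr (x - const_mx e) (x + const_mx e) (x' - x) a.
have -> : x - const_mx e + (x' - x) = x' - const_mx e by apply/matrixP => i j; rewrite !mxE; ring.
have -> : x + const_mx e + (x' - x) = x' + const_mx e by apply/matrixP => i j; rewrite !mxE; ring.
rewrite !obox_ball// distrC; apply => s s01 y.
have -> : x - const_mx e + s *: (x' - x) = (x + s *: (x' - x)) - const_mx e by rewrite addrAC.
have -> : x + const_mx e + s *: (x' - x) = (x + s *: (x' - x)) + const_mx e by rewrite addrAC.
move=> /(cbox_ball e0) h; apply: x0O; apply/ball_normP.
have -> : x0 - y = (1 - s) *: (x0 - x) + s *: (x0 - x') + (x + s *: (x' - x) - y).
  rewrite !scalerBr !scalerBl !scale1r; apply/matrixP => i j; rewrite !mxE; ring.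
(* The point x + s (x' - x) is a convex combination, so its distance to x0 is
   less than rho - e. *)
move: s01 => /andP[s0 s1].
rewrite (le_lt_trans (ler_normD _ _))// (le_lt_trans (lerD (ler_normD _ _) h))//.
rewrite !normrZ (ger0_norm s0) ger0_norm ?subr_ge0//.
have := ler_wpM2l s0 (ltW x'r).
have s1' : 0 <= 1 - s by lra.
have [s_eq0|sn0] := eqVneq s 0.
  by move=> _; rewrite s_eq0; lra.
have := @ler_wpM2l _ _ s1' _ _ (ltW xr).
have : s * (`|x0 - x'| + e) < s * rho by rewrite ltr_pM2l// lt_neqAle eq_sym sn0.
by nra.
Qed.

Definition vol (e : R) : R := (e *+ 2) ^+ n.

Lemma vol_gt0 e : 0 < e -> 0 < vol e.
Proof. by move=> e0; rewrite exprn_gt0// mulrn_wgt0. Qed.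

(** Density at scale e of the mass below the level a. *)
Definition avg (e a : R) (x : E) : \bar R :=
  ((vol e)^-1%:E * sg (ball x e `*` below a))%E.

Lemma avg_ge0 e a x : 0 < e -> (0 <= avg e a x)%E.
Proof. by move=> e0; rewrite mule_ge0// lee_fin invr_ge0 ltW// vol_gt0. Qed.

Lemma avg_propagation (x0 x x' : E) (rho e a b : R) :
  ball x0 rho `<=` Omega -> 0 < e -> `|x0 - x| + e < rho -> `|x0 - x'| + e < rho ->
  a + L * `|x - x'| <= b -> (avg e a x <= avg e b x')%E.
Proof.
move=> x0O e0 xr x'r ab; rewrite lee_pmul2l ?lte_fin ?invr_gt0 ?vol_gt0//.
rewrite (le_trans (ball_propagation a x0O e0 xr x'r))//.
by apply: sg_mono => //; exact: ball_measurable.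
Qed.

Let C (B : set E) e a : set (E * ER) :=
  [set q | B q.1 /\ ball q.1 e q.2.1 /\ below a q.2.2].

Let mC B e a : 0 < e -> measurable B -> measurable (C B e a).
Proof.
move=> e0 mB; apply: measurableI.
  by have := @measurable_fst _ _ E ER measurableT _ mB; rewrite setTI.
apply: measurableI; last first.
  have ms : measurable_fun setT (fun q : E * ER => q.2.2).
    exact: (measurableT_comp measurable_snd measurable_snd).
  by have := ms measurableT _ (measurable_below a); rewrite setTI.
have oD : open [set q : E * E | `|q.1 - q.2| < e].
  apply: (@open_comp _ _ (fun q : E * E => `|q.1 - q.2|) [set t | t < e]); last exact: open_lt.
  move=> q _; apply: (@continuous_comp _ _ _ (fun q : E * E => q.1 - q.2) (fun z : E => `|z|)).
    by apply: cvgB; [exact: cvg_fst|exact: cvg_snd].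
  exact: norm_continuous.
have mp : measurable_fun setT (fun q : E * ER => (q.1, q.2.1)).
  apply: measurable_fun_pair => //.
  exact: (measurableT_comp measurable_fst measurable_snd).
have := mp measurableT _ (open_measurable_rVrV oD); rewrite setTI.
rewrite (_ : _ @^-1` _ = (fun q : E * ER => ball q.1 e q.2.1))//.
by apply/seteqP; split => q /= /ball_normP.
Qed.

Let avg_fubini (B : set E) e a : 0 < e -> measurable B ->
  (\int[leb n]_(x in B) sg (ball x e `*` below a) =
   \int[sg]_p leb n (ysection (C B e a) p))%E.
Proof.
move=> e0 mB.
have -> : (\int[leb n]_(x in B) sg (ball x e `*` below a) =
    \int[leb n]_x sg (xsection (C B e a) x))%E.
  rewrite integral_mkcond; apply: eq_integral => x _; rewrite patchE.
  case: ifPn => xB.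
    congr (sg _); apply/seteqP; split => -[z y]; rewrite /xsection /C /= inE /=.
      by move=> [? ?]; rewrite inE in xB.
    by move=> [_ [? ?]].
  rewrite (_ : xsection _ _ = set0) ?measure0//; apply/seteqP; split => // -[z y].
  by rewrite /xsection /C /= inE /= => -[Bx _]; move/negP: xB; rewrite inE.
have := @product_measure_unique _ _ _ _ R (leb n) sg (leb n \x^ sg)%E
  (fun A B mA mB => product_measure2E _ _ mA mB) _ (mC a e0 mB).
by [].
Qed.


Let measurable_ball_mass e a : 0 < e ->
  measurable_fun setT (fun x : E => sg (ball x e `*` below a)).
Proof.
move=> e0; rewrite (_ : (fun _ => _) = (fun x => sg (xsection (C setT e a) x))); last first.
  apply/funext => x; congr (sg _); apply/seteqP; split => -[z y].
    by move=> h; rewrite /xsection /C /= inE.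
  by rewrite /xsection /C /= inE => -[].
by apply: measurable_fun_xsection; exact: mC.
Qed.

Lemma measurable_avg e a : 0 < e -> measurable_fun setT (avg e a).
Proof. by move=> e0; apply: measurable_funeM; exact: measurable_ball_mass. Qed.

Let avg_int (B : set E) e a : 0 < e -> measurable B ->
  (\int[leb n]_(x in B) avg e a x =
   \int[sg]_p ((vol e)^-1%:E * leb n (ysection (C B e a) p)))%E.
Proof.
move=> e0 mB; have v0 : 0 <= (vol e)^-1 by rewrite invr_ge0 ltW// vol_gt0.
rewrite ge0_integralZl_EFin//; last first.
  exact: measurable_funS (measurable_ball_mass a e0).
rewrite avg_fubini// ge0_integralZl_EFin//.
by apply: measurable_fun_ysection; exact: mC.
Qed.

(** Exchanging the integrals over x and over sg, a point (z, y) with z in Bm is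
    counted with weight 1: the ball around z lies in B. *)
Lemma avg_lower (B Bm : set E) e a : 0 < e -> measurable B -> measurable Bm ->
  (forall x, Bm x -> ball x e `<=` B) ->
  (sg (Bm `*` below a) <= \int[leb n]_(x in B) avg e a x)%E.
Proof.
move=> e0 mB mBm BmB; rewrite avg_int//.
have mBa : measurable (Bm `*` below a) by exact: measurableXb.
have -> : sg (Bm `*` below a) = (\int[sg]_p (\1_(Bm `*` below a) p)%:E)%E.
  by rewrite integral_indic// setIT.
have v0 : (0 <= (vol e)^-1%:E)%E by rewrite lee_fin invr_ge0 ltW// vol_gt0.
apply: ge0_le_integral => //.
- by apply/measurable_EFinP; exact: measurable_indic.
- by apply: measurable_funeM; apply: measurable_fun_ysection; exact: mC.
move=> [z y] _; have [[/= Bz ya]|nB] := pselect ((Bm `*` below a) (z, y)); last first.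
  by rewrite indicE memNset//= mule_ge0.
rewrite indicE mem_set//.
rewrite -lee_pdivrMl ?invr_gt0 ?vol_gt0// invrK -EFinM mulr1 -(leb_ball z e0).
apply: le_measure; rewrite ?inE.
- exact: ball_measurable.
- by apply: measurable_ysection; exact: mC.
move=> x zx; rewrite /ysection /C /= inE /=; split; first exact: (BmB _ Bz).
by split => //; exact: ball_sym.
Qed.

(** Same exchange of integrals: each point counts at most once, and only if its
    base point lies in Bp. *)
Lemma avg_upper (B Bp : set E) e a : 0 < e -> measurable B -> measurable Bp ->
  (forall x z, B x -> ball x e z -> Bp z) ->
  (\int[leb n]_(x in B) avg e a x <= sg (Bp `*` below a))%E.
Proof.
move=> e0 mB mBp BBp; rewrite avg_int//.
have mBa : measurable (Bp `*` below a) by exact: measurableXb.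
have -> : sg (Bp `*` below a) = (\int[sg]_p (\1_(Bp `*` below a) p)%:E)%E.
  by rewrite integral_indic// setIT.
have v0 : (0 <= (vol e)^-1%:E)%E by rewrite lee_fin invr_ge0 ltW// vol_gt0.
apply: ge0_le_integral => //.
- by move=> p _; rewrite mule_ge0.
- by apply: measurable_funeM; apply: measurable_fun_ysection; exact: mC.
- by apply/measurable_EFinP; exact: measurable_indic.
move=> [z y] _.
rewrite -lee_pdivlMl ?invr_gt0 ?vol_gt0// invrK.
have [Bz|nB] := pselect ((Bp `*` below a) (z, y)).
  rewrite indicE mem_set// -EFinM mulr1 -(leb_ball z e0).
  apply: le_measure; rewrite ?inE.
  - by apply: measurable_ysection; exact: mC.
  - exact: ball_measurable.
  by move=> x; rewrite /ysection /C /= inE /= => -[_ [xz _]]; exact: ball_sym.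
rewrite indicE memNset//= mule0.
have -> : ysection (C B e a) (z, y) = set0; last by rewrite measure0.
apply/seteqP; split => // x; rewrite /ysection /C /= inE /= => -[Bx [xz ya]].
by apply: nB; split => //=; exact: (BBp x).
Qed.

(** Averaging over a ball of radius d at the small scale e, and propagating
    to its centre, compares the averages at the two scales. *)
Lemma avg_scale_lower (x0 : E) (rho d e a : R) : ball x0 rho `<=` Omega ->
  0 < e -> e < d -> d + e < rho ->
  (sg (ball x0 (d - e) `*` below a) <= (vol d)%:E * avg e (a + L * d) x0)%E.
Proof.
move=> x0O e0 ed der.
have d0 : 0 < d by lra.
apply: (le_trans (@avg_lower (ball x0 d) (ball x0 (d - e)) e a e0 _ _ _)).
- exact: ball_measurable.
- exact: ball_measurable.
- move=> x /ball_normP xd y /ball_normP yx; apply/ball_normP.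
  rewrite -(subrK x x0) -addrA (le_lt_trans (ler_normD _ _))//; lra.
apply: (@le_trans _ _ (\int[leb n]_(x in ball x0 d) cst (avg e (a + L * d) x0) x)%E).
  apply: ge0_le_integral => //.
  - exact: ball_measurable.
  - by move=> x _; exact: avg_ge0.
  - apply: measurable_funS (measurable_avg a e0) => //.
  move=> x /ball_normP xd; apply: (@avg_propagation x0 x x0 rho) => //; first lra.
    by rewrite subrr normr0; lra.
  by rewrite lerD2l ler_wpM2l ?speed_ge0// distrC ltW.
rewrite integral_cst; last exact: ball_measurable.
by have -> : (vol d)%:E = leb n (ball x0 d) by [rewrite leb_ball]; rewrite muleC.
Qed.

(** The same comparison, propagating from the centre instead. *)
Lemma avg_scale_upper (x0 : E) (rho d e a : R) : ball x0 rho `<=` Omega ->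
  0 < e -> e < d -> d + e < rho ->
  ((vol d)%:E * avg e (a - L * d) x0 <= sg (ball x0 (d + e)%R `*` below a))%E.
Proof.
move=> x0O e0 ed der.
have d0 : 0 < d by lra.
apply: (le_trans _ (@avg_upper (ball x0 d) (ball x0 (d + e)) e a e0 _ _ _)).
- apply: (@le_trans _ _ (\int[leb n]_(x in ball x0 d) cst (avg e (a - L * d) x0) x)%E).
    rewrite integral_cst; last exact: ball_measurable.
    by have -> : (vol d)%:E = leb n (ball x0 d) by [rewrite leb_ball]; rewrite muleC.
  apply: ge0_le_integral => //.
  - exact: ball_measurable.
  - by move=> x _; exact: avg_ge0.
  - apply: measurable_funS (measurable_avg a e0) => //.
  move=> x /ball_normP xd; apply: (@avg_propagation x0 x0 x rho) => //.
  - by rewrite subrr normr0; lra.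
  - lra.
  have : L * `|x0 - x| <= L * d by rewrite ler_wpM2l ?speed_ge0// ltW.
  lra.
- exact: ball_measurable.
- exact: ball_measurable.
move=> x y /ball_normP xd /ball_normP yx; apply/ball_normP.
rewrite -(subrK x x0) -addrA (le_lt_trans (ler_normD _ _))//; lra.
Qed.

End averages.

(** * Constancy of the mean density *)

Section increasing_unions.
Context d (T : measurableType d) {R : realType} (m : {measure set T -> \bar R}).
Local Open Scope ereal_scope.
Variable F : (set T)^nat.
Hypothesis mF : forall k, measurable (F k).
Hypothesis ndF : forall k j, (k <= j)%N -> F k `<=` F j.

Let nd : nondecreasing_seq F.
Proof. by move=> k j kj; apply/subsetPset; exact: ndF. Qed.

Lemma measure_bigcup_le l : (forall k, m (F k) <= l) -> m (\bigcup_k F k) <= l.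
Proof.
move=> ml; have h := nondecreasing_cvg_mu (mu := m) mF (measurable_bigcup_nat mF) nd.
rewrite -(cvg_lim _ h)//; apply: lime_le; first by apply/cvg_ex; eexists; exact: h.
by apply: nearW => k; exact: ml.
Qed.

Lemma integral_bigcup_le (f : T -> \bar R) l : measurable_fun setT f -> (forall x, 0 <= f x) ->
  (forall k, \int[m]_(x in F k) f x <= l) -> \int[m]_(x in \bigcup_k F k) f x <= l.
Proof.
move=> mf f0 ml.
have h := @ge0_nondecreasing_set_cvg_integral _ _ _ F f m nd mF.
rewrite -(cvg_lim _ (h _ _))//.
- apply: lime_le; first by apply/cvg_ex; eexists; apply: h => // k; exact: measurable_funS mf.
  by apply: nearW => k; exact: ml.
- by move=> k; exact: measurable_funS mf.
Qed.

End increasing_unions.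

Section mass_constant.
Context {R : realType} {n : nat} (Omega : set 'rV[R]_n).
Notation E := 'rV[R]_n.
Notation ER := ('rV[R]_n * R)%type.
Variables (sg : {finite_measure set ER -> \bar R}) (mz : 'I_n -> ER -> R) (M : R).
Hypothesis tr : transported Omega sg mz M.
Notation L := (@speed R n M).

Lemma sg_below_gt (B : set E) a : measurable B -> M < a -> sg (B `*` below a) = sg (B `*` setT).
Proof.
move=> mB Ma; case: tr => oO M0 sg0 _ _.
apply/le_anti/andP; split.
  apply: le_measure; rewrite ?inE; [exact: measurableXb|exact: measurableX|].
  by move=> [x y] [].
have mO := measurable_slab M (open_measurable_rV oO).
apply: (@le_trans _ _ (sg ((B `*` below a) `|` ~` [set p : ER | Omega p.1 /\ `|p.2| <= M]))).
  apply: le_measure; rewrite ?inE; first exact: measurableX.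
    by apply: measurableU; [exact: measurableXb|exact: measurableC].
  move=> [x y] [/= Bx _]; have [[? yM]|nO] := pselect (Omega x /\ `|y| <= M); last by right.
  by left; split => //=; rewrite /below/=; have := ler_norm y; lra.
rewrite -[leRHS]adde0 -sg0; apply: measureU2; [exact: measurableXb|exact: measurableC].
Qed.

Lemma sg_below_le (B : set E) a : measurable B -> a <= - M -> sg (B `*` below a) = 0%E.
Proof.
move=> mB Ma; case: tr => oO M0 sg0 _ _; apply/eqP; rewrite eq_le measure_ge0 andbT -sg0.
have mO := measurable_slab M (open_measurable_rV oO).
apply: le_measure; rewrite ?inE; [exact: measurableXb|exact: measurableC|].
by move=> [x y] [/= _ ya] [_]; rewrite ler_norml => /andP[? _]; move: ya; rewrite /below/=; lra.
Qed.

(** Mass per unit volume of the projection of sg on the base. *)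
Definition dens (e : R) (x : E) : R := fine (sg (ball x e `*` setT)) / @vol R n e.

Lemma dens_ge0 e x : 0 < e -> 0 <= dens e x.
Proof. by move=> e0; rewrite divr_ge0 ?fine_ge0// ltW// vol_gt0. Qed.

Lemma avg_dens e a x : M < a -> avg sg e a x = (dens e x)%:E.
Proof.
move=> Ma; rewrite /avg sg_below_gt//; last exact: ball_measurable.
have fin : sg (ball x e `*` setT) \is a fin_num.
  by apply: fin_num_measure; apply: measurableX => //; exact: ball_measurable.
by rewrite /dens muleC EFinM fineK.
Qed.

(** Above the level M all the mass is counted, so that propagation in both
    directions gives an equality. *)
Lemma dens_local x0 rho x e : ball x0 rho `<=` Omega -> 0 < e -> `|x0 - x| + e < rho ->
  dens e x = dens e x0.
Proof.
move=> x0O e0 xr; apply/le_anti/andP.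
have L0 : 0 <= L := speed_ge0 tr.
have x00 : `|x0 - x0| + e < rho.
  by rewrite subrr normr0; have := normr_ge0 (x0 - x); lra.
have M1 : M < M + 1 by lra.
split; rewrite -lee_fin.
  rewrite -(avg_dens e x M1).
  have Mb : M < M + 1 + L * `|x - x0| by rewrite ltr_wpDr// mulr_ge0.
  by rewrite -(avg_dens e x0 Mb); apply: (avg_propagation tr x0O).
rewrite -(avg_dens e x0 M1).
have Mb : M < M + 1 + L * `|x0 - x| by rewrite ltr_wpDr// mulr_ge0.
by rewrite -(avg_dens e x Mb); apply: (avg_propagation tr x0O).
Qed.

(** Averages at a common small scale e compare the masses of the balls of radii
    p and q, up to errors that vanish with e. *)
Lemma dens_scale_le x0 rho p q : ball x0 rho `<=` Omega -> 0 < p < rho -> 0 < q < rho ->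
  dens p x0 <= dens q x0.
Proof.
move=> x0O /andP[p0 pr] /andP[q0 qr].
pose s (d : R) : R := fine (sg (ball x0 d `*` setT)).
have fin d : sg (ball x0 d `*` setT) \is a fin_num.
  by apply: fin_num_measure; apply: measurableX => //; exact: ball_measurable.
have M1 : M < M + 1 by lra.
have L0 : 0 <= L := speed_ge0 tr.
have mb d : measurable (ball x0 d) by exact: ball_measurable.
have step e : 0 < e -> e < q - e -> p + e + e < rho ->
    s p <= ((p + e) *+ 2) ^+ n * (((q - e) *+ 2) ^+ n)^-1 * s q.
  move=> e0 eq per.
  have lo : s p <= @vol R n (p + e) * dens e x0.
    rewrite -lee_fin EFinM fineK//.
    have Mb : M < M + 1 + L * (p + e) by rewrite ltr_wpDr// mulr_ge0//; lra.
    rewrite -(avg_dens e x0 Mb).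
    rewrite -(sg_below_gt (mb p) M1).
    have := avg_scale_lower tr (M + 1) x0O e0 (d := p + e).
    by rewrite addrK; apply; lra.
  have hi : @vol R n (q - e) * dens e x0 <= s q.
    rewrite -lee_fin EFinM fineK//.
    have Mb : M < M + 1 + L * (q - e) - L * (q - e) by rewrite addrK.
    have Mb' : M < M + 1 + L * (q - e) by rewrite ltr_wpDr// mulr_ge0//; lra.
    rewrite -(avg_dens e x0 Mb) -(sg_below_gt (mb q) Mb').
    have := avg_scale_upper tr (M + 1 + L * (q - e)) x0O e0 (d := q - e).
    by rewrite subrK; apply; lra.
  apply: (le_trans lo); rewrite -/(@vol R n (p + e)) -/(@vol R n (q - e)) -mulrA.
  have qe0 : 0 < q - e by lra.
  have pe0 : 0 < p + e by lra.
  apply: ler_wpM2l; first exact/ltW/vol_gt0.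
  by rewrite ler_pdivlMl// vol_gt0.
have cont : (fun k => ((p + eps k) *+ 2) ^+ n * (((q - eps k) *+ 2) ^+ n)^-1 * s q)
    @ \oo --> (p *+ 2) ^+ n * ((q *+ 2) ^+ n)^-1 * s q.
  have e0 : (@eps R) @ \oo --> (0 : R) by exact: cvg_harmonic.
  have cX (g : nat -> R) l : g @ \oo --> l -> (g k *+ 2) ^+ n @[k --> \oo] --> (l *+ 2) ^+ n.
    move=> gl; have h := @exprn_continuous R n (l *+ 2).
    by apply: (cvg_comp (fun k => g k *+ 2) (fun t => t ^+ n) _ h); exact: cvgMn.
  apply: cvgMl; apply: cvgM.
    apply: cX; rewrite -[in X in _ --> X](addr0 p).
    by apply: cvgD => //; exact: cvg_cst.
  apply: cvgV; first by rewrite gt_eqF// exprn_gt0// mulrn_wgt0.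
  apply: cX; rewrite -[in X in _ --> X](subr0 q).
  by apply: cvgB => //; exact: cvg_cst.
have [|N hN] := @eps_small R (Num.min (q / 2) ((rho - p) / 2)).
  by rewrite lt_min !divr_gt0// subr_gt0.
have lim : s p <= (p *+ 2) ^+ n * ((q *+ 2) ^+ n)^-1 * s q.
  rewrite -(cvg_lim _ cont)//; apply: limr_ge; first by apply/cvg_ex; eexists; exact: cont.
  exists N => // k /= /hN; rewrite lt_min => /andP[k1 k2].
  by apply: step; [exact: eps_gt0|lra|lra].
rewrite /dens ler_pdivrMr ?vol_gt0// (le_trans lim)// -/(s q) /vol.
by rewrite mulrC mulrA mulrAC.
Qed.

Lemma dens_scale x0 rho rho' p q : ball x0 rho `<=` Omega -> ball x0 rho' `<=` Omega ->
  0 < p < rho -> 0 < q < rho' -> dens p x0 = dens q x0.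
Proof.
move=> xO xO' /andP[p0 pr] /andP[q0 qr].
wlog le_rho : rho rho' p q xO xO' p0 pr q0 qr / rho <= rho'.
  move=> h; have /orP[le|le] := le_total rho rho'; first exact: (h rho rho').
  by apply/esym; apply: (h rho' rho).
have pr' : p < rho' by exact: lt_le_trans le_rho.
by apply/le_anti/andP; split; apply: (dens_scale_le xO'); apply/andP.
Qed.

Hypothesis cO : connected Omega.

(** The density depends neither on the radius nor, locally, on the centre;
    connectedness makes it constant. *)
Lemma dens_constant : exists c : R, 0 <= c /\
  forall x0 rho e, ball x0 rho `<=` Omega -> 0 < e < rho -> dens e x0 = c.
Proof.
have oO : open Omega by case: tr.
have [[xs Os]|O0] := pselect (Omega !=set0); last first.
  exists 0; split => // x0 rho e x0O /andP[e0 er]; exfalso; apply: O0.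
  by exists x0; apply: x0O; apply: ballxx; exact: lt_trans er.
have rad x : Omega x -> exists2 rho, 0 < rho & ball x rho `<=` Omega.
  by move=> Ox; have /nbhs_ballP[rho /= r0 h] : nbhs x Omega by [exact: open_nbhs_nbhs]; exists rho.
have [r r0 sO] := rad _ Os.
pose c := dens (r / 2) xs.
(* The set of points around which the density equals c is open and closed in
   Omega. *)
pose P x := forall rho e, ball x rho `<=` Omega -> 0 < e < rho -> dens e x = c.
have Ploc x : Omega x -> exists2 rho, 0 < rho & forall y, ball x rho y -> Omega y /\ (P y <-> P x).
  move=> Ox; have [rho rho0 xO] := rad _ Ox; exists (rho / 2); first by rewrite divr_gt0.
  move=> y /ball_normP xy.
  have yO : ball y (rho / 2) `<=` Omega.
    move=> z /ball_normP yz; apply: xO; apply/ball_normP.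
    rewrite -(subrK y x) -addrA (le_lt_trans (ler_normD _ _))//; lra.
  split; first by apply: yO; apply: ballxx; rewrite divr_gt0.
  have e4 : dens (rho / 4) y = dens (rho / 4) x by apply: (dens_local xO); lra.
  split => Px rho' e h er.
    rewrite (dens_scale (q := rho / 4) h xO er); last lra.
    by rewrite -e4; apply: (Px _ _ yO); lra.
  rewrite (dens_scale (q := rho / 4) h yO er); last lra.
  by rewrite e4; apply: (Px _ _ xO); lra.
have PO : [set x | Omega x /\ P x] = Omega.
  apply: cO.
  - exists xs; split => // rho e h er.
    by apply: (dens_scale h sO er); lra.
  - exists [set x | Omega x /\ P x].
      rewrite openE => x [Ox Px]; have [rho r1 h] := Ploc _ Ox.
      by apply/nbhs_ballP; exists rho => //= y /h[Oy Pyx]; split => //; apply/Pyx.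
    by apply/seteqP; split => x /= [].
  - exists (~` [set x | Omega x /\ ~ P x]); last first.
      apply/seteqP; split => x /=; first by move=> [Ox Px]; split => // -[].
      by move=> [Ox nP]; split => //; apply: contrapT => ?; apply: nP.
    apply: open_closedC; rewrite openE => x [Ox nPx]; have [rho r1 h] := Ploc _ Ox.
    by apply/nbhs_ballP; exists rho => //= y /h[Oy Pyx]; split => // /Pyx.
exists c; split; first by apply: dens_ge0; rewrite divr_gt0.
move=> x0 rho e x0O /[dup] er /andP[e0 e1].
have /(_ rho e x0O er) // : P x0.
by have : Omega x0; [apply: x0O; apply: ballxx; exact: lt_trans e1|rewrite -PO => -[]].
Qed.

End mass_constant.

(** * Vertical distributions and their quantiles *)

Section profile.
Context {R : realType} {n : nat} (Omega : set 'rV[R]_n).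
Notation E := 'rV[R]_n.
Notation ER := ('rV[R]_n * R)%type.
Variables (sg : {finite_measure set ER -> \bar R}) (mz : 'I_n -> ER -> R) (M : R).
Hypothesis tr : transported Omega sg mz M.
Notation L := (@speed R n M).
Variable c : R.
Hypothesis densc : forall x0 rho e, ball x0 rho `<=` Omega -> 0 < e < rho ->
  dens sg e x0 = c.
Hypothesis c0 : 0 <= c.

Let oO : open Omega. Proof. by case: tr. Qed.
Let M0 : 0 < M. Proof. by case: tr. Qed.
Let L0 : 0 <= L. Proof. exact: speed_ge0 tr. Qed.

Let mO : measurable Omega. Proof. exact: open_measurable_rV. Qed.

Lemma open_radius x : Omega x -> exists2 rho, 0 < rho & ball x rho `<=` Omega.
Proof.
by move=> Ox; have /nbhs_ballP[rho /= r0 h] : nbhs x Omega by [exact: open_nbhs_nbhs]; exists rho.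
Qed.

Definition lower_avg (b : R) (x : E) : \bar R := limn_einf (fun k => avg sg (eps k) b x).

(** Up to the factor c, a version of the conditional distribution function of y
    given x. The lower limit makes it defined at every point, so that the finite
    propagation speed holds pointwise and not only almost everywhere. *)
Definition profile (b : R) (x : E) : R := fine (lower_avg b x) * \1_Omega x.

Lemma avg_mono e a b x : 0 < e -> a <= b -> (avg sg e a x <= avg sg e b x)%E.
Proof.
move=> e0 ab; rewrite lee_pmul2l ?lte_fin ?invr_gt0 ?vol_gt0//.
by apply: sg_mono => //; exact: ball_measurable.
Qed.

Lemma avg_le_c e rho b x : ball x rho `<=` Omega -> 0 < e < rho -> (avg sg e b x <= c%:E)%E.
Proof.
move=> xO /[dup] er /andP[e0 e1].
have Mb : M < Num.max b (M + 1) by rewrite lt_max; apply/orP; right; lra.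
rewrite -(densc xO er) -(avg_dens tr e x Mb).
by apply: avg_mono => //; rewrite le_max lexx.
Qed.

Lemma lower_avg_ge0 b x : (0 <= lower_avg b x)%E.
Proof. by apply: (@le_limn_einf _ _ _ 0) => k _; apply: avg_ge0; exact: eps_gt0. Qed.

Lemma lower_avg_le b x : Omega x -> (lower_avg b x <= c%:E)%E.
Proof.
move=> Ox; have [rho r0 xO] := open_radius Ox; have [N hN] := eps_small r0.
by apply: (@limn_einf_le _ _ _ N) => k /hN kr; apply: (avg_le_c _ xO); rewrite eps_gt0.
Qed.

Lemma profileE b x : Omega x -> (profile b x)%:E = lower_avg b x.
Proof.
move=> Ox; rewrite /profile indicE mem_set// mulr1 fineK//.
rewrite ge0_fin_numE; last exact: lower_avg_ge0.
by apply: (le_lt_trans (lower_avg_le b Ox)); rewrite ltry.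
Qed.

Lemma profile_out b x : ~ Omega x -> profile b x = 0.
Proof. by move=> nO; rewrite /profile indicE memNset// mulr0. Qed.

Lemma profile_ge0 b x : 0 <= profile b x.
Proof.
have [Ox|nO] := pselect (Omega x); last by rewrite profile_out.
by rewrite -lee_fin profileE// lower_avg_ge0.
Qed.

Lemma profile_le b x : profile b x <= c.
Proof.
have [Ox|nO] := pselect (Omega x); last by rewrite profile_out.
by rewrite -lee_fin profileE// lower_avg_le.
Qed.

Lemma profile_mono a b x : a <= b -> profile a x <= profile b x.
Proof.
move=> ab; have [Ox|nO] := pselect (Omega x); last by rewrite !profile_out.
rewrite -lee_fin !profileE//; apply: (@limn_einf_mono _ _ _ 0) => k _.
by apply: avg_mono => //; exact: eps_gt0.
Qed.

Lemma profile_gt a x : Omega x -> M < a -> profile a x = c.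
Proof.
move=> Ox Ma; apply/le_anti; rewrite profile_le/= -lee_fin profileE//.
have [rho r0 xO] := open_radius Ox; have [N hN] := eps_small r0.
apply: (@le_limn_einf _ _ _ N) => k /hN kr.
by rewrite (avg_dens tr)// (densc xO)// eps_gt0.
Qed.

Lemma profile_le0 a x : a <= - M -> profile a x = 0.
Proof.
move=> Ma; have [Ox|nO] := pselect (Omega x); last by rewrite profile_out.
apply/le_anti; rewrite profile_ge0 andbT -lee_fin profileE//.
apply: (@limn_einf_le _ _ _ 0) => k _.
by rewrite /avg (sg_below_le tr _ Ma) ?mule0//; exact: ball_measurable.
Qed.

Lemma measurable_profile b : measurable_fun setT (profile b).
Proof.
apply: measurable_funM; last exact: measurable_indic.
apply: measurableT_comp; first exact: fine_measurable.
by apply: measurable_fun_limn_einf => // k; apply: measurable_avg; exact: eps_gt0.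
Qed.

Lemma profile_shift x0 rho x x' a b : ball x0 rho `<=` Omega ->
  `|x0 - x| < rho -> `|x0 - x'| < rho -> a + L * `|x - x'| <= b ->
  profile a x <= profile b x'.
Proof.
move=> x0O xr x'r ab.
have Ox : Omega x by apply: x0O; apply/ball_normP.
have Ox' : Omega x' by apply: x0O; apply/ball_normP.
rewrite -lee_fin !profileE//.
have [|N hN] := @eps_small R (Num.min (rho - `|x0 - x|) (rho - `|x0 - x'|)).
  by rewrite lt_min !subr_gt0 xr.
apply: (@limn_einf_mono _ _ _ N) => k /hN; rewrite lt_min => /andP[k1 k2].
by apply: (avg_propagation tr x0O) => //; [exact: eps_gt0|lra|lra].
Qed.

(** Comparison of the scale d with all smaller scales, at the cost of raising
    the level by L d. *)
Lemma avg_profile x rho d a : ball x rho `<=` Omega -> 0 < d < rho ->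
  (avg sg d a x <= (profile (a + L * d) x)%:E)%E.
Proof.
move=> xO /andP[d0 dr]; have Ox : Omega x by apply: xO; apply: ballxx; lra.
rewrite profileE// /avg -lee_pdivlMl ?invr_gt0 ?vol_gt0// invrK.
pose F j := ball x (d - eps j) `*` below a.
have mb e : measurable (ball x e) by exact: ball_measurable.
have -> : ball x d `*` below a = \bigcup_j F j.
  apply/seteqP; split => [[y t] [/= /ball_normP xy ya]|[y t] [j _ [/= xy ya]]].
    have [|N hN] := @eps_small R (d - `|x - y|); first by rewrite subr_gt0.
    exists N => //; split => //=; apply/ball_normP; have := hN _ (leqnn N); lra.
  by split => //=; apply: le_ball xy; have := @eps_gt0 R j; lra.
apply: measure_bigcup_le => [j|k j kj|j]; first exact: measurableXb.
  move=> [y t] [/= xy ya]; split => //=; apply: le_ball xy.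
  by have := @eps_le R _ _ kj; lra.
rewrite -lee_pdivrMl ?vol_gt0//.
have [|N hN] := @eps_small R (Num.min d (rho - d)); first by rewrite lt_min subr_gt0 d0.
apply: (@le_limn_einf _ _ _ (maxn j N)) => k; rewrite geq_max => /andP[jk].
move=> /hN; rewrite lt_min => /andP[k1 k2]; rewrite lee_pdivrMl ?vol_gt0//.
apply: (le_trans _ (avg_scale_lower tr a xO _ k1 _)); [|exact: eps_gt0|lra].
apply: sg_mono => //; apply: le_ball; have := @eps_le R _ _ jk; lra.
Qed.

(** The level M is always admitted, and levels below - M never, so that the
    infimum lies in [- M, M] for every r, also outside [0, c] and outside Omega.
    Reaching c - r rather than r makes the quantiles decrease with r. *)
Definition quantile_set (r : R) (x : E) : set R :=
  [set b | - M <= b <= M /\ (b = M \/ c - r <= profile b x)].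

Definition quantile (r : R) (x : E) : R := inf (quantile_set r x).

Let qM r x : quantile_set r x M.
Proof. by have M0' := M0; split; [apply/andP; split; lra|left]. Qed.

Let qinf r x : has_inf (quantile_set r x).
Proof. by split; [exists M; exact: qM|exists (- M) => b [/andP[]]]. Qed.

Lemma quantile_le r x b : quantile_set r x b -> quantile r x <= b.
Proof. by move=> qb; apply: ge_inf => //; case: (qinf r x). Qed.

Lemma quantile_bounded r x : `|quantile r x| <= M.
Proof.
rewrite ler_norml; apply/andP; split; last by apply: quantile_le; exact: qM.
by apply: lb_le_inf; [exists M; exact: qM|move=> b [/andP[]]].
Qed.

Lemma quantile_decreasing r r' x : r' <= r -> quantile r x <= quantile r' x.
Proof.
move=> rr; apply: lb_le_inf; first by exists M; exact: qM.
move=> b [bM qb]; apply: quantile_le; split => //.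
by case: qb => [->|h]; [left|right; apply: le_trans h; lra].
Qed.

(** If the profile at x' reaches c - r at the level b, the profile at x reaches
    it at b + L |x - x'|, by finite speed. *)
Lemma quantile_lipschitz r x0 rho x x' : ball x0 rho `<=` Omega ->
  ball x0 rho x -> ball x0 rho x' -> `|quantile r x - quantile r x'| <= L * `|x - x'|.
Proof.
move=> x0O.
suff le1 y y' : ball x0 rho y -> ball x0 rho y' -> quantile r y - L * `|y - y'| <= quantile r y'.
  move=> hx hx'; rewrite ler_norml; have := le1 _ _ hx hx'; have := le1 _ _ hx' hx.
  by rewrite (distrC x'); move=> ? ?; apply/andP; split; lra.
move=> /ball_normP y1 /ball_normP y2; apply: lb_le_inf; first by exists M; exact: qM.
move=> b [/andP[b1 b2] qb].
have Ly : 0 <= L * `|y - y'| by rewrite mulr_ge0.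
have qM' := quantile_le (qM r y).
rewrite lerBlDr.
case: qb => [bM|qb]; first by move: qM'; rewrite bM; lra.
have [le|gt] := leP (b + L * `|y - y'|) M; last by lra.
apply: quantile_le; split; first by apply/andP; split; lra.
right; apply: (le_trans qb); apply: (profile_shift x0O) => //.
by rewrite distrC.
Qed.

(** A description by countably many levels, from which joint measurability in
    (x, r) follows. *)
Lemma quantile_lt r x a : quantile r x < a <->
  M < a \/ exists q : rat, [/\ - M <= ratr q, ratr q < a & c - r <= profile (ratr q) x].
Proof.
split.
  move=> qa; have [Ma|aM] := ltP M a; first by left.
  right; have [b [/andP[b1 b2] qb] ba] := inf_lt (proj1 (qinf r x)) qa.
  case: qb => [bM|qb]; first by move: ba; rewrite bM; lra.
  have [q /andP[bq qa']] : exists q : rat, b < ratr q < a.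
    by have /rat_in_itvoo[q] := ba; rewrite in_itv/= => h; exists q.
  exists q; split => //; first by lra.
  by apply: (le_trans qb); apply: profile_mono; lra.
case=> [Ma|[q [q1 q2 q3]]]; first by apply: le_lt_trans Ma; apply: quantile_le; exact: qM.
have [qM'|qM'] := leP (ratr q) M; last first.
  by apply: lt_trans q2; apply: le_lt_trans qM'; apply: quantile_le; exact: qM.
apply: le_lt_trans q2; apply: quantile_le; split; first by apply/andP.
by right.
Qed.

Lemma measurable_quantile : measurable_fun setT (fun p : E * R => quantile p.2 p.1).
Proof.
apply: (measurability _ (RGenInftyO.measurableE R)) => _ [_ [a ->] <-]; rewrite setTI.
have -> : (fun p : E * R => quantile p.2 p.1) @^-1` `]-oo, a[%classic =
    (if M < a then setT else set0) `|`
    \bigcup_(q : rat) (if (- M <= ratr q) && (ratr q < a)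
       then [set p : E * R | c - p.2 <= profile (ratr q) p.1] else set0).
  apply/seteqP; split => [[x r]|[x r]]; rewrite /= in_itv/=.
    move=> /quantile_lt[->|[q [q1 q2 q3]]]; first by left.
    by right; exists q => //; rewrite q1 q2.
  move=> h; apply/quantile_lt; case: h => [|[q _]]; first by case: ifP => //; left.
  by case: ifP => // /andP[q1 q2] /= q3; right; exists q.
apply: measurableU; first by case: ifP.
apply: bigcupT_measurable_rat => q; case: ifP => // _.
have mf : measurable_fun setT (fun p : E * R => c - p.2 <= profile (ratr q) p.1).
  apply: measurable_fun_ler.
    by apply: measurable_funB => //; exact: measurable_cst.
  by apply: (measurableT_comp (measurable_profile _)).
by have := mf measurableT [set true] I; rewrite setTI; congr (measurable _);
  apply/seteqP; split => p /=.
Qed.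

End profile.

Section restriction.
Context d (T : measurableType d) {R : realType} (m : {measure set T -> \bar R}).
Variables (D : set T) (mD : measurable D) (fD : (m D < +oo)%E).

(** The finiteness of m D is an argument, so that the finite measure structure
    can be inferred. *)
Definition restr_to (_ : (m D < +oo)%E) : set T -> \bar R := mrestr m mD.
Local Notation restr := (restr_to fD).

HB.instance Definition _ := Measure.on restr.

Let restr_fin : fin_num_fun restr.
Proof.
move=> A mA; rewrite ge0_fin_numE//; apply: (le_lt_trans _ fD).
by rewrite /restr_to /mrestr le_measure ?inE//; exact: measurableI.
Qed.
HB.instance Definition _ := Measure_isFinite.Build _ _ _ restr restr_fin.

End restriction.

Section quantile_law.
Context {R : realType} {n : nat} (Omega : set 'rV[R]_n).
Notation E := 'rV[R]_n.
Notation ER := ('rV[R]_n * R)%type.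
Variables (sg : {finite_measure set ER -> \bar R}) (mz : 'I_n -> ER -> R) (M : R).
Hypothesis tr : transported Omega sg mz M.
Notation L := (@speed R n M).
Variable c : R.
Hypothesis densc : forall x0 rho e, ball x0 rho `<=` Omega -> 0 < e < rho ->
  dens sg e x0 = c.
Hypothesis c0 : 0 <= c.
Variables (mO : measurable Omega) (fO : (leb n Omega < +oo)%E).
Lemma measurable_levels : measurable (`[0, c]%classic : set R). Proof. exact: measurable_itv. Qed.
Lemma finite_levels : (lebesgue_measure (`[0%R, c]%classic : set R) < +oo)%E.
Proof. rewrite lebesgue_measure_itv; case: ifP => _; last exact: ltry.
by rewrite -EFinB ltry. Qed.

Definition base : {finite_measure set E -> \bar R} := restr_to mO fO.
Let measurable_idR : measurable_fun setT (fun r : measurableTypeR R => r : R).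
Proof. by move=> _ A mA; rewrite setTI. Qed.

(** Lebesgue measure lives on measurableTypeR R; the image under the identity
    moves its restriction to R with its canonical sigma-algebra. *)
Definition levels : {finite_measure set R -> \bar R} :=
  push (@restr_to _ (measurableTypeR R) R lebesgue_measure _ measurable_levels finite_levels)
    (mfun_of measurable_idR).

Lemma levelsE A : levels A = lebesgue_measure (A `&` `[0, c]%classic).
Proof. by []. Qed.

Notation u := (@quantile R n Omega sg M c).

Let mu x : measurable_fun setT (fun r => u r x).
Proof. exact: (measurableT_comp (measurable_quantile tr densc) (@measurable_pair1 _ _ E R x)). Qed.

Let mlt x a : measurable [set r | u r x < a].
Proof.
have := @mu x measurableT _ (measurable_below a); rewrite setTI.
by congr (measurable _).
Qed.

Let lebprof x a : (profile Omega sg a x)%:E =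
  lebesgue_measure (`[c - profile Omega sg a x, c]%classic : set R).
Proof.
have p0 := profile_ge0 tr densc a x.
rewrite lebesgue_measure_itv/= lte_fin; case: ltP => h; last by congr EFin; lra.
by rewrite -EFinB; congr EFin; lra.
Qed.

Lemma levels_quantile_le x a : Omega x ->
  (levels [set r | (u r x < a)%R] <= (profile Omega sg a x)%:E)%E.
Proof.
move=> Ox; have p0 := profile_ge0 tr densc a x.
rewrite lebprof levelsE; apply: le_measure; rewrite ?inE.
- by apply: measurableI; [exact: mlt|exact: measurable_itv].
- exact: measurable_itv.
move=> r [/= /(quantile_lt tr densc) h]; rewrite !in_itv/= => /andP[r0 rc].
rewrite rc andbT.
case: h => [Ma|[q [q1 q2 q3]]]; first by rewrite (profile_gt tr densc c0)//; lra.
by have := profile_mono tr densc x (ltW q2); lra.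
Qed.

(** The gap b < a is there because the profile, a lower limit, need not be
    left-continuous in its level. *)
Lemma levels_quantile_ge x a b : Omega x -> b < a ->
  ((profile Omega sg b x)%:E <= levels [set r | (u r x < a)%R])%E.
Proof.
move=> Ox ba; have pc := profile_le tr densc c0 b x.
have [bM|Mb] := leP b (- M).
  by rewrite (profile_le0 tr densc x bM); exact: measure_ge0.
rewrite lebprof levelsE; apply: le_measure; rewrite ?inE.
- exact: measurable_itv.
- by apply: measurableI; [exact: mlt|exact: measurable_itv].
move=> r /=; rewrite !in_itv/= => /andP[r1 r2]; split; last by apply/andP; split; lra.
have qM : quantile_set Omega sg M c r x M.
  by have [_ M0 _ _ _] := tr; split; [apply/andP; split; lra|left].
have [bM|bM] := leP b M; last by apply: (le_lt_trans (quantile_le tr qM)); lra.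
apply: le_lt_trans ba; apply: (quantile_le tr).
by split; [apply/andP; split; lra|right; lra].
Qed.

Definition quantile_graph (p : E * R) : ER := (p.1, u p.2 p.1).

Lemma measurable_quantile_graph : measurable_fun setT quantile_graph.
Proof. by apply: measurable_fun_pair => //; exact: (measurable_quantile tr densc). Qed.

Notation law := (push (finite_prod base levels) (mfun_of measurable_quantile_graph)).

Let mlev a : measurable_fun setT (fun x => levels [set r | (u r x < a)%R]).
Proof.
have mA : measurable [set p : E * R | u p.2 p.1 < a].
  have := measurable_quantile tr densc measurableT (measurable_below a); rewrite setTI.
  by congr (measurable _).
have := @measurable_fun_xsection _ _ E R R levels _ mA.
by apply: eq_measurable_fun => x _; congr (levels _); apply/seteqP; split => r;
  rewrite /xsection /= inE.
Qed.

Let law_below (B : set E) a : measurable B ->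
  law (B `*` below a) = (\int[leb n]_(x in B `&` Omega) levels [set r | (u r x < a)%R])%E.
Proof.
move=> mB; rewrite /push /pushforward /finite_prod /product_measure1.
have -> : (\int[base]_x (levels \o xsection (mfun_of measurable_quantile_graph @^-1` (B `*` below a))) x =
  \int[base]_(x in B) levels [set r | (u r x < a)%R])%E.
  rewrite [RHS]integral_mkcond; apply: eq_integral => x _ /=; rewrite patchE.
  case: ifPn => xB.
    congr (levels _); apply/seteqP; split => r; rewrite /xsection /= inE /=; first by case.
    by rewrite inE in xB.
  rewrite (_ : xsection _ _ = set0) ?measure0//; apply/seteqP; split => // r.
  by rewrite /xsection /= inE /= => -[Bx _]; move/negP: xB; rewrite inE.
rewrite integral_mkcond ge0_integral_mrestr.
- by rewrite integral_mkcondl.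
- apply/(measurable_restrictT _ mB).
  by apply: measurable_funS (mlev a).
- by move=> x; apply: erestrict_ge0.
Qed.

Let open_inner e U : 0 <= e -> measurable (inner e U : set E).
Proof. by move=> e0; apply: open_measurable_rV; exact: inner_open. Qed.

(** Shrinking U by 2 eps and lowering the level by (L + 1) eps leaves room to
    bound sg by averages at scale eps, and these by the profile. *)
Lemma sg_le_quantile (U : set E) a : open U -> U `<=` Omega ->
  (sg (U `*` below a) <= \int[leb n]_(x in U) levels [set r | (u r x < a)%R])%E.
Proof.
move=> oU UO; have L0 : 0 <= L := speed_ge0 tr.
have mU := open_measurable_rV oU.
pose F k := inner (2 * eps k) U `*` below (a - (L + 1) * eps k).
(* The shrunk sets increase to U x (-oo, a). *)
have -> : U `*` below a = \bigcup_k F k.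
  apply/seteqP; split => [[x y] [/= Ux ya]|[x y] [k _ [/= Ux ya]]].
    have : (\bigcup_k inner (2 * eps k) U) x by rewrite bigcup_inner.
    move=> [k _ xk].
    have [|N hN] := @eps_small R ((a - y) / (L + 1)); first by rewrite divr_gt0// ?subr_gt0//; lra.
    exists (maxn k N) => //; split => /=.
      apply: inner_mono xk; have := @eps_le R _ _ (leq_maxl k N); lra.
    have := hN _ (leq_maxr k N); rewrite ltr_pdivlMr; last by lra.
    by rewrite /below/=; lra.
  split => /=; first by apply: inner_sub Ux; have := @eps_gt0 R k; lra.
  apply: lt_le_trans ya _; rewrite gerBl mulr_ge0//; first lra.
  exact/ltW/eps_gt0.
have e0 k : 0 < @eps R k := eps_gt0 k.
apply: measure_bigcup_le => [k|k j kj|k].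
- by apply: measurableXb; apply: open_inner; have := e0 k; lra.
- have kj' := @eps_le R _ _ kj.
  move=> [x y] [/= h1 h2]; split => /=; first by apply: inner_mono h1; lra.
  by apply: lt_le_trans h2 _; rewrite lerD2l lerN2 ler_wpM2l//; lra.
- have ek0 := e0 k.
  apply: (le_trans (@avg_lower _ _ sg (inner (eps k) U) (inner (2 * eps k) U) _ _ (e0 k) _ _ _)).
  - by apply: open_inner; lra.
  - by apply: open_inner; lra.
  - move=> x xk y; apply: inner_inner; have -> : eps k + eps k = 2 * eps k :> R by lra.
    exact: xk.
  apply: (@le_trans _ _ (\int[leb n]_(x in inner (eps k) U) levels [set r | (u r x < a)%R])%E).
    apply: ge0_le_integral => //.
    - by apply: open_inner; lra.
    - by move=> x _; apply: avg_ge0.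
    - by apply: measurable_funS (measurable_avg _ _ _).
    - by apply: measurable_funS (mlev a).
    move=> x [rho ekr xU].
    have Ox : Omega x by apply/UO/xU/ballxx; lra.
    apply: (le_trans (avg_profile tr densc (rho := rho) _ _ _)).
    - exact: subset_trans UO.
    - by rewrite e0.
    by apply: levels_quantile_ge => //; lra.
  apply: ge0_subset_integral => //.
  - by apply: open_inner; lra.
  - by apply: measurable_funS (mlev a).
  - by apply: inner_sub; lra.
Qed.

(** Fatou's lemma, applied to the averages whose lower limit is the profile. *)
Lemma sg_ge_quantile (U : set E) a : open U -> U `<=` Omega ->
  (\int[leb n]_(x in U) levels [set r | (u r x < a)%R] <= sg (U `*` below a))%E.
Proof.
move=> oU UO; have mU := open_measurable_rV oU.
have e0 k : 0 < @eps R k := eps_gt0 k.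
have -> : (\int[leb n]_(x in U) levels [set r | (u r x < a)%R] =
  \int[leb n]_(x in \bigcup_j inner (2 * eps j) U) levels [set r | (u r x < a)%R])%E.
  by rewrite bigcup_inner.
apply: integral_bigcup_le => [k|k j kj|||j].
- by apply: open_inner; have := e0 k; lra.
- by apply: inner_mono; have := @eps_le R _ _ kj; lra.
- exact: mlev.
- by move=> x; exact: measure_ge0.
have mj : measurable (inner (2 * eps j) U : set E) by apply: open_inner; have := e0 j; lra.
have jU : inner (2 * eps j) U `<=` U by apply: inner_sub; have := e0 j; lra.
apply: (@le_trans _ _ (\int[leb n]_(x in inner (2 * eps j) U) lower_avg sg a x)%E).
  apply: ge0_le_integral => //.
  - by apply: measurable_funS (mlev a).
  - apply: measurable_fun_limn_einf => // k; apply: measurable_funS (measurable_avg _ _ _) => //.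
  move=> x /jU/UO Ox; rewrite -(profileE tr densc)//.
  exact: levels_quantile_le.
apply: (le_trans (fatou _ mj _ _)) => [k|k x _|].
- by apply: measurable_funS (measurable_avg _ _ _).
- exact: avg_ge0.
apply: (@limn_einf_le _ _ _ j) => k jk; apply: avg_upper => //.
move=> x z xj; have : inner (eps k) U x by apply: inner_mono xj; have := @eps_le R _ _ jk; have := e0 j; lra.
exact: inner_ball.
Qed.

(** Quadrants times half-lines are determining; on them the two preceding
    inequalities apply to the open set where the quadrant meets Omega. *)
Lemma quantile_law A : measurable A -> sg A = law A.
Proof.
move=> mA; have [_ h] := determiningX (@determining_rV R n) (@determining_R R).
apply: (h sg law _ _ mA) => _ [B [_ [[a ->] [b ->] ->]]].
pose B0 : set E := [set x | forall i, x ord0 i < a i].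
change (sg (B0 `*` below b) = law (B0 `*` below b)).
have oB : open B0.
  rewrite openE => x Bx; apply: (filter_forall (F := nbhs x)) => i.
  have : open ((fun y : E => y ord0 i) @^-1` [set t | t < a i]).
    by apply: open_comp; [move=> y _; exact: coord_continuous|exact: open_lt].
  by move=> oi; apply: (open_nbhs_nbhs (conj oi (Bx i))).
have mB : measurable B0 := open_measurable_rV oB.
have oO : open Omega by case: tr.
have oU : open (B0 `&` Omega) by exact: openI.
have UO : B0 `&` Omega `<=` Omega by exact: subIsetr.
have mU := open_measurable_rV oU.
rewrite law_below//.
transitivity (sg ((B0 `&` Omega) `*` below b)).
  have [_ _ sg0 _ _] := tr.
  have mS := measurable_slab M mO.
  apply/le_anti/andP; split.
    rewrite -[leRHS]adde0 -sg0; apply: (le_trans _ (measureU2 _ _ _)).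
    - apply: le_measure; rewrite ?inE; first exact: measurableXb.
        by apply: measurableU; [exact: measurableXb|exact: measurableC].
      move=> [x y] [/= Bx yb]; have [Ox|nO] := pselect (Omega x); first by left.
      by right => -[].
    - exact: measurableXb.
    - exact: measurableC.
  by apply: le_measure; rewrite ?inE; [exact: measurableXb|exact: measurableXb|move=> p [[]]].
by apply/le_anti; rewrite sg_le_quantile// sg_ge_quantile.
Qed.

End quantile_law.

(** * Determination by rational boxes *)

Section rational_boxes.
Context {R : realType} {n : nat}.
Notation E := 'rV[R]_n.

Definition ratv (q : 'rV[rat]_n) : E := map_mx ratr q.

Lemma rational_box_cover (Omega : set E) : open Omega ->
  exists (l h : nat -> 'rV[rat]_n) (D : set nat),
    (forall k, D k -> cbox (ratv (l k)) (ratv (h k)) `<=` Omega) /\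
    Omega = \bigcup_(k in D) obox (ratv (l k)) (ratv (h k)).
Proof.
move=> oO; pose q (k : nat) : 'rV[rat]_n * 'rV[rat]_n := odflt (0, 0) (unpickle k).
exists (fun k => (q k).1), (fun k => (q k).2).
exists [set k | cbox (ratv (q k).1) (ratv (q k).2) `<=` Omega]; split => //.
apply/seteqP; split => [x Ox|x [k /= kO xk]]; last first.
  by apply: kO => i; have /andP[? ?] := xk i; apply/andP; split; exact: ltW.
have /nbhs_ballP[e /= e0 eO] : nbhs x Omega by exact: open_nbhs_nbhs.
(* The corners are chosen within e / 4 of x - e / 2 and x + e / 2. *)
have e4 : 0 < e / 4 by rewrite divr_gt0.
have [q1] := rV_rat_dense (x - const_mx (e / 2)) e4; rewrite rV_ballE// => q1P.
have [q2] := rV_rat_dense (x + const_mx (e / 2)) e4; rewrite rV_ballE// => q2P.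
have lo i : x ord0 i - e < ratv q1 ord0 i < x ord0 i.
  have := q1P i; rewrite /ball/= !mxE ltr_norml => /andP[? ?].
  by apply/andP; split; lra.
have hi i : x ord0 i < ratv q2 ord0 i < x ord0 i + e.
  have := q2P i; rewrite /ball/= !mxE ltr_norml => /andP[? ?].
  by apply/andP; split; lra.
have qE : q (pickle (q1, q2)) = (q1, q2) by rewrite /q pickleK.
exists (pickle (q1, q2)); rewrite /= qE/=; last first.
  by move=> i; have /andP[? ?] := lo i; have /andP[? ?] := hi i; apply/andP.
move=> y yb; apply: eO; rewrite rV_ballE// => i.
have /andP[? ?] := lo i; have /andP[? ?] := hi i; have /andP[? ?] := yb i.
by rewrite /ball/= ltr_norml; apply/andP; split; lra.
Qed.

Definition quadrant (a : E) : set E := [set x | forall i, x ord0 i < a ord0 i].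

Lemma measurable_quadrant a : measurable (quadrant a).
Proof.
apply: (@measurable_rV_box R n (fun i => [set t | t < a ord0 i])) => i.
exact: measurable_below.
Qed.

(** Every quadrant is a limit of smaller rational quadrants. *)
Lemma determining_quadrant :
  @determining R _ _ [set A : set E | exists a : 'rV[rat]_n, A = quadrant (ratv a)].
Proof.
split => [_ [a ->]|m1 m2 h]; first exact: measurable_quadrant.
have [_ det] := @determining_rV R n; apply: det => _ [a ->].
have mf (m : {finite_measure set E -> \bar R}) A : measurable A -> (fine (m A))%:E = m A.
  by move=> mA; rewrite fineK//; exact: fin_num_measure.
pose b : E := \row_i a i.
have -> : (fun x : E => [set y : E | forall i, y ord0 i < a i] x) = quadrant b.
  by apply/seteqP; split => x /= xa i; have := xa i; rewrite mxE.
rewrite -[LHS]mf; last exact: measurable_quadrant.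
rewrite -[RHS]mf; last exact: measurable_quadrant.
congr EFin.
have [q qP] : exists q : nat -> 'rV[rat]_n, forall k i, b ord0 i - eps k < ratv (q k) ord0 i < b ord0 i.
  have ex k : exists q : 'rV[rat]_n, forall i, b ord0 i - eps k < ratv q ord0 i < b ord0 i.
    have e2 : 0 < @eps R k / 2 by rewrite divr_gt0// eps_gt0.
    have [q] := rV_rat_dense (b - const_mx (eps k / 2)) e2; rewrite rV_ballE// => qP.
    exists q => i; have := qP i; rewrite /ball/= !mxE ltr_norml => /andP[? ?].
    by apply/andP; split; lra.
  by have [q qP] := choice ex; exists q.
have mlim (m : {finite_measure set E -> \bar R}) :
    fine (m (quadrant (ratv (q k)))) @[k --> \oo] --> fine (m (quadrant b)).
  rewrite -bint_indic; last exact: measurable_quadrant.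
  have -> : (fun k => fine (m (quadrant (ratv (q k))))) =
      (fun k => \int[m]_x (\1_(quadrant (ratv (q k))) x)).
    by apply/funext => k; rewrite bint_indic//; exact: measurable_quadrant.
  apply: (@bint_cvg _ _ _ _ _ _ 1).
  - by move=> k; apply: measurable_indic; exact: measurable_quadrant.
  - by move=> k x; rewrite indicE; case: (_ \in _); rewrite ?normr1 ?normr0.
  move=> x; have [xb|nxb] := pselect (quadrant b x).
    rewrite [X in _ --> X]indicE mem_set//; apply: cvg_near_cst.
    have near_i : forall i, \forall k \near \oo, x ord0 i < ratv (q k) ord0 i.
      move=> i; have [|N hN] := @eps_small R (b ord0 i - x ord0 i); first by rewrite subr_gt0.
      by exists N => // k /= /hN; have /andP[? ?] := qP k i; lra.
    apply: filterS (filter_forall _ near_i) => k xk.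
    by rewrite indicE mem_set.
  rewrite [X in _ --> X]indicE memNset//; apply: cvg_near_cst; apply: nearW => k.
  rewrite indicE memNset// => xq; apply: nxb => i; apply: lt_trans (xq i) _.
  by have /andP[] := qP k i.
have l1 := mlim m1; have l2 := mlim m2.
rewrite -(cvg_lim _ l1)// -(cvg_lim _ l2)//; congr (lim (_ @ \oo)); apply/funext => k.
by rewrite h//; exists (q k).
Qed.

(** Cutting a box by a quadrant gives a box, so equality on boxes is enough to
    use determining classes of quadrants inside a box. *)
Lemma quadrant_obox (l h : E) (a : E) :
  quadrant a `&` obox l h = obox l (\row_i Num.min (h ord0 i) (a ord0 i)).
Proof.
apply/seteqP; split => x /=.
  by move=> [xa xb] i; rewrite mxE lt_min (xa i) andbT; exact: xb.
move=> xb; split => i; have := xb i; rewrite mxE lt_min => /andP[? /andP[? ?]] //.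
by apply/andP.
Qed.

Lemma cbox_min (l h a : E) :
  cbox l (\row_i Num.min (h ord0 i) (a ord0 i)) `<=` cbox l h.
Proof.
by move=> x xb i; have := xb i; rewrite mxE le_min => /andP[-> /andP[-> _]].
Qed.

Lemma ratv_min (h a : 'rV[rat]_n) :
  \row_i Num.min (ratv h ord0 i) (ratv a ord0 i) = ratv (\row_i Num.min (h ord0 i) (a ord0 i)).
Proof.
apply/rowP => i; rewrite !mxE.
by rewrite !minEle ler_rat; case: ifP.
Qed.

(** Omega is a countable union of rational boxes, and inside each of them the
    boxes times sets of G are determining. *)
Lemma ae_eq_boxes d (T : measurableType d) (m : {finite_measure set (E * T)%type -> \bar R})
    (Omega : set E) (G : set_system T) (f g : (E * T)%type -> R) :
  open Omega -> @determining R _ _ G -> m (~` Omega `*` setT) = 0%E -> bmf f -> bmf g ->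
  (forall l h A, cbox l h `<=` Omega -> G A ->
    \int[m]_p (f p * \1_(obox l h `*` A) p) = \int[m]_p (g p * \1_(obox l h `*` A) p)) ->
  {ae m, forall p, f p = g p}.
Proof.
move=> oO dG m0 bf bg fg.
have [mG _] := dG.
have [l [h [D [DO OD]]]] := rational_box_cover oO.
pose box k := obox (ratv (l k)) (ratv (h k)) `*` [set: T].
have mbox k : measurable (box k) by apply: measurableX => //; exact: measurable_obox.
have step k : {ae m, forall p, D k -> box k p -> f p = g p}.
  have [Dk|nD] := pselect (D k); last by apply: aeW.
  have dX := determiningX determining_quadrant dG.
  have := ae_eq_determining (m := m) (f := f) (g := g) dX (mbox k).
  move=> /(_ (bmf_integrable m (mbox k) bf) (bmf_integrable m (mbox k) bg)).
  move=> aek; suff: {ae m, forall p, box k p -> f p = g p} by apply: filterS => p fp _.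
  apply: aek => _ [_ [A [[a ->] GA ->]]].
  have -> : quadrant (ratv a) `*` A `&` box k =
      obox (ratv (l k)) (\row_i Num.min (ratv (h k) ord0 i) (ratv a ord0 i)) `*` A.
    rewrite -quadrant_obox; apply/seteqP; split => -[x y] /=.
      by move=> [[? ?] [? _]].
    by move=> [[? ?] ?].
  have mA : measurable A := mG _ GA.
  have mB := measurableX (measurable_obox (ratv (l k))
    (\row_i Num.min (ratv (h k) ord0 i) (ratv a ord0 i))) mA.
  have := fg _ _ A (subset_trans (@cbox_min _ _ (ratv a)) (DO _ Dk)) GA.
  rewrite !bint_indicM// => e.
  by rewrite -!bint_EFin// e.
have out : {ae m, forall p, Omega p.1}.
  exists (~` Omega `*` setT); split => //.
    by apply: measurableX => //; apply: measurableC; exact: open_measurable_rV.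
have all := ae_foralln step.
apply: filterS2 out all => p Op hp.
have : (\bigcup_(k in D) obox (ratv (l k)) (ratv (h k))) p.1 by rewrite -OD.
by move=> [k Dk pk]; apply: (hp k).
Qed.

End rational_boxes.

(** * Difference quotients and weak derivatives *)

Section translation.
Context {R : realType} {n : nat} (Omega : set 'rV[R]_n).
Notation E := 'rV[R]_n.
Variables (mO : measurable Omega) (fO : (leb n Omega < +oo)%E).
Notation lam := (base mO fO).

Lemma bint_base_leb (f : E -> R) : bmf f -> (forall x, ~ Omega x -> f x = 0) ->
  (leb n).-integrable setT (EFin \o f) /\ \int[lam]_x f x = \int[leb n]_x f x.
Proof.
move=> bf f0.
have fE : (EFin \o f) \_ Omega = EFin \o f.
  apply/funext => x; rewrite patchE; case: ifPn => // xO /=.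
  by rewrite f0// => Ox; move/negP: xO; rewrite inE.
have mf : measurable_fun setT (EFin \o f) by apply/measurable_EFinP; exact: bmf_meas.
have inO : (leb n).-integrable Omega (EFin \o f).
  apply: (proj1 (@integrable_mrestr _ _ _ (leb n) _ mO _ mf)).
  exact: (@bmf_integrable _ _ _ lam _ _ measurableT bf).
split; first by rewrite -fE; apply/(integrable_mkcond _ mO).
rewrite /Rintegral (@integral_mrestr _ _ _ (leb n) _ mO _ mf); congr fine.
by rewrite integral_mkcond fE.
Qed.

(** Extending by zero turns integrals over Omega into integrals over R^n, where
    Lebesgue measure is invariant. *)
Lemma bint_base_translation (f : E -> R) (v : E) : bmf f ->
  (forall x, ~ Omega x -> f x = 0) -> (forall x, ~ Omega x -> f (x + v) = 0) ->
  \int[lam]_x f (x + v) = \int[lam]_x f x.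
Proof.
move=> bf f0 fv0.
have bfv : bmf (fun x : E => f (x + v)) by exact: (bmf_comp bf (@measurable_rV_add R n v)).
have [i1 ->] := bint_base_leb bfv fv0; have [i2 ->] := bint_base_leb bf f0.
rewrite /Rintegral; congr fine.
have := @integral_pushforward _ _ E E R _ (@measurable_rV_add R n v) (leb n) setT (EFin \o f).
rewrite preimage_setT => <- //; last by apply/measurable_EFinP; exact: bmf_meas.
apply: (@eq_measure_integral _ E R setT (leb n)
  (push (leb n) (mfun_of (@measurable_rV_add R n v)))) => A mA _.
exact: leb_translation.
Qed.

End translation.

Section test_function_quotients.
Context {R : realType} {n : nat} (Omega : set 'rV[R]_n).
Notation E := 'rV[R]_n.
Implicit Types psi : E -> R.

(** The open sets inner (eps k) Omega increase to Omega and cover the compact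
    support. *)
Lemma test_function_inner psi : open Omega -> test_function Omega psi ->
  exists2 d, 0 < d & forall x, psi x != 0 -> inner d Omega x.
Proof.
move=> oO [_ cS SO].
have: fsupport psi `<=` cover [set: nat] (fun k => inner (1 * @eps R k) Omega).
  by move=> x /SO Ox; rewrite /cover bigcup_inner.
move: cS; rewrite compact_cover => /(_ _ _ _) cS.
move=> /cS[k _|D _ DS]; first by apply: inner_open; rewrite mul1r ltW// eps_gt0.
exists (eps (\max_(k <- finmap.enum_fset D) k)%N); first exact: eps_gt0.
move=> x px; have : fsupport psi x by apply: subset_closure.
move=> /DS[k /= kD]; rewrite mul1r; apply: inner_mono; apply: eps_le.
exact: leq_bigmax_seq.
Qed.

Lemma is_derive_along psi (e x : E) (s : R) : is_smooth psi ->
  is_derive s (1 : R) (fun s : R => psi (s *: e + x)) ('D_e psi (s *: e + x)).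
Proof.
move=> spsi; apply/is_derive_line.
have d : derivable psi (s *: e + x) e by exact: is_smooth_derivable.
have /is_derive_line : is_derive (s *: e + x) e psi ('D_e psi (s *: e + x)) by exact/derivableP.
congr is_derive; apply/funext => h.
by rewrite [h *: (1 : R)]mulr1 scalerDl addrA.
Qed.

Lemma test_quotient_bounded psi (e : E) : test_function Omega psi ->
  exists C, forall (t : R) x, t != 0 -> `|t^-1 * (psi (x - t *: e) - psi x)| <= C.
Proof.
move=> tpsi; have [_ [C hC]] := test_function_derive_bmf e tpsi.
have [spsi _ _] := tpsi.
exists C => t x t0.
pose g (s : R) := psi (s *: e + x).
have dg (s : R) : is_derive s (1 : R) g ('D_e psi (s *: e + x)) by exact: is_derive_along.
have [c hc] : exists c, psi (x - t *: e) - psi x = - 'D_e psi c * t.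
  have gt : psi (x - t *: e) = g (- t) by rewrite /g scaleNr addrC.
  have g0 : psi x = g 0 by rewrite /g scale0r add0r.
  rewrite gt g0.
  have cg a b : {within `[a, b], continuous g}.
    by apply: continuous_subspaceT; exact: is_derive_continuous dg.
  have [le|lt] := leP 0 (- t).
    have [s _ ->] := MVT_segment le (fun s _ => dg s) (cg _ _).
    by exists (s *: e + x); rewrite subr0 mulrN mulNr.
  have [s _ h] := MVT_segment (ltW lt) (fun s _ => dg s) (cg _ _).
  by exists (s *: e + x); rewrite -opprB h sub0r opprK mulNr.
rewrite hc mulrC mulfK// normrN; exact: hC.
Qed.

Lemma test_quotient_cvg psi (e : E) (t : nat -> R) x : test_function Omega psi ->
  t @ \oo --> 0 -> (forall k, t k != 0) ->
  (t k)^-1 * (psi (x - t k *: e) - psi x) @[k --> \oo] --> - 'D_e psi x.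
Proof.
move=> [spsi _ _] t0 tn0.
have d : derivable psi x e by exact: is_smooth_derivable.
have cd : h^-1 *: (psi (h *: e + x) - psi x) @[h --> 0^'] --> 'D_e psi x by exact: d.
have /cvgr_dnbhsP/(_ (fun k => - t k)) h := cd.
have /cvgN : (- t k)^-1 *: (psi (- t k *: e + x) - psi x) @[k --> \oo] --> 'D_e psi x.
  apply: h; split => [k|]; first by rewrite oppr_eq0.
  by rewrite -[X in _ --> X]oppr0; exact: cvgN.
move=> hk; apply: cvg_trans hk; apply: near_eq_cvg; apply: nearW => k /=.
transitivity (- ((- t k)^-1 * (psi (- t k *: e + x) - psi x))) => //.
by rewrite invrN mulNr opprK scaleNr (addrC (- _) x).
Qed.

End test_function_quotients.

Section difference_quotients.
Context {R : realType} {n : nat} (Omega : set 'rV[R]_n).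
Notation E := 'rV[R]_n.
Variables (mO : measurable Omega) (fO : (leb n Omega < +oo)%E).
Context d (Z : measurableType d).
Variable mZ : {finite_measure set Z -> \bar R}.
Notation lam := (base mO fO).
Notation P := (finite_prod lam mZ).
Hypothesis oO : open Omega.
Implicit Types (w : (E * Z)%type -> R) (psi : E -> R) (e : E) (t : R).

(** The indicator keeps the segment from x to x + t e inside Omega; for
    functions Lipschitz on the balls of Omega the quotient is then bounded, also
    near the boundary. *)
Definition dquot w e t (p : (E * Z)%type) : R :=
  t^-1 * (w (p.1 + t *: e, p.2) - w p) * \1_(inner `|t| Omega) p.1.

Lemma bmf_shift w v : bmf w -> bmf (fun p : (E * Z)%type => w (p.1 + v, p.2)).
Proof.
move=> bw; apply: (bmf_comp bw); apply: measurable_fun_pair => //.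
exact: (measurableT_comp (@measurable_rV_add R n v) measurable_fst).
Qed.

Lemma bmf_fst (f : E -> R) : bmf f -> bmf (fun p : (E * Z)%type => f p.1).
Proof. by move=> bf; apply: (bmf_comp bf). Qed.

Lemma bmf_snd (f : Z -> R) : bmf f -> bmf (fun p : (E * Z)%type => f p.2).
Proof. by move=> bf; apply: (bmf_comp bf). Qed.

Lemma bmf_inner t : bmf (fun p : (E * Z)%type => \1_(inner `|t| Omega) p.1 : R).
Proof.
apply: (bmf_fst (f := \1_(inner `|t| Omega))); apply: bmf_indic.
by apply: open_measurable_rV; exact: inner_open.
Qed.

Lemma bmf_dquot w e t : bmf w -> bmf (dquot w e t).
Proof.
move=> bw; apply: bmfM; last exact: bmf_inner.
by apply: bmfM; [exact: bmf_cst|apply: bmfB => //; exact: bmf_shift].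
Qed.

(** The translation by t e moves the quotient to psi. The support of psi stays
    at distance more than |t| from the complement of Omega, where the indicator
    in the quotient equals 1. *)
Lemma dquot_parts w e t del psi z : bmf w -> test_function Omega psi ->
  `|e| <= 1 -> (forall x, psi x != 0 -> inner del Omega x) -> `|t| < del ->
  \int[lam]_x (dquot w e t (x, z) * psi x) =
  \int[lam]_x (w (x, z) * (t^-1 * (psi (x - t *: e) - psi x))).
Proof.
move=> bw tpsi e1 innpsi tdel.
have bpsi := test_function_bmf tpsi.
have bwz : bmf (fun x => w (x, z)) by exact: bmf_section2.
have bwt : bmf (fun x : E => w (x + t *: e, z)).
  exact: (bmf_comp bwz (@measurable_rV_add R n (t *: e))).
have bpt : bmf (fun x : E => psi (x - t *: e)).
  exact: (bmf_comp bpsi (@measurable_rV_add R n (- (t *: e)))).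
have psiO x : ~ Omega x -> psi x = 0.
  move=> nO; apply/eqP; apply: contrapT => /negP/innpsi xi; apply: nO.
  by apply: inner_sub xi; apply: le_trans (ltW tdel).
have te : `|t *: e| < del.
  by rewrite normrZ (le_lt_trans _ tdel)// ler_piMr.
have psitO x : ~ Omega x -> psi (x - t *: e) = 0.
  move=> nO; apply/eqP; apply: contrapT => /negP/innpsi xi; apply: nO.
  apply: (inner_ball xi); apply/ball_normP.
  by rewrite addrAC subrr add0r normrN.
have eL x : dquot w e t (x, z) * psi x = t^-1 * (w (x + t *: e, z) * psi x - w (x, z) * psi x).
  rewrite /dquot/=; have [->|px] := eqVneq (psi x) 0; first by rewrite !mulr0 subrr mulr0.
  rewrite indicE mem_set; first by rewrite mulr1 -mulrA mulrBl.
  by apply: inner_mono (innpsi _ px); exact: ltW.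
have eR x : w (x, z) * (t^-1 * (psi (x - t *: e) - psi x)) =
    t^-1 * (w (x, z) * psi (x - t *: e) - w (x, z) * psi x) by ring.
under eq_Rintegral do rewrite eL.
under [RHS]eq_Rintegral do rewrite eR.
rewrite !bintZl; [|by apply: bmfB; exact: bmfM|by apply: bmfB; exact: bmfM].
congr (_ * _); rewrite !bintB; [|exact: bmfM..].
congr (_ - _).
have := @bint_base_translation R n Omega mO fO (fun x => w (x, z) * psi (x - t *: e)) (t *: e).
rewrite /= => <-; first by apply: eq_Rintegral => x _; rewrite addrK.
- exact: bmfM.
- by move=> x nO; rewrite psitO// mulr0.
- by move=> x nO; rewrite addrK psiO// mulr0.
Qed.

(** Level by level, discrete integration by parts; then the quotients of psi
    converge boundedly to - D_e psi. *)
Lemma dquot_weak w e (t : nat -> R) psi (beta : Z -> R) : bmf w -> test_function Omega psi ->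
  bmf beta -> `|e| <= 1 -> (forall k, t k != 0) -> t @ \oo --> (0 : R) ->
  \int[P]_p (dquot w e (t k) p * (psi p.1 * beta p.2)) @[k --> \oo] -->
  - \int[P]_p (w p * ('D_e psi p.1 * beta p.2)).
Proof.
move=> bw tpsi bbeta e1 tn0 t0.
have [del del0 innpsi] := test_function_inner oO tpsi.
have bpsi := test_function_bmf tpsi.
have [Cq hCq] := test_quotient_bounded e tpsi.
have [_ [Cw hCw]] := bw; have [_ [Cb hCb]] := bbeta.
pose q k (p : (E * Z)%type) := w p * ((t k)^-1 * (psi (p.1 - t k *: e) - psi p.1) * beta p.2).
have bq k : bmf (q k).
  apply: bmfM => //; apply: bmfM; last exact: bmf_snd.
  apply: bmfM; first exact: bmf_cst.
  apply: bmfB; last exact: bmf_fst.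
  exact: (bmf_shift (w := fun p => psi p.1) (- (t k *: e)) (bmf_fst bpsi)).
have lim : \int[P]_p q k p @[k --> \oo] --> \int[P]_p (w p * (- 'D_e psi p.1 * beta p.2)).
  apply: (@bint_cvg _ _ _ P q _ (Cw * (Cq * Cb))).
  - by move=> k; exact: bmf_meas.
  - move=> k p; rewrite !normrM ler_pM// ?ler_pM//.
    by rewrite -normrM; exact: hCq.
  - move=> p; apply: cvgMr; apply: cvgMl.
    exact: test_quotient_cvg tpsi t0 tn0.
have -> : - (\int[P]_p (w p * ('D_e psi p.1 * beta p.2))) =
    \int[P]_p (w p * (- 'D_e psi p.1 * beta p.2)).
  rewrite -bintN; first by apply: eq_Rintegral => p _; rewrite mulNr mulrN.
  apply: bmfM => //; apply: bmfM; last exact: bmf_snd.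
  exact: (bmf_fst (test_function_derive_bmf e tpsi)).
apply: cvg_trans lim; apply: near_eq_cvg.
have /cvgrPdist_lt/(_ _ del0) := t0; apply: filterS => k; rewrite sub0r normrN => tk.
have bdq : bmf (fun p => dquot w e (t k) p * (psi p.1 * beta p.2)).
  apply: bmfM; first exact: bmf_dquot.
  by apply: bmfM; [exact: bmf_fst|exact: bmf_snd].
rewrite (bint_fubini2 _ _ (bq k)) (bint_fubini2 _ _ bdq).
apply: eq_Rintegral => z _ /=.
have -> : (fun x => q k (x, z)) = (fun x => beta z * (w (x, z) * ((t k)^-1 * (psi (x - t k *: e) - psi x)))).
  by apply/funext => x; rewrite /q/=; ring.
have -> : (fun x => dquot w e (t k) (x, z) * (psi x * beta z)) =
    (fun x => beta z * (dquot w e (t k) (x, z) * psi x)).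
  by apply/funext => x; ring.
rewrite !bintZl; first by congr (_ * _); apply/esym; exact: dquot_parts tk.
- exact: (bmfM (bmf_section2 z (bmf_dquot e (t k) bw)) bpsi).
- apply: bmfM; first exact: bmf_section2.
  apply: bmfM; first exact: bmf_cst.
  apply: bmfB => //.
  exact: (bmf_comp bpsi (@measurable_rV_add R n (- (t k *: e)))).
Qed.

End difference_quotients.

Section weak_partial.
Context {R : realType} {n : nat} (Omega : set 'rV[R]_n).
Notation E := 'rV[R]_n.
Variables (mO : measurable Omega) (fO : (leb n Omega < +oo)%E).
Context d (Z : measurableType d).
Variable mZ : {finite_measure set Z -> \bar R}.
Notation lam := (base mO fO).
Notation P := (finite_prod lam mZ).
Hypothesis oO : open Omega.
Variables (w : (E * Z)%type -> R) (L : R) (e : E).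
Hypotheses (bw : bmf w) (L0 : 0 <= L) (e1 : `|e| <= 1).
Hypothesis lipw : forall x0 rho x x' z, ball x0 rho `<=` Omega ->
  ball x0 rho x -> ball x0 rho x' -> `|w (x, z) - w (x', z)| <= L * `|x - x'|.

Lemma dquot_bounded t p : t != 0 -> `|dquot Omega w e t p| <= L.
Proof.
move=> t0; case: p => x z; rewrite /dquot/=.
have [[rho tr xO]|nx] := pselect (inner `|t| Omega x); last by rewrite indicE memNset// mulr0 normr0.
have te : `|t *: e| <= `|t| by rewrite normrZ ler_piMr.
rewrite indicE; set b := (_ \in _); have : `|(b%:R : R)| <= 1 by case: b; rewrite ?normr1 ?normr0.
move=> b1; rewrite normrM -[leRHS]mulr1 ler_pM//.
rewrite normrM normfV ler_pdivrMl ?normr_gt0// mulrC.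
apply: (le_trans (lipw z xO _ _)).
- by apply/ball_normP; rewrite opprD addrA subrr add0r normrN (le_lt_trans te).
- by apply: ballxx; exact: le_lt_trans tr.
by rewrite addrC addKr ler_wpM2l.
Qed.

Variable U : set_system nat.
Hypotheses (UU : UltraFilter U) (oU : \oo `<=` U).

(** The quotients are bounded by the Lipschitz constant and so have a weak
    limit, through which discrete integration by parts passes. The weak limit
    itself is kept in the conclusion, because signs of quotients pass to it. *)
Lemma weak_partial (t : nat -> R) : (forall k, t k != 0) -> t @ \oo --> (0 : R) ->
  exists2 G : (E * Z)%type -> R, measurable_fun setT G /\ (forall p, `|G p| <= L) &
  (forall h, bmf h ->
    \int[P]_p (dquot Omega w e (t k) p * h p) @[k --> U] --> \int[P]_p (G p * h p)) /\
  forall psi beta, test_function Omega psi -> bmf beta ->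
    \int[P]_p (G p * (psi p.1 * beta p.2)) = - (\int[P]_p (w p * ('D_e psi p.1 * beta p.2))).
Proof.
move=> tn0 t0.
have [G [mG GL] limG] := weak_star P UU (f_ := fun k => dquot Omega w e (t k))
  (fun k => bmf_meas (bmf_dquot Omega e (t k) bw)) (fun k p => dquot_bounded p (tn0 k)) L0.
exists G => //; split => // psi beta tpsi bbeta.
have bpsi := test_function_bmf tpsi.
have bh : bmf (fun p : (E * Z)%type => psi p.1 * beta p.2).
  by apply: bmfM; [exact: bmf_fst|exact: bmf_snd].
have lim1 := limG _ bh.
have lim2 := @dquot_weak _ _ _ mO fO _ _ mZ oO _ _ t _ _ bw tpsi bbeta e1 tn0 t0.
have lim2' : \int[P]_p (dquot Omega w e (t k) p * (psi p.1 * beta p.2)) @[k --> U] -->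
  - (\int[P]_p (w p * ('D_e psi p.1 * beta p.2))).
  by move=> A /lim2 h; exact: oU h.
exact: (cvg_unique _ lim1 lim2').
Qed.

End weak_partial.

(** * The weak derivatives of the quantiles *)

Section ae_integral.
Context d (T : measurableType d) {R : realType} (m : {finite_measure set T -> \bar R}).

Lemma bint_ae_eq (f g : T -> R) : bmf f -> bmf g -> {ae m, forall x, f x = g x} ->
  \int[m]_x f x = \int[m]_x g x.
Proof.
move=> bf bg fg; rewrite /Rintegral; congr fine; apply: ae_eq_integral => //.
- by apply/measurable_EFinP; exact: bmf_meas.
- by apply/measurable_EFinP; exact: bmf_meas.
by apply: filterS fg => x fgx _; rewrite fgx.
Qed.

Lemma bint_ge0 (f : T -> R) : bmf f -> (forall x, 0 <= f x) -> 0 <= \int[m]_x f x.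
Proof. by move=> bf f0; apply: Rintegral_ge0 => x _. Qed.

End ae_integral.

Lemma indicX (T1 T2 : Type) (R : realType) (A : set T1) (B : set T2) p :
  \1_(A `*` B) p = \1_A p.1 * \1_B p.2 :> R.
Proof.
rewrite !indicE -natrM mulnb; congr ((nat_of_bool _)%:R).
by apply/idP/andP => [|[]]; rewrite !inE.
Qed.

Section calculus.
Context {R : realType}.

Lemma taylor1 (chi dchi d2 : R -> R) (C a b : R) :
  (forall y, is_derive y (1 : R) chi (dchi y)) ->
  (forall y, is_derive y (1 : R) dchi (d2 y)) -> (forall y, `|d2 y| <= C) ->
  `|chi b - chi a - dchi a * (b - a)| <= C * (b - a) ^+ 2.
Proof.
move=> d1 d1' hC.
have C0 : 0 <= C by exact: le_trans (normr_ge0 _) (hC 0).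
have mvt (f df : R -> R) x y : (forall y, is_derive y (1 : R) f (df y)) ->
    exists2 s, `|s - x| <= `|y - x| & f y - f x = df s * (y - x).
  move=> df'; have [le|lt] := leP x y.
    have [s] := MVT_segment le (fun s _ => df' s) (continuous_subspaceT (is_derive_continuous df')).
    rewrite in_itv/= => /andP[s1 s2] ->; exists s => //.
    by rewrite !ger0_norm ?subr_ge0// lerD2r.
  have [s] := MVT_segment (ltW lt) (fun s _ => df' s) (continuous_subspaceT (is_derive_continuous df')).
  rewrite in_itv/= => /andP[s1 s2] h; exists s.
    by rewrite !ler0_norm ?subr_le0// ?(ltW lt)// lerN2 lerD2r.
  by rewrite -opprB h -mulrN opprB.
have [s sab ->] := mvt _ _ a b d1.
have [s' s'as] := mvt _ _ a s d1'.
rewrite -mulrBl => ->; rewrite !normrM -mulrA ler_pM//.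
have -> : (b - a) ^+ 2 = `|b - a| * `|b - a| by rewrite -expr2 real_normK ?num_real.
exact: ler_wpM2r.
Qed.

Lemma flat_second_derivative : exists (f2 : R -> R) (C : R),
  (forall t, is_derive t (1 : R) (@flat' R) (f2 t)) /\ forall t, `|f2 t| <= C.
Proof.
pose p2 := flatp_deriv (flatp_deriv (1 : {poly R})).
have [C _ hC] := flatp_bounded p2.
by exists (flatp p2), C; split => // t; exact: is_derive_flatp.
Qed.

Lemma is_derive_scale (f df : R -> R) (s a y : R) :
  (forall t, is_derive t (1 : R) f (df t)) ->
  is_derive y (1 : R) (fun y => f (s * (a - y))) (- s * df (s * (a - y))).
Proof.
move=> d1.
have dl : is_derive y (1 : R) (fun y : R => s * (a - y)) (- s).
  have h1 : is_derive y (1 : R) (fun y : R => a - y) (0 - 1) by apply: is_deriveB.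
  by have := is_deriveZ s h1; rewrite sub0r scalerN [s *: (1:R)]mulr1.
have := @is_derive1_comp R f (fun y : R => s * (a - y)) y (df (s * (a - y))) (- s) (d1 _) dl.
by rewrite (mulrC (df _)).
Qed.

(** Allows an integration over a threshold to be carried out by Fubini with a
    finite measure. *)
Lemma levels_FTC (F f : R -> R) (c : R) : 0 < c -> continuous f ->
  (forall t, is_derive t (1 : R) F (f t)) -> bmf f ->
  \int[levels c]_t f t = F c - F 0.
Proof.
move=> c0 cf dF bf.
rewrite bint_push//.
have mf : measurable_fun setT (EFin \o f : measurableTypeR R -> \bar R).
  by apply/measurable_EFinP; exact: bmf_meas.
rewrite /Rintegral (@integral_mrestr _ (measurableTypeR R) R lebesgue_measure _ _ _ mf).
rewrite (@continuous_FTC2 R f F 0 c)//.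
- exact: continuous_subspaceT.
- have dF' t : derivable F t 1 by case: (dF t).
  have cF : continuous F := is_derive_continuous dF.
  split => [t _||]; [exact: dF'|exact/cvg_at_right_filter/cF|exact/cvg_at_left_filter/cF].
- by move=> t _; rewrite derive1E; case: (dF t).
Qed.

End calculus.

Section identification.
Context {R : realType} {n : nat} (Omega : set 'rV[R]_n).
Notation E := 'rV[R]_n.
Notation ER := ('rV[R]_n * R)%type.
Variables (mO : measurable Omega) (fO : (leb n Omega < +oo)%E).
Variable lev : {finite_measure set R -> \bar R}.
Notation lam := (base mO fO).
Notation P := (finite_prod lam lev).
Variables (sg : {finite_measure set ER -> \bar R}) (mz : 'I_n -> ER -> R) (M L : R).
Hypothesis tr : transported Omega sg mz M.
Variable w : ER -> R.
Hypotheses (mw : measurable_fun setT w) (wM : forall p, `|w p| <= M) (L0 : 0 <= L).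
Hypothesis decw : forall x r r', r' <= r -> w (x, r) <= w (x, r').
Hypothesis lipw : forall x0 rho x x' z, ball x0 rho `<=` Omega ->
  ball x0 rho x -> ball x0 rho x' -> `|w (x, z) - w (x', z)| <= L * `|x - x'|.

Definition graph (p : ER) : ER := (p.1, w p).

Lemma measurable_graph : measurable_fun setT graph.
Proof. by apply: measurable_fun_pair. Qed.

Notation law := (push P (mfun_of measurable_graph)).
Hypothesis sg_law : forall A, measurable A -> sg A = law A.

Let bw : bmf w. Proof. by split => //; exists M. Qed.
Let oO : open Omega. Proof. by case: tr. Qed.
Let M0 : 0 < M. Proof. by case: tr. Qed.

Lemma bint_sg (h : ER -> R) : bmf h -> \int[sg]_p h p = \int[P]_p h (graph p).
Proof.
move=> bh; rewrite -[RHS](bint_push P (mfun_of measurable_graph) bh).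
by rewrite /Rintegral; congr fine; apply: eq_measure_integral => A mA _; exact: sg_law.
Qed.

Lemma bmf_graph (h : ER -> R) : bmf h -> bmf (fun p => h (graph p)).
Proof. by move=> bh; exact: (bmf_comp bh measurable_graph). Qed.

Let bmzi i : bmf (mz i). Proof. exact: (bmz tr). Qed.

Lemma law_out : law (~` Omega `*` setT) = 0%E.
Proof.
have mC : measurable (~` Omega) by exact: measurableC.
rewrite /push /pushforward.
have -> : mfun_of measurable_graph @^-1` (~` Omega `*` [set: R]) = ~` Omega `*` setT.
  by apply/seteqP; split.
rewrite /finite_prod product_measure1E//.
apply/eqP; rewrite mule_eq0; apply/orP; left; apply/eqP.
by change (leb n (~` Omega `&` Omega) = 0%E); rewrite setICl measure0.
Qed.

Lemma P_out : P (~` Omega `*` setT) = 0%E.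
Proof.
have mC : measurable (~` Omega) by exact: measurableC.
rewrite /finite_prod product_measure1E//.
apply/eqP; rewrite mule_eq0; apply/orP; left; apply/eqP.
by change (leb n (~` Omega `&` Omega) = 0%E); rewrite setICl measure0.
Qed.

Variable i : 'I_n.
Notation e := (delta_mx ord0 i : E).

Lemma bmf_test psi (beta : R -> R) : test_function Omega psi -> bmf beta ->
  bmf (fun p : ER => psi p.1 * beta p.2).
Proof.
move=> tpsi bbeta; apply: bmfM; first exact: (bmf_comp (test_function_bmf tpsi) measurable_fst).
exact: (bmf_comp bbeta measurable_snd).
Qed.

(** Bumps increase to the indicator of a box. *)
Lemma test_box (f : ER -> R) l h a : bmf f ->
  (forall psi beta, test_function Omega psi -> bmf beta ->
    \int[P]_p (f p * (psi p.1 * beta p.2)) = 0) ->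
  cbox l h `<=` Omega -> \int[P]_p (f p * \1_(obox l h `*` below a) p) = 0.
Proof.
move=> bf f0 lhO; have [_ [C hC]] := bf.
have bb : bmf (\1_(below a) : R -> R) by apply: bmf_indic; exact: measurable_below.
pose g (k : nat) p := f p * (boxbump l h k p.1 * \1_(below a) p.2).
have lim : \int[P]_p g k p @[k --> \oo] --> \int[P]_p (f p * \1_(obox l h `*` below a) p).
  apply: (@bint_cvg _ _ _ P g _ (C * (1 * 1))).
  - by move=> k; apply: bmf_meas; apply: bmfM => //; apply: bmf_test => //; exact: bump_test.
  - move=> k p; rewrite !normrM ler_pM ?ler_pM//.
      by rewrite ger0_norm ?bump_ge0 ?bump_le1.
    by rewrite indicE; case: (_ \in _); rewrite ?normr1 ?normr0.
  - by move=> p; apply: cvgMr; rewrite indicX; apply: cvgMl; exact: cvg_bump.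
have lim0 : \int[P]_p g k p @[k --> \oo] --> (0 : R).
  by apply: cvg_near_cst; apply: nearW => k; apply: f0 => //; exact: bump_test.
exact: (cvg_unique _ lim lim0).
Qed.

Lemma norm_delta : `|e| <= 1.
Proof.
apply: norm_le_coord => // j; rewrite mxE eqxx andTb.
by case: (_ == _); rewrite ?normr1 ?normr0.
Qed.

Variable U : set_system nat.
Hypotheses (UU : UltraFilter U) (oU : \oo `<=` U).

Section weak_limit.
Variables (t : nat -> R) (G : ER -> R).
Hypotheses (tn0 : forall k, t k != 0) (t0 : t @ \oo --> (0 : R)) (bG : bmf G).
Hypothesis limG : forall h, bmf h ->
  \int[P]_p (dquot Omega w e (t k) p * h p) @[k --> U] --> \int[P]_p (G p * h p).

Let bpsi psi : test_function Omega psi -> bmf (fun p : ER => psi p.1).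
Proof. by move=> tpsi; exact: (bmf_comp (test_function_bmf tpsi) measurable_fst). Qed.

Let bGmz : bmf (fun p => G p - mz i (graph p)).
Proof. by apply: bmfB => //; exact: bmf_graph. Qed.

(** The equation for chi(w) = flat (s (a - w)) expresses mz i chi'(w) by the
    weak derivative of chi(w). The difference quotients of chi(w) are those of w
    times chi'(w), up to O(t) by Taylor's formula, so the same holds with G in
    place of mz i. *)
Lemma weak_limit_chain psi s a : test_function Omega psi ->
  \int[P]_p ((G p - mz i (graph p)) * (psi p.1 * (s * flat' (s * (a - w p))))) = 0.
Proof.
move=> tpsi.
have [f2 [C2 [d2 hC2]]] := @flat_second_derivative R.
have [C1 C10 hC1] := @flat'_bounded R.
pose chi (y : R) := flat (s * (a - y)).
pose dchi (y : R) := - s * flat' (s * (a - y)).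
pose d2chi (y : R) := - s * (- s * f2 (s * (a - y))).
have der1 y : is_derive y (1 : R) chi (dchi y) by apply: is_derive_scale; exact: is_derive_flat.
have der2 y : is_derive y (1 : R) dchi (d2chi y).
  have h := is_derive_scale s a y d2.
  exact: (is_deriveZ (- s) h).
have d2b y : `|d2chi y| <= s ^+ 2 * C2.
  by rewrite /d2chi mulrA mulrNN -expr2 normrM ger0_norm ?sqr_ge0// ler_wpM2l ?sqr_ge0.
have dchib y : `|dchi y| <= `|s| * C1 by rewrite normrM normrN ler_wpM2l.
have chib y : `|chi y| <= 1 by rewrite ger0_norm ?flat_ge0// flat_le1.
have schi : is_smooth chi.
  have -> : chi = flat \o (fun y => - s * y + s * a) by apply/funext => y; congr flat; ring.
  apply: is_smooth_comp; first exact: smooth1_flat.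
  exact: (is_smooth_affine (- s) (s * a) (@is_smooth_id R)).
have cder (f df : R -> R) : (forall y, is_derive y (1 : R) f (df y)) -> measurable_fun setT f.
  by move=> df'; apply: continuous_measurable_fun; exact: is_derive_continuous df'.
have bchi : bmf (fun p => chi (w p)).
  by split; [exact: (measurableT_comp (cder _ _ der1) mw)|exists 1 => p].
have bdchi : bmf (fun p => dchi (w p)).
  by split; [exact: (measurableT_comp (cder _ _ der2) mw)|exists (`|s| * C1) => p].
have bp := bpsi tpsi.
have bdp : bmf (fun p : ER => 'D_e psi p.1) by exact: (bmf_comp (test_function_derive_bmf e tpsi) measurable_fst).
have bmq : bmf (fun p => mz i (graph p)) by exact: bmf_graph.
have eqmz : \int[P]_p (mz i (graph p) * (psi p.1 * dchi (w p))) =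
    - (\int[P]_p (chi (w p) * ('D_e psi p.1 * cst 1 p.2))).
  have [_ _ _ _ teq] := tr.
  have := teq psi chi dchi tpsi schi der1 _ i.
  have bnd : exists C, forall y, `|chi y| <= C /\ `|dchi y| <= C.
    exists (1 + `|s| * C1) => y; have := chib y; have := dchib y.
    by have := mulr_ge0 (normr_ge0 s) C10; lra.
  move=> /(_ bnd); rewrite bint_sg; last first.
    apply: bmfD; apply: bmfM => //.
    - by split; [exact: (measurableT_comp (cder _ _ der1))|exists 1 => p].
    - apply: bmfM => //.
      by split; [exact: (measurableT_comp (cder _ _ der2))|exists (`|s| * C1) => p].
  rewrite /graph/= bintD; [|exact: bmfM|by apply: bmfM => //; exact: bmfM].
  move/eqP; rewrite addrC addr_eq0 => /eqP h.
  transitivity (\int[P]_p (psi p.1 * dchi (w p) * mz i (p.1, w p))).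
    by apply: eq_Rintegral => p _; rewrite /graph mulrC.
  rewrite h; congr (- _); apply: eq_Rintegral => p _; rewrite /cst; ring.
have b1 : bmf (cst 1 : R -> R) by exact: bmf_cst.
have lim2 := @dquot_weak _ _ _ mO fO _ _ lev oO _ _ t _ _ bchi tpsi b1 norm_delta tn0 t0.
have lim2' : \int[P]_p (dquot Omega (fun p => chi (w p)) e (t k) p * (psi p.1 * cst 1 p.2)) @[k --> U]
   --> - (\int[P]_p (chi (w p) * ('D_e psi p.1 * cst 1 p.2))).
  by move=> A /lim2 h; exact: oU h.
have lim1 := limG (bmfM bp bdchi).
have [_ [Cp hCp]] := bp.
have near0 : \int[P]_p (dquot Omega (fun p => chi (w p)) e (t k) p * (psi p.1 * cst 1 p.2))
   - \int[P]_p (dquot Omega w e (t k) p * (psi p.1 * dchi (w p))) @[k --> U] --> (0 : R).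
  have s0 : `|t k| * (s ^+ 2 * C2 * L ^+ 2 * Cp * fine (P setT)) @[k --> U] --> (0 : R).
    have h : `|t k| * (s ^+ 2 * C2 * L ^+ 2 * Cp * fine (P setT)) @[k --> \oo] --> (0 : R).
      rewrite -[X in _ --> X](mul0r (s ^+ 2 * C2 * L ^+ 2 * Cp * fine (P setT))).
      by apply: cvgMl; rewrite -[X in _ --> X](@normr0 _ R); exact: cvg_norm.
    by move=> A /h hA; exact: oU hA.
  apply/cvgr0Pnorm_le => eps eps0.
  have /cvgr0Pnorm_le/(_ _ eps0) := s0; apply: filterS => k; apply: le_trans.
  have bpc : bmf (fun p : ER => psi p.1 * cst 1 p.2).
    have b1' : bmf (fun _ : ER => 1 : R) by exact: bmf_cst.
    exact: (bmfM bp b1').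
  have bf1 := bmfM (bmf_dquot Omega e (t k) bchi) bpc.
  have bf2 := bmfM (bmf_dquot Omega e (t k) bw) (bmfM bp bdchi).
  rewrite -(bintB P bf1 bf2).
  apply: (le_trans _ (ler_norm _)); rewrite mulrA.
  apply: (bint_norm_le P (bmfB bf1 bf2)).
  move=> p; set dq1 := dquot _ _ _ _ _; set dq2 := dquot _ _ _ _ _.
  have -> : dq1 * (psi p.1 * cst 1 p.2) - dq2 * (psi p.1 * dchi (w p)) =
      (dq1 - dq2 * dchi (w p)) * psi p.1 by rewrite /cst; ring.
  have -> : `|t k| * (s ^+ 2 * C2 * L ^+ 2 * Cp) = `|t k| * (s ^+ 2 * C2 * L ^+ 2) * Cp by ring.
  rewrite normrM ler_pM//.
  have C20 : 0 <= C2 by exact: le_trans (normr_ge0 _) (hC2 0).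
  rewrite /dq1 /dq2 {dq1 dq2}.
  have [[rho tr' xO]|nx] := pselect (inner `|t k| Omega p.1); last first.
    rewrite /dquot !indicE memNset// !mulr0 mul0r subrr normr0.
    apply: mulr_ge0 => //; apply: mulr_ge0; last exact: sqr_ge0.
    by apply: mulr_ge0 => //; exact: sqr_ge0.
  rewrite /dquot !indicE mem_set; last by exists rho.
  rewrite [X in `|X|](_ : _ = (t k)^-1 * (chi (w (p.1 + t k *: e, p.2)) - chi (w p) -
    dchi (w p) * (w (p.1 + t k *: e, p.2) - w p))); last by rewrite mulr1n; ring.
  rewrite normrM normfV.
  rewrite ler_pdivrMl ?normr_gt0//.
  have := taylor1 (w p) (w (p.1 + t k *: e, p.2)) der1 der2 d2b => /le_trans; apply.
  have -> : `|t k| * (`|t k| * (s ^+ 2 * C2 * L ^+ 2)) = s ^+ 2 * C2 * (L * `|t k|) ^+ 2 by ring.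
  rewrite ler_wpM2l//; first by rewrite mulr_ge0 ?sqr_ge0.
  rewrite -real_normK ?num_real// ler_pXn2r ?nnegrE ?mulr_ge0//.
  have te : `|t k *: e| <= `|t k| by rewrite normrZ ler_piMr// norm_delta.
  case: p xO => x r /= xO; apply: (le_trans (lipw r xO _ _)).
  - by apply/ball_normP; rewrite opprD addrA subrr add0r normrN (le_lt_trans te).
  - by apply: ballxx; exact: le_lt_trans tr'.
  by rewrite addrC addKr ler_wpM2l.
have FF : Filter U by typeclasses eauto.
have lim3 := cvgB lim2' lim1; move: (lim3 FF) => {}lim3.
have e0 := cvg_unique (@Rhausdorff R) near0 lim3; rewrite -eqmz in e0.
have PU : ProperFilter U by typeclasses eauto.
have eqG := subr0_eq (esym (e0 (fmap_proper_filter _ PU))).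
have -> : 0 = - (0 : R) by rewrite oppr0.
transitivity (- (\int[P]_p (G p * (psi p.1 * dchi (w p)) - mz i (graph p) * (psi p.1 * dchi (w p))))).
  rewrite -bintN; first by apply: eq_Rintegral => p _; rewrite /dchi; ring.
  by apply: bmfB; apply: bmfM => //; exact: bmfM.
rewrite bintB; [|by apply: bmfM => //; exact: bmfM..].
by rewrite -eqG subrr.
Qed.

(** Integrating the previous identity over the thresholds below a replaces the
    derivative of flat by flat. *)
Lemma weak_limit_flat psi s a : 0 < s -> test_function Omega psi ->
  \int[P]_p ((G p - mz i (graph p)) * (psi p.1 * flat (s * (a - w p)))) = 0.
Proof.
move=> s0 tpsi.
have [C1 C10 hC1] := @flat'_bounded R.
have [f2 [C2 [d2 hC2]]] := @flat_second_derivative R.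
have cf' : continuous (@flat' R) by exact: is_derive_continuous d2.
have mf' : measurable_fun setT (@flat' R) by exact: continuous_measurable_fun.
(* Below l the threshold is under all values of w, where flat (s (l - w))
   vanishes: integrating from l to a loses nothing. *)
pose l := Num.min (- M) a - 1; pose c := a - l.
have lM : l < - M by rewrite /l ltrBlDr gt_min ltrDl ltr01.
have c0 : 0 < c.
  by rewrite subr_gt0 /l ltrBlDr gt_min ltrDl ltr01 orbT.
pose f y tau : R := s * flat' (s * (l + tau - y)).
have bfy y : bmf (f y).
  split; last by exists (s * C1) => tau; rewrite normrM (gtr0_norm s0) ler_wpM2l// ltW.
  apply: measurable_funM => //; apply: (measurableT_comp mf'); apply: measurable_funM => //.
  by apply: measurable_funB => //; exact: measurable_funD.
have FTC y : - M <= y -> \int[levels c]_tau f y tau = flat (s * (a - y)).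
  move=> My; pose F tau := flat (- s * ((y - l) - tau)).
  have cf : continuous (f y).
    move=> tau; apply: cvgMr.
    apply: (continuous_comp (f := fun tau => s * (l + tau - y))); last exact: cf'.
    by apply: cvgMr; apply: cvgB; [apply: cvgD; [exact: cvg_cst|exact: cvg_id]|exact: cvg_cst].
  have dF tau : is_derive tau (1 : R) F (f y tau).
    have h := is_derive_scale (- s) (y - l) tau (@is_derive_flat R).
    suff -> : f y tau = - (- s) * flat' (- s * (y - l - tau)) by exact: h.
    by rewrite opprK /f; congr (_ * flat' _); ring.
  rewrite (@levels_FTC R F (f y) c c0 cf dF (bfy y)) /F.
  have -> : - s * (y - l - c) = s * (a - y) by rewrite /c; ring.
  rewrite (@flat_le0 R (- s * (y - l - 0))) ?subr0// mulNr oppr_le0 mulr_ge0//; first exact: ltW.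
  lra.
pose f0 p := (G p - mz i (graph p)) * psi p.1.
have bf0 : bmf f0 by apply: bmfM => //; exact: bpsi.
pose H (z : ER * R) := f0 z.1 * f (w z.1) z.2.
have bH : bmf H.
  apply: bmfM; first exact: (bmf_comp bf0 measurable_fst).
  split; last by exists (s * C1) => tau; rewrite normrM (gtr0_norm s0) ler_wpM2l// ltW.
  apply: measurable_funM => //; apply: (measurableT_comp mf'); apply: measurable_funM => //.
  apply: measurable_funB; first by apply: measurable_funD.
  exact: (measurableT_comp mw measurable_fst).
have e1 := bint_fubini1 P (levels c) bH; have e2 := bint_fubini2 P (levels c) bH.
transitivity (\int[P]_p \int[levels c]_y H (p, y)).
  apply: eq_Rintegral => p _; rewrite /H/= (bintZl _ _ (bfy _)) FTC ?mulrA//.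
  by have := wM p; rewrite ler_norml => /andP[].
rewrite -e1 e2; transitivity (\int[levels c]_y (cst 0 y)); last by rewrite bint_cst mul0r.
apply: eq_Rintegral => tau _; rewrite /cst -(weak_limit_chain s (l + tau) tpsi).
by apply: eq_Rintegral => p _; rewrite /H /f0 /f /= -mulrA.
Qed.

Lemma weak_limit_below psi a : test_function Omega psi ->
  \int[P]_p ((G p - mz i (graph p)) * (psi p.1 * \1_(below a) (w p))) = 0.
Proof.
move=> tpsi; have bp := bpsi tpsi.
have [_ [C hC]] := bGmz; have [_ [Cp hCp]] := bp.
have mfl k : measurable_fun setT (fun p => flat (k.+1%:R * (a - w p))).
  by apply: (measurableT_comp measurable_flat); apply: measurable_funM => //; exact: measurable_funB.
pose g (k : nat) p := (G p - mz i (graph p)) * (psi p.1 * flat (k.+1%:R * (a - w p))).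
have lim : \int[P]_p g k p @[k --> \oo] -->
    \int[P]_p ((G p - mz i (graph p)) * (psi p.1 * \1_(below a) (w p))).
  apply: (@bint_cvg _ _ _ P g _ (C * (Cp * 1))).
  - move=> k; apply: measurable_funM; first exact: bmf_meas.
    by apply: measurable_funM; first exact: bmf_meas.
  - move=> k p; rewrite !normrM ler_pM ?ler_pM//.
    by rewrite ger0_norm ?flat_ge0 ?flat_le1.
  - move=> p; apply: cvgMr; apply: cvgMr.
    have := @cvg_flat_scale R (a - w p); rewrite subr_gt0 indicE /below.
    by case: ltP => h; [rewrite mem_set|rewrite memNset//= => /lt_geF; rewrite h].
have lim0 : \int[P]_p g k p @[k --> \oo] --> (0 : R).
  apply: cvg_near_cst; apply: nearW => k; apply: weak_limit_flat => //.
exact: (cvg_unique _ lim lim0).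
Qed.

Lemma weak_limit_box l h a : cbox l h `<=` Omega ->
  \int[P]_p ((G p - mz i (graph p)) * \1_(obox l h `*` below a) (graph p)) = 0.
Proof.
move=> lhO; have [_ [C hC]] := bGmz.
have mb : measurable_fun setT (fun p => \1_(below a) (w p) : R).
  exact: (measurableT_comp (measurable_indic (measurable_below a)) mw).
have tb k := bump_test k lhO.
pose g (k : nat) p := (G p - mz i (graph p)) * (boxbump l h k p.1 * \1_(below a) (w p)).
have lim : \int[P]_p g k p @[k --> \oo] -->
    \int[P]_p ((G p - mz i (graph p)) * \1_(obox l h `*` below a) (graph p)).
  apply: (@bint_cvg _ _ _ P g _ (C * (1 * 1))).
  - move=> k; apply: measurable_funM; first exact: bmf_meas.
    by apply: measurable_funM => //; exact: bmf_meas (bpsi (tb k)).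
  - move=> k p; rewrite !normrM ler_pM ?ler_pM//.
      by rewrite ger0_norm ?bump_ge0 ?bump_le1.
    by rewrite indicE; case: (_ \in _); rewrite ?normr1 ?normr0.
  - move=> p; apply: cvgMr.
    have -> : \1_(obox l h `*` below a) (graph p) = \1_(obox l h) p.1 * \1_(below a) (w p) :> R.
      by rewrite indicX.
    by apply: cvgMl; exact: cvg_bump.
have lim0 : \int[P]_p g k p @[k --> \oo] --> (0 : R).
  by apply: cvg_near_cst; apply: nearW => k; exact: weak_limit_below.
exact: (cvg_unique _ lim lim0).
Qed.

(** The function G - mz i (x, w) is orthogonal to the boxes times half-lines in
    (x, w), which determine functions of (x, w). *)
Lemma weak_limit_graph (h : ER -> R) : bmf h ->
  \int[P]_p (G p * h (graph p)) = \int[P]_p (mz i (graph p) * h (graph p)).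
Proof.
move=> bh; have [mG [C hC]] := bG.
have C0 : 0 <= C by apply: le_trans (hC (0, 0)).
have [g [mg gC] gE] := conditional_expectation P (mfun_of measurable_graph) mG hC C0.
have bg : bmf g by split => //; exists C.
have -> : \int[P]_p (G p * h (graph p)) = \int[law]_q (g q * h q) by exact: gE.
have -> : \int[P]_p (mz i (graph p) * h (graph p)) = \int[law]_q (mz i q * h q).
  have bm : bmf (fun q => mz i q * h q) by exact: bmfM.
  by rewrite (bint_push P (mfun_of measurable_graph) bm).
apply: bint_ae_eq; [exact: bmfM|exact: bmfM|].
suff : {ae law, forall q, g q = mz i q} by apply: filterS => q ->.
apply: (ae_eq_boxes oO (@determining_R R)) => //; first exact: law_out.
move=> l k _ lkO [a ->].
have b1 : bmf (\1_(obox l k `*` below a) : ER -> R).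
  by apply: bmf_indic; apply: measurableX; [exact: measurable_obox|exact: measurable_below].
rewrite -(gE _ b1).
have bm1 : bmf (fun q => mz i q * \1_(obox l k `*` below a) q) by exact: bmfM.
rewrite (bint_push P (mfun_of measurable_graph) bm1) /=.
apply/eqP; rewrite -subr_eq0 -bintB; last 2 first.
- by apply: bmfM => //; exact: bmf_graph b1.
- by apply: bmfM; apply: (bmf_graph (h := _)).
rewrite -[X in _ == X](weak_limit_box a lkO); apply/eqP.
by apply: eq_Rintegral => p _; rewrite mulrBl.
Qed.

End weak_limit.

Let lim_sign (f : nat -> R) (l : R) : f @ U --> l -> (forall k, 0 <= f k) -> 0 <= l.
Proof.
move=> fl f0; rewrite -(cvg_lim _ fl)//; apply: limr_ge; first by apply/cvg_ex; exists l.
exact: nearW.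
Qed.

(** Let theta = 1_{r < s0} - K(x, w), where K(x, w) is the conditional
    expectation of 1_{r < s0}. Since theta is orthogonal to functions of (x, w),
    among which w(x, r) and, x being fixed, w(x + t e, s0), the increment w(x +
    t e, r) - w(x, r) may be replaced by w(x + t e, r) - w(x + t e, s0). This
    has the sign of theta: w decreases with r, while theta is >= 0 for r < s0
    and <= 0 for r >= s0. *)
Lemma quotient_sign (K : ER -> R) (s0 t : R) (B : E -> R) : t != 0 ->
  bmf K -> (forall q, 0 <= K q <= 1) -> bmf B -> (forall x, 0 <= B x) ->
  (forall h, bmf h -> \int[P]_p (\1_(below s0) p.2 * h (graph p)) =
     \int[P]_p (K (graph p) * h (graph p))) ->
  0 <= t * \int[P]_p (dquot Omega w e t p *
     (B p.1 * (\1_(below s0) p.2 - K (graph p)))).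
Proof.
move=> t0 bK K01 bB B0 KE.
have bbeta : bmf (fun p : ER => \1_(below s0) p.2 : R).
  have b1 : bmf (\1_(below s0) : R -> R) by apply: bmf_indic; exact: measurable_below.
  exact: (bmf_comp b1 measurable_snd).
have bKg := bmf_graph bK.
have orth h : bmf h -> \int[P]_p (h (graph p) * (\1_(below s0) p.2 - K (graph p))) = 0.
  move=> bh; have bhg := bmf_graph bh.
  transitivity (\int[P]_p (\1_(below s0) p.2 * h (graph p) - K (graph p) * h (graph p))).
    by apply: eq_Rintegral => p _; ring.
  by rewrite bintB ?KE ?subrr//; exact: bmfM.
pose one (x : E) : R := \1_(inner `|t| Omega) x.
have b1 : bmf one by apply: bmf_indic; apply: open_measurable_rV; exact: inner_open.
(* The second coordinate of (x, w) is bounded on the graph only; clamping makes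
   it a bounded function. *)
pose cl (y : R) : R := clamp M y.
have bcl : bmf cl.
  split; last by exists M => y; exact: clamp_le.
  apply: measurable_maxr => //; exact: measurable_minr.
have bwt : bmf (fun x : E => w (x + t *: e, s0)).
  exact: (bmf_comp (bmf_section2 s0 bw) (@measurable_rV_add R n (t *: e))).
pose h1 (q : ER) := B q.1 * one q.1 * cl q.2.
have bh1 : bmf h1.
  apply: bmfM; last exact: (bmf_comp bcl measurable_snd).
  by apply: bmfM; [exact: (bmf_comp bB measurable_fst)|exact: (bmf_comp b1 measurable_fst)].
pose h2 (q : ER) := B q.1 * one q.1 * w (q.1 + t *: e, s0).
have bh2 : bmf h2.
  apply: bmfM; last exact: (bmf_comp bwt measurable_fst).
  by apply: bmfM; [exact: (bmf_comp bB measurable_fst)|exact: (bmf_comp b1 measurable_fst)].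
have bh : bmf (fun p => \1_(below s0) p.2 - K (graph p)) by exact: bmfB.
have bw2 : bmf (fun p : ER => w (p.1 + t *: e, p.2)) by exact: bmf_shift.
pose f p := B p.1 * one p.1 * ((w (p.1 + t *: e, p.2) - w (p.1 + t *: e, s0)) *
  (\1_(below s0) p.2 - K (graph p))).
have bBo : bmf (fun p : ER => B p.1 * one p.1).
  by apply: bmfM; [exact: (bmf_comp bB measurable_fst)|exact: (bmf_comp b1 measurable_fst)].
have bf : bmf f.
  apply: bmfM => //; apply: bmfM => //; apply: bmfB => //.
  exact: (bmf_comp bwt measurable_fst).
have bd : bmf (fun p => dquot Omega w e t p * (B p.1 * (\1_(below s0) p.2 - K (graph p)))).
  apply: bmfM; first exact: bmf_dquot.
  by apply: bmfM => //; exact: (bmf_comp bB measurable_fst).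
rewrite -bintZl//.
have -> : \int[P]_p (t * (dquot Omega w e t p * (B p.1 * (\1_(below s0) p.2 - K (graph p))))) =
    \int[P]_p f p + \int[P]_p (h2 (graph p) * (\1_(below s0) p.2 - K (graph p))) -
    \int[P]_p (h1 (graph p) * (\1_(below s0) p.2 - K (graph p))).
  have bg1 := bmf_graph bh1; have bg2 := bmf_graph bh2.
  rewrite -bintD//; last exact: bmfM.
  rewrite -bintB//; [|by apply: bmfD => //; exact: bmfM|exact: bmfM].
  apply: eq_Rintegral => p _; rewrite /f /h1 /h2 /dquot /graph/= /cl clampE// -/(one p.1).
  by rewrite !mulrA mulfV// mul1r; ring.
rewrite !orth// addr0 subr0; apply: bint_ge0 => // -[x r]; rewrite /f/=.
apply: mulr_ge0; first by rewrite mulr_ge0// /one indicE.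
have /andP[K0 K1] := K01 (graph (x, r)).
rewrite indicE /below; have [rs|sr] := ltP r s0.
  by rewrite mem_set// mulr_ge0// subr_ge0//; apply: decw; exact: ltW.
rewrite memNset//=; last by apply/negP; rewrite -leNgt.
by rewrite mulr_le0// ?sub0r ?oppr_le0// subr_le0; exact: decw.
Qed.

(** Let G be the weak limit of the forward quotients. The backward quotients
    have a limit G' which is again the weak derivative of w, so G' = G almost
    everywhere. By the sign of the quotients the integrals of G and of G'
    against B theta are >= 0 and <= 0, hence vanish: G is orthogonal to what
    1_{r < s0} adds to (x, w). So G is its own mean given (x, w), which is mz i.
    *)
Lemma weak_derivative_graph psi beta : test_function Omega psi -> bmf beta ->
  \int[P]_p (mz i (graph p) * (psi p.1 * beta p.2)) =
  - (\int[P]_p (w p * ('D_e psi p.1 * beta p.2))).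
Proof.
have eps0 : (@eps R) @ \oo --> (0 : R) by exact: cvg_harmonic.
have epsn0 k : @eps R k != 0 by rewrite gt_eqF// eps_gt0.
have neps0 : (fun k => - @eps R k) @ \oo --> (0 : R).
  by rewrite -[X in _ --> X]oppr0; exact: cvgN.
have nepsn0 k : - @eps R k != 0 by rewrite oppr_eq0.
have [G [mG GL] [limG GE]] := weak_partial mO fO lev oO bw L0 norm_delta lipw UU oU epsn0 eps0.
have [G' [mG' GL'] [limG' GE']] := weak_partial mO fO lev oO bw L0 norm_delta lipw UU oU nepsn0 neps0.
have bG : bmf G by split => //; exists L.
have bG' : bmf G' by split => //; exists L.
have GG' : {ae P, forall p, G p = G' p}.
  apply: (ae_eq_boxes oO (@determining_R R)) => //; first exact: P_out.
  move=> l h _ lhO [a ->].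
  have b1 : bmf (\1_(obox l h `*` below a) : ER -> R).
    by apply: bmf_indic; apply: measurableX; [exact: measurable_obox|exact: measurable_below].
  apply/eqP; rewrite -subr_eq0 -bintB; [|exact: bmfM..].
  apply/eqP; rewrite -(test_box (f := fun p => G p - G' p) a _ _ lhO).
  - by apply: eq_Rintegral => p _; rewrite mulrBl.
  - exact: bmfB.
  move=> psi' beta' tpsi bbeta; have bp := bmf_test tpsi bbeta.
  transitivity (\int[P]_p (G p * (psi' p.1 * beta' p.2) - G' p * (psi' p.1 * beta' p.2))).
    by apply: eq_Rintegral => p _; rewrite mulrBl.
  by rewrite bintB ?GE ?GE' ?subrr//; exact: bmfM.
have key (B : E -> R) s0 : bmf B -> (forall x, 0 <= B x) ->
    \int[P]_p (G p * (B p.1 * \1_(below s0) p.2)) =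
    \int[P]_p (mz i (graph p) * (B p.1 * \1_(below s0) p.2)).
  move=> bB B0.
  (* Centred at 1/2, so that the symmetric bound on the conditional expectation
     gives 0 <= K <= 1. *)
  have m12 : measurable_fun setT (fun p : ER => \1_(below s0) p.2 - 2^-1 : R).
    apply: measurable_funB => //.
    exact: (measurableT_comp (measurable_indic (measurable_below s0)) measurable_snd).
  have c12 (p : ER) : `|\1_(below s0) p.2 - 2^-1 : R| <= 2^-1.
    by rewrite indicE; case: (_ \in _); rewrite ler_norml/=; apply/andP; split; lra.
  have h0 : (0 : R) <= 2^-1 by rewrite invr_ge0.
  have [K' [mK' K'b] KE'] := conditional_expectation P (mfun_of measurable_graph) m12 c12 h0.
  pose K q := K' q + 2^-1.
  have bK' : bmf K' by split => //; exists 2^-1.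
  have bK : bmf K by apply: bmfD => //; exact: bmf_cst.
  have K01 q : 0 <= K q <= 1.
    by have := K'b q; rewrite /K ler_norml => /andP[? ?]; apply/andP; split; lra.
  have bbeta : bmf (\1_(below s0) : R -> R) by apply: bmf_indic; exact: measurable_below.
  have bb2 : bmf (fun p : ER => \1_(below s0) p.2 : R) by exact: (bmf_comp bbeta measurable_snd).
  have KE (h : ER -> R) : bmf h -> \int[P]_p (\1_(below s0) p.2 * h (graph p)) =
     \int[P]_p (K (graph p) * h (graph p)).
    move=> bh; have bhg := bmf_graph bh.
    have bKh : bmf (fun q => K' q * h q) by exact: bmfM.
    have := KE' h bh; rewrite (bint_push P (mfun_of measurable_graph) bKh) /= => e1.
    transitivity (\int[P]_p ((\1_(below s0) p.2 - 2^-1) * h (graph p) + 2^-1 * h (graph p))).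
      by apply: eq_Rintegral => p _; ring.
    have b3 : bmf (fun p : ER => (\1_(below s0) p.2 - 2^-1) * h (graph p)).
      by apply: bmfM => //; apply: bmfB => //; exact: bmf_cst.
    have b4 : bmf (fun p : ER => 2^-1 * h (graph p)) by apply: bmfM => //; exact: bmf_cst.
    rewrite bintD// e1 -bintD//; last exact: bmf_graph bKh.
    by apply: eq_Rintegral => p _; rewrite /K /=; ring.
  have bB2 : bmf (fun p : ER => B p.1) by exact: (bmf_comp bB measurable_fst).
  pose r p := B p.1 * (\1_(below s0) p.2 - K (graph p)).
  have br : bmf r by apply: bmfM => //; apply: bmfB => //; exact: bmf_graph.
  have pos : 0 <= \int[P]_p (G p * r p).
    apply: (lim_sign (limG _ br)) => k.
    have := quotient_sign (epsn0 k) bK K01 bB B0 KE.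
    by rewrite pmulr_rge0// eps_gt0.
  have neg : 0 <= - (\int[P]_p (G' p * r p)).
    apply: (lim_sign (cvgN (limG' _ br))) => k.
    have := quotient_sign (nepsn0 k) bK K01 bB B0 KE.
    by rewrite mulNr -mulrN pmulr_rge0// eps_gt0.
  have eGG' : \int[P]_p (G p * r p) = \int[P]_p (G' p * r p).
    apply: bint_ae_eq; [exact: bmfM|exact: bmfM|].
    by apply: filterS GG' => p ->.
  have zero : \int[P]_p (G p * r p) = 0 by apply/le_anti; rewrite pos andbT eGG' -oppr_ge0.
  pose hK (q : ER) := B q.1 * K q.
  have bhK : bmf hK by exact: bmfM.
  pose hm (q : ER) := B q.1 * mz i q.
  have bhm : bmf hm by exact: bmfM.
  have s1 : \int[P]_p (G p * (B p.1 * \1_(below s0) p.2)) =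
     \int[P]_p (G p * r p) + \int[P]_p (G p * hK (graph p)).
    rewrite -bintD; [|exact: bmfM|by apply: bmfM => //; exact: bmf_graph bhK].
    by apply: eq_Rintegral => p _; rewrite /r /hK /=; ring.
  rewrite s1 zero add0r (weak_limit_graph epsn0 eps0 bG limG bhK).
  transitivity (\int[P]_p (K (graph p) * hm (graph p))).
    by apply: eq_Rintegral => p _; rewrite /hK /hm; ring.
  by rewrite -(KE _ bhm); apply: eq_Rintegral => p _; rewrite /hm /=; ring.
have GE0 : {ae P, forall p, G p = mz i (graph p)}.
  apply: (ae_eq_boxes oO (@determining_R R)) => //; [exact: P_out|exact: bmf_graph|].
  move=> l h _ lhO [a ->].
  have bO : bmf (\1_(obox l h) : E -> R) by apply: bmf_indic; exact: measurable_obox.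
  have O0 x : 0 <= \1_(obox l h) x :> R by rewrite indicE.
  have := key _ a bO O0.
  under eq_Rintegral do rewrite -indicX.
  by under [X in _ = X -> _]eq_Rintegral do rewrite -indicX.
move=> tpsi bbeta; rewrite -GE//.
have bp : bmf (fun p : ER => psi p.1 * beta p.2).
  by apply: bmfM; [exact: (bmf_comp (test_function_bmf tpsi) measurable_fst)|exact: (bmf_comp bbeta measurable_snd)].
apply: bint_ae_eq; [by apply: bmfM => //; exact: bmf_graph|exact: bmfM|].
by apply: filterS GE0 => p ->.
Qed.

End identification.

(** * Uniqueness of weak gradients and regularity of the data *)

Section weak_gradient_uniqueness.
Context {R : realType} {n : nat} (Omega : set 'rV[R]_n).
Notation E := 'rV[R]_n.
Hypothesis oO : open Omega.

Let mO : measurable Omega. Proof. exact: open_measurable_rV. Qed.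

Let measurable_cbox (l h : E) : measurable (cbox l h).
Proof. exact: (closed_measurable_rV (@cbox_closed R n l h)). Qed.

Let obox_cbox (l h : E) : obox l h `<=` cbox l h.
Proof. by move=> x xb i; have /andP[? ?] := xb i; apply/andP; split; exact: ltW. Qed.

(** Dominated convergence on the closed box, where f is integrable. *)
Lemma bump_integral_cvg (f : E -> R) l h : locally_integrable_on Omega f ->
  cbox l h `<=` Omega ->
  \int[leb n]_(x in Omega) (f x * boxbump l h k x) @[k --> \oo] -->
  \int[leb n]_(x in obox l h) f x.
Proof.
move=> [mf intf] lhO.
have iK := intf _ (@cbox_compact R n l h) lhO.
have mK := measurable_cbox l h.
have mfK : measurable_fun (cbox l h) (EFin \o f) by exact: measurable_int iK.
have mb k : measurable_fun (cbox l h) (EFin \o boxbump l h k).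
  apply/measurable_EFinP; apply: measurable_funTS.
  exact: bmf_meas (test_function_bmf (bump_test k lhO)).
have eqI k : \int[leb n]_(x in Omega) (f x * boxbump l h k x) =
    fine (\int[leb n]_(x in cbox l h) (f x * boxbump l h k x)%:E)%E.
  rewrite /Rintegral; congr fine; rewrite integral_mkcond [RHS]integral_mkcond.
  apply: eq_integral => x _; rewrite !patchE.
  have [xb|nxb] := pselect (cbox l h x); first by rewrite !mem_set//; exact: lhO.
  rewrite (memNset nxb) bump_out ?mulr0 ?if_same// => xo; apply: nxb.
  exact: obox_cbox.
under eq_fun do rewrite eqI.
have -> : \int[leb n]_(x in obox l h) f x =
    fine (\int[leb n]_(x in cbox l h) (f x * \1_(obox l h) x)%:E)%E.
  rewrite /Rintegral; congr fine; rewrite integral_mkcond [RHS]integral_mkcond.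
  apply: eq_integral => x _; rewrite !patchE indicE.
  have [xb|nxb] := pselect (obox l h x).
    by rewrite !mem_set ?mulr1//; exact: obox_cbox.
  by rewrite (memNset nxb) mulr0 if_same.
have mo : measurable_fun (cbox l h) (\1_(obox l h) : E -> R).
  by apply: measurable_funTS; apply: measurable_indic; exact: measurable_obox.
have mfR : measurable_fun (cbox l h) f by exact/measurable_EFinP.
have [|||||i2 _ cv] := @dominated_convergence _ E R (leb n) (cbox l h) mK
  (fun k x => (f x * boxbump l h k x)%:E) (fun x => (f x * \1_(obox l h) x)%:E)
  (fun x => `|f x|%:E).
- by move=> k; apply/measurable_EFinP; apply: measurable_funM => //; exact/measurable_EFinP.
- by apply/measurable_EFinP; exact: measurable_funM.
- apply: aeW => x _; apply: cvg_EFin; first exact: nearW.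
  by apply: cvgMr; exact: cvg_bump.
- exact: integrable_norm iK.
- apply: aeW => x k _; rewrite lee_fin normrM ler_piMr// ger0_norm ?bump_ge0//.
  exact: bump_le1.
apply: fine_cvg; rewrite fineK//.
by apply: integrable_fin_num.
Qed.

(** Countably many test functions suffice, which will allow a single null set of
    levels for all of them. *)
Lemma ae_eq_bumps (f g : E -> R) : locally_integrable_on Omega f ->
  locally_integrable_on Omega g ->
  (forall l h : 'rV[rat]_n, cbox (ratv l) (ratv h) `<=` Omega -> forall k,
    \int[leb n]_(x in Omega) (f x * boxbump (ratv l) (ratv h) k x) =
    \int[leb n]_(x in Omega) (g x * boxbump (ratv l) (ratv h) k x)) ->
  {ae leb n, forall x, Omega x -> f x = g x}.
Proof.
move=> lf lg fg.
have fgo l h : cbox (ratv l) (ratv h) `<=` Omega ->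
    \int[leb n]_(x in obox (ratv l) (ratv h)) f x =
    \int[leb n]_(x in obox (ratv l) (ratv h)) g x.
  move=> lhO; have c1 := bump_integral_cvg lf lhO; have c2 := bump_integral_cvg lg lhO.
  rewrite -(cvg_lim _ c1)// -(cvg_lim _ c2)//; congr (lim (_ @ \oo)).
  by apply/funext => k; exact: fg.
have [l [h [D [DO OD]]]] := rational_box_cover oO.
have int (F : E -> R) a b : locally_integrable_on Omega F -> cbox a b `<=` Omega ->
    (leb n).-integrable (obox a b) (EFin \o F).
  move=> [_ iF] abO; apply: integrableS (iF _ (@cbox_compact R n a b) abO) => //.
  exact: measurable_obox.
have step k : {ae leb n, forall x, D k -> obox (ratv (l k)) (ratv (h k)) x -> f x = g x}.
  have [Dk|nD] := pselect (D k); last by apply: aeW.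
  have lhO := DO _ Dk.
  have mo : measurable (obox (ratv (l k)) (ratv (h k)) : set E) by exact: measurable_obox.
  have := ae_eq_determining (m := leb n) determining_quadrant mo (int _ _ _ lf lhO) (int _ _ _ lg lhO).
  move=> aek; suff: {ae leb n, forall x, obox (ratv (l k)) (ratv (h k)) x -> f x = g x}.
    by apply: filterS => x fx _.
  apply: aek => _ [a ->]; rewrite quadrant_obox ratv_min.
  set b := \row_i _.
  have bO : cbox (ratv (l k)) (ratv b) `<=` Omega.
    by apply: subset_trans lhO; rewrite /b -ratv_min; exact: cbox_min.
  have := fgo _ _ bO; rewrite /Rintegral => e.
  rewrite -[LHS]fineK; last by apply: integrable_fin_num; [exact: measurable_obox|exact: int].
  rewrite -[RHS]fineK; last by apply: integrable_fin_num; [exact: measurable_obox|exact: int].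
  by congr EFin.
have all := ae_foralln step.
apply: filterS all => x hx Ox.
have : (\bigcup_(k in D) obox (ratv (l k)) (ratv (h k))) x by rewrite -OD.
by move=> [k Dk xk]; apply: (hx k).
Qed.

End weak_gradient_uniqueness.

Section levels_radon.
Context {R : realType}.

Lemma levels_is_radon (c : R) : is_radon (levels c).
Proof.
split=> [K cK|A mA].
  rewrite -ge0_fin_numE//; apply: fin_num_measure.
  by apply: closed_measurable; apply: compact_closed cK; exact: Rhausdorff.
have mA' : measurable A.
  move: A mA; apply: smallest_sub; first exact: sigma_algebra_measurable.
  by move=> A oA; exact: open_measurable.
have mAc : measurable (A `&` `[0, c]%classic) by apply: measurableI.
rewrite levelsE (lebesgue_regularity_inner_sup mAc); congr ereal_sup.
apply/seteqP; split => _ [K [cK KA] <-].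
  exists K; first by split => //; apply: subset_trans KA _; exact: subIsetl.
  by rewrite levelsE setIidl//; apply: subset_trans KA _; exact: subIsetr.
exists (K `&` `[0, c]%classic); last by rewrite levelsE.
split; last exact: setSI.
apply: (subclosed_compact _ cK); last exact: subIsetl.
apply: closedI; first by apply: compact_closed cK; exact: Rhausdorff.
exact: interval_closed.
Qed.

Lemma levels_compactly_supported (c : R) : compactly_supported (levels c).
Proof.
apply: (@subclosed_compact _ _ `[0, c]%classic).
- rewrite -[X in closed X]setCK; apply: open_closedC; rewrite openE => x /= nx.
  have [V [oV Vx V0]] : exists V, [/\ open V, V x & ~ (0 < levels c V)%E].
    apply: contrapT => h; apply: nx => V oV Vx; apply: contrapT => V0; apply: h.
    by exists V.
  have : nbhs x V by exact: open_nbhs_nbhs.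
  by apply: filterS => y Vy supp; apply: V0; exact: supp.
- exact: segment_compact.
move=> x suppx; apply: contrapT => nx.
have oC : open (~` `[0, c]%classic : set R) by apply: closed_openC; exact: interval_closed.
by have := suppx _ oC nx; rewrite levelsE setICl measure0 ltxx.
Qed.

End levels_radon.

Section lipschitz_W1infty.
Context {R : realType} {n : nat} (Omega : set 'rV[R]_n).
Notation E := 'rV[R]_n.
Variables (mO : measurable Omega) (fO : (leb n Omega < +oo)%E).
Hypothesis oO : open Omega.
Notation lam := (base mO fO).

Lemma bint_base_in (f : E -> R) : measurable_fun setT f ->
  \int[lam]_x f x = \int[leb n]_(x in Omega) f x.
Proof.
move=> mf; rewrite /Rintegral (@integral_mrestr _ _ _ (leb n) _ mO)//.
exact/measurable_EFinP.
Qed.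

Lemma bmf_locally_integrable (f : E -> R) : bmf f -> locally_integrable_on Omega f.
Proof.
move=> bf; split; first exact: measurable_funTS (bmf_meas bf).
move=> K cK KO; have mK : measurable K.
  by apply: closed_measurable_rV; apply: compact_closed cK; exact: norm_hausdorff.
have mf : measurable_fun setT (EFin \o f) by apply/measurable_EFinP; exact: bmf_meas.
apply: integrableS KO _ => //.
apply: (proj1 (@integrable_mrestr _ _ _ (leb n) _ mO _ mf)).
exact: (@bmf_integrable _ _ _ lam _ _ measurableT bf).
Qed.

(** The weak gradient comes from weak limits of difference quotients, the
    parameter space being reduced to a point mass. *)
Lemma lipschitz_W1infty (u : E -> R) (L : R) : bmf u -> 0 <= L ->
  (forall x0 rho x x', ball x0 rho `<=` Omega -> ball x0 rho x -> ball x0 rho x' ->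
    `|u x - u x'| <= L * `|x - x'|) -> W1infty Omega u.
Proof.
move=> bu L0 lipu; split.
- apply: continuous_in_subspaceT => x; rewrite inE => Ox.
  have /nbhs_ballP[rho /= r0 xO] : nbhs x Omega by exact: open_nbhs_nbhs.
  have FF : Filter (nbhs x) by exact: nbhs_filter.
  apply: (proj2 (@cvgrPdist_le _ _ _ _ FF _ _)) => eps eps0.
  have L1 : 0 < L + 1 by lra.
  have d0 : 0 < Num.min rho (eps / (L + 1)) by rewrite lt_min r0 divr_gt0.
  apply: filterS (nbhsx_ballx x _ d0) => y /ball_normP.
  rewrite lt_min => /andP[xy1 xy2].
  apply: (le_trans (lipu x rho _ _ xO (ballxx _ r0) _)); first exact/ball_normP.
  move: xy2; rewrite ltr_pdivlMr// => /ltW; apply: le_trans.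
  by rewrite mulrC ler_wpM2l//; lra.
- by have [_ [C hC]] := bu; exists C; apply: aeW => x _; exact: hC.
have [U [UU oU]] := @ultraFilterLemma nat \oo _.
pose dz : {finite_measure set R -> \bar R} := \d_(0 : R).
pose w (p : (E * R)%type) := u p.1.
have bw : bmf w by exact: (bmf_comp bu measurable_fst).
have eps0 : (@eps R) @ \oo --> (0 : R) by exact: cvg_harmonic.
have epsn0 k : @eps R k != 0 by rewrite gt_eqF// eps_gt0.
have ex i : exists G : (E * R)%type -> R, (measurable_fun setT G /\ (forall p, `|G p| <= L)) /\
  forall psi beta, test_function Omega psi -> bmf beta ->
    \int[finite_prod lam dz]_p (G p * (psi p.1 * beta p.2)) =
    - (\int[finite_prod lam dz]_p (w p * ('D_(delta_mx ord0 i : E) psi p.1 * beta p.2))).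
  have [G bG [_ GE]] := weak_partial mO fO dz oO bw L0 (norm_delta i)
    (fun x0 rho x x' (z : R) => lipu x0 rho x x') UU oU epsn0 eps0.
  by exists G.
have [G hG] := choice ex.
pose g (x : E) : E := \row_i G i (x, 0).
have bGi i : bmf (G i) by have [[mG GL] _] := hG i; split => //; exists L.
have bgi i : bmf (fun x => g x ord0 i).
  have -> : (fun x => g x ord0 i) = (fun x => G i (x, 0)).
    by apply/funext => x; rewrite mxE.
  exact: (bmf_section2 (0 : R) (bGi i)).
have toleb (F : (E * R)%type -> R) : bmf F ->
    \int[finite_prod lam dz]_p F p = \int[leb n]_(x in Omega) F (x, 0).
  move=> bF; pose H (z : R) := \int[lam]_x F (x, z).
  have mH : measurable_fun setT (EFin \o H).
    have bH : bmf H by exact: bmf_int2.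
    by apply: (proj2 (measurable_EFinP setT H)); exact: bmf_meas.
  rewrite (bint_fubini2 _ _ bF) -/H [LHS]/Rintegral.
  rewrite (integral_dirac (0 : R) measurableT mH).
  by rewrite diracE mem_set// mul1e/= /H bint_base_in//; exact: (bmf_meas (bmf_section2 (0 : R) bF)).
exists g.
  split.
  - exact: bmf_locally_integrable.
  - by move=> i; exact: bmf_locally_integrable.
  move=> psi tpsi i; have [_ GE] := hG i.
  have b1 : bmf (cst 1 : R -> R) by exact: bmf_cst.
  have := GE psi (cst 1) tpsi b1.
  have bp : bmf (fun p : (E * R)%type => psi p.1).
    exact: (bmf_comp (test_function_bmf tpsi) measurable_fst).
  have bdp : bmf (fun p : (E * R)%type => 'D_(delta_mx ord0 i : E) psi p.1).
    exact: (bmf_comp (test_function_derive_bmf _ tpsi) measurable_fst).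
  have b1' : bmf (fun _ : (E * R)%type => 1 : R) by exact: bmf_cst.
  rewrite !toleb; [|exact: (bmfM bw (bmfM bdp b1'))|exact: (bmfM (bGi i) (bmfM bp b1'))].
  move=> e; apply/eqP; rewrite -eqr_oppLR; apply/eqP.
  transitivity (- \int[leb n]_(x in Omega) (w (x, 0) *
    ('D_(delta_mx ord0 i) psi (x, 0 : R).1 * cst 1 (x, 0 : R).2))).
    by congr (- _); apply: eq_Rintegral => x _; rewrite /w /cst /= mulr1.
  by rewrite -e; apply: eq_Rintegral => x _; rewrite /g mxE /cst /= mulr1.
exists L; apply: aeW => x _; apply: norm_le_coord => // i.
by rewrite mxE; have [[_ GL] _] := hG i; exact: GL.
Qed.

End lipschitz_W1infty.

(** * Gradients at almost every level, averages of affine functions *)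

Section weak_gradients_of_levels.
Context {R : realType} {n : nat} (Omega : set 'rV[R]_n).
Notation E := 'rV[R]_n.
Notation ER := ('rV[R]_n * R)%type.
Variables (mO : measurable Omega) (fO : (leb n Omega < +oo)%E).
Variable lev : {finite_measure set R -> \bar R}.
Notation lam := (base mO fO).
Notation P := (finite_prod lam lev).
Hypothesis oO : open Omega.
Variables (w : ER -> R) (g : 'I_n -> ER -> R).
Hypotheses (bw : bmf w) (bg : forall i, bmf (g i)).
Hypothesis wg : forall i psi beta, test_function Omega psi -> bmf beta ->
  \int[P]_p (g i p * (psi p.1 * beta p.2)) =
  - (\int[P]_p (w p * ('D_(delta_mx ord0 i : E) psi p.1 * beta p.2))).

Let fubini_level (F : ER -> R) (psi : E -> R) (beta : R -> R) : bmf F -> bmf psi -> bmf beta ->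
  \int[P]_p (F p * (psi p.1 * beta p.2)) = \int[lev]_r ((\int[lam]_x (F (x, r) * psi x)) * beta r).
Proof.
move=> bF bpsi bbeta.
have b1 : bmf (fun p : ER => psi p.1) by exact: (bmf_comp bpsi measurable_fst).
have b2 : bmf (fun p : ER => beta p.2) by exact: (bmf_comp bbeta measurable_snd).
rewrite (bint_fubini2 _ _ (bmfM bF (bmfM b1 b2))); apply: eq_Rintegral => r _ /=.
rewrite mulrC -bintZl; last exact: (bmfM (bmf_section2 r bF) bpsi).
by apply: eq_Rintegral => x _; ring.
Qed.

Let level_identity i psi : test_function Omega psi ->
  {ae lev, forall r, \int[lam]_x (g i (x, r) * psi x) =
    - \int[lam]_x (w (x, r) * 'D_(delta_mx ord0 i : E) psi x)}.
Proof.
move=> tpsi.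
have bpsi := test_function_bmf tpsi.
have bdpsi := test_function_derive_bmf (delta_mx ord0 i : E) tpsi.
pose f1 r := \int[lam]_x (g i (x, r) * psi x).
pose f2 r := - \int[lam]_x (w (x, r) * 'D_(delta_mx ord0 i : E) psi x).
have b1 : bmf f1.
  apply: (bmf_int2 lam lev (f := fun p => g i p * psi p.1)).
  by apply: bmfM => //; exact: (bmf_comp bpsi measurable_fst).
have b2 : bmf f2.
  apply: bmfN; apply: (bmf_int2 lam lev (f := fun p => w p * 'D_(delta_mx ord0 i : E) psi p.1)).
  by apply: bmfM => //; exact: (bmf_comp bdpsi measurable_fst).
suff : {ae lev, forall r, [set: R] r -> f1 r = f2 r} by apply: filterS => r; apply.
apply: (ae_eq_determining (@determining_measurable R _ R)) => //.
- exact: bmf_integrable.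
- exact: bmf_integrable.
move=> A mA; rewrite setIT -(bint_EFin lev mA b1) -(bint_EFin lev mA b2); congr EFin.
rewrite -(bint_indicM lev f1 mA) -(bint_indicM lev f2 mA).
have bA : bmf (\1_A : R -> R) by exact: bmf_indic.
rewrite /f1 -(fubini_level (bg i) bpsi bA) wg// (fubini_level bw bdpsi bA).
rewrite -bintN; first by apply: eq_Rintegral => r _; rewrite /f2 mulNr.
apply: bmfM => //; have := bmfN b2; congr bmf.
by apply/funext => r; rewrite /f2 opprK.
Qed.

(** For one test function, the two sides have the same integrals over all sets
    of levels, hence agree for almost every level. Countably many of them
    determine a weak gradient, so that the exceptional levels do not depend on
    the gradient. *)
Lemma weak_gradient_levels :
  {ae lev, forall r, forall G : E -> E, is_weak_gradient Omega (fun x => w (x, r)) G ->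
    {ae leb n, forall x, Omega x -> forall i, G x ord0 i = g i (x, r)}}.
Proof.
pose tests := ('I_n * 'rV[rat]_n * 'rV[rat]_n * nat)%type.
pose Q (t : tests) r := cbox (ratv t.1.1.2) (ratv t.1.2) `<=` Omega ->
  \int[lam]_x (g t.1.1.1 (x, r) * boxbump (ratv t.1.1.2) (ratv t.1.2) t.2 x) =
  - \int[lam]_x (w (x, r) * 'D_(delta_mx ord0 t.1.1.1 : E) (boxbump (ratv t.1.1.2) (ratv t.1.2) t.2) x).
have aeQ j : {ae lev, forall r, forall t, unpickle j = Some t -> Q t r}.
  case E : (unpickle j) => [t|]; last by apply: aeW.
  have [tO|nO] := pselect (cbox (ratv t.1.1.2) (ratv t.1.2) `<=` Omega).
    by apply: filterS (level_identity t.1.1.1 (bump_test t.2 tO)) => r hr _ [<-] _.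
  by apply: aeW => r _ [<-] /nO.
apply: filterS (ae_foralln aeQ) => r hr G [[mw iw] iG GE].
have all i : {ae leb n, forall x, Omega x -> G x ord0 i = g i (x, r)}.
  have bgr : bmf (fun x => g i (x, r)) by exact: (bmf_section2 r (bg i)).
  have bwr : bmf (fun x => w (x, r)) by exact: (bmf_section2 r bw).
  apply: (ae_eq_bumps oO (iG i) (bmf_locally_integrable mO fO bgr)) => l h lhO k.
  have tb := bump_test k lhO.
  have := hr (pickle ((i, l, h, k) : tests)) (i, l, h, k); rewrite pickleK => /(_ erefl lhO) /=.
  rewrite !bint_base_in; first last.
  - exact: (bmf_meas (bmfM bgr (test_function_bmf tb))).
  - exact: (bmf_meas (bmfM bwr (test_function_derive_bmf _ tb))).
  by rewrite GE// opprK => ->.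
by apply: filterS (filter_forall _ all) => x h Ox i; exact: h.
Qed.

End weak_gradients_of_levels.

Section exhaustion.
Context d (Y : measurableType d) {R : realType}.

Lemma cvg_exhaust (m : {finite_measure set Y -> \bar R}) (F : Y -> R) (T : nat -> set Y) :
  m.-integrable setT (EFin \o F) -> (forall k, measurable (T k)) ->
  (forall y, exists N, forall k, (N <= k)%N -> T k y) ->
  \int[m]_y (F y * \1_(T k) y) @[k --> \oo] --> \int[m]_y F y.
Proof.
move=> iF mT TT.
have mF : measurable_fun setT F by apply/measurable_EFinP; exact: measurable_int iF.
have [|||||i2 _ cv] := @dominated_convergence _ Y R m setT measurableT
  (fun k y => (F y * \1_(T k) y)%:E) (fun y => (F y)%:E) (fun y => `|F y|%:E).
- by move=> k; apply/measurable_EFinP; apply: measurable_funM => //; exact: measurable_indic.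
- exact/measurable_EFinP.
- apply: aeW => y _; have [N hN] := TT y.
  apply: cvg_near_cst; exists N => // k /= /hN Tk.
  by rewrite indicE mem_set// mulr1.
- exact: integrable_norm iF.
- apply: aeW => y k _; rewrite lee_fin normrM ler_piMr// indicE.
  by case: (_ \in _); rewrite ?normr1 ?normr0.
apply: fine_cvg; rewrite fineK//.
exact: integrable_fin_num.
Qed.

End exhaustion.

Section affine_average.
Context d1 d2 (X : measurableType d1) (Y : measurableType d2) {R : realType}.
Variables (m : {finite_measure set X -> \bar R}) (p : {mfun X >-> Y}).
Variables (I : finType) (zeta : I -> X -> R) (mean : I -> Y -> R).
Hypotheses (bzeta : forall i, bmf (zeta i)) (bmean : forall i, bmf (mean i)).
Hypothesis meanE : forall i h, bmf h ->
  \int[m]_x (zeta i x * h (p x)) = \int[push m p]_y (mean i y * h y).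
Variables (a : Y -> R) (b : I -> Y -> R).
Hypotheses (ma : measurable_fun setT a) (mb : forall i, measurable_fun setT (b i)).

Notation Phi := (fun x => a (p x) + \sum_i b i (p x) * zeta i x).
Notation Psi := (fun y => a y + \sum_i b i y * mean i y).

(** Conditional expectation of an affine expression with unbounded coefficients:
    the truncated identities hold, and those tested against the sign of the
    right-hand side show that it is integrable. *)
Lemma affine_average : m.-integrable setT (EFin \o Phi) ->
  (push m p).-integrable setT (EFin \o Psi) /\ \int[m]_x Phi x = \int[push m p]_y Psi y.
Proof.
move=> iPhi.
pose s y := `|a y| + \sum_i `|b i y|.
(* On T k the coefficients are bounded, and the definition of mean applies. *)
pose T (k : nat) := [set y | s y <= k%:R].
have ms : measurable_fun setT s.
  apply: measurable_funD; first exact: measurableT_comp.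
  by apply: measurable_sum => i; exact: measurableT_comp.
have mT k : measurable (T k).
  have -> : T k = s @^-1` `]-oo, k%:R]%classic.
    by apply/seteqP; split => y; rewrite /T/= in_itv.
  by rewrite -[X in measurable X]setTI; apply: ms => //; exact: measurable_itv.
have sb y i : `|b i y| <= s y.
  rewrite /s (bigD1 i)//= addrCA lerDl addr_ge0// sumr_ge0//.
have sa y : `|a y| <= s y by rewrite lerDl sumr_ge0.
have TT y : exists N, forall k, (N <= k)%N -> T k y.
  exists (Num.truncn (s y)).+1 => k /= Nk; rewrite /T/=.
  apply/ltW; apply: (lt_le_trans (truncnS_gt _)).
  by rewrite ler_nat.
have mPsi : measurable_fun setT Psi.
  apply: measurable_funD => //; apply: measurable_sum => i; apply: measurable_funM => //.
  exact: bmf_meas.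
have mPhi : measurable_fun setT Phi.
  by apply/measurable_EFinP; exact: measurable_int iPhi.
have trunc k h : bmf h -> [/\ bmf (fun x => Phi x * (\1_(T k) (p x) * h (p x))),
    bmf (fun y => Psi y * (\1_(T k) y * h y)) &
    \int[m]_x (Phi x * (\1_(T k) (p x) * h (p x))) =
    \int[push m p]_y (Psi y * (\1_(T k) y * h y))].
  move=> bh; pose H y := \1_(T k) y * h y.
  have b1 : bmf (\1_(T k) : Y -> R) by exact: bmf_indic.
  have bH : bmf H by exact: bmfM.
  have bmul (f : Y -> R) : measurable_fun setT f -> (forall y, `|f y| <= s y) -> bmf (fun y => f y * H y).
    move=> mf fs; have [_ [C hC]] := bh; split.
      by apply: measurable_funM => //; exact: bmf_meas.
    exists (k%:R * C) => y; rewrite /H indicE.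
    have [Ty|nT] := pselect (T k y).
      by rewrite mem_set// mul1r normrM ler_pM//; exact: le_trans (fs y) Ty.
    rewrite memNset// mul0r mulr0 normr0 mulr_ge0//.
    exact: le_trans (normr_ge0 _) (hC y).
  have baH := bmul a ma sa; have bbH i := bmul (b i) (mb i) (sb ^~ i).
  have bzb i : bmf (fun x => zeta i x * (b i (p x) * H (p x))).
    by apply: bmfM => //; exact: (bmf_comp (bbH i) (@measurable_funPT _ _ _ _ p)).
  have bap : bmf (fun x => a (p x) * H (p x)).
    exact: (bmf_comp baH (@measurable_funPT _ _ _ _ p)).
  have bmb i : bmf (fun y => mean i y * (b i y * H y)) by exact: bmfM.
  have eL : (fun x => Phi x * H (p x)) =
      (fun x => a (p x) * H (p x) + \sum_i zeta i x * (b i (p x) * H (p x))).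
    apply/funext => x; rewrite mulrDl mulr_suml; congr (_ + _).
    by apply: eq_bigr => i _; ring.
  have eR : (fun y => Psi y * H y) =
      (fun y => a y * H y + \sum_i mean i y * (b i y * H y)).
    apply/funext => y; rewrite mulrDl mulr_suml; congr (_ + _).
    by apply: eq_bigr => i _; ring.
  rewrite -/(H _) eL eR; split; [by apply: bmfD => //; exact: bmf_sum..|].
  rewrite bintD//; last exact: bmf_sum.
  rewrite bintD//; last exact: bmf_sum.
  rewrite !bint_sum// (bint_push m p baH).
  by congr (_ + _); apply: eq_bigr => i _; exact: (meanE i (bbH i)).
pose N := [set y | Psi y < 0].
have mN : measurable N.
  have -> : N = (fun y => Psi y) @^-1` `]-oo, 0[%classic.
    by apply/seteqP; split => y; rewrite /N/= in_itv.
  by rewrite -[X in measurable X]setTI; apply: mPsi => //; exact: measurable_itv.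
(* Testing against the sign of Psi bounds the integral of |Psi| over T k by that
   of |Phi|. *)
pose sgn y : R := 1 - 2 * \1_N y.
have bsgn : bmf sgn.
  apply: bmfB; first exact: bmf_cst.
  by apply: bmfM; [exact: bmf_cst|exact: bmf_indic].
have sgnE y : Psi y * sgn y = `|Psi y|.
  rewrite /sgn indicE; have [Py|Py] := ltP (Psi y) 0.
    by rewrite mem_set// ltr0_norm// mulr1n; ring.
  by rewrite memNset ?ger0_norm// ?mulr0n; [ring|rewrite /N/= ltNge Py].
have sgn1 y : `|sgn y| = 1.
  rewrite /sgn indicE; case: (_ \in _); rewrite ?mulr1 ?mulr0 ?subr0 ?normr1//.
  by have -> : 1 - 2 = -1 :> R by [ring]; rewrite normrN1.
have iPsi : (push m p).-integrable setT (EFin \o Psi).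
  apply/integrableP; split; first exact/measurable_EFinP.
  pose J := \int[m]_x `|Phi x|.
  have iJ : m.-integrable setT (EFin \o (fun x => `|Phi x|)) by exact: integrable_norm iPhi.
  apply: (@le_lt_trans _ _ J%:E); last exact: ltry.
  have -> : [set: Y] = \bigcup_k T k.
    by apply/seteqP; split => y // _; have [k hk] := TT y; exists k => //; exact: hk.
  apply: integral_bigcup_le => //.
  - by move=> k j kj y /= Ty; apply: (le_trans Ty); rewrite ler_nat.
  - by apply: measurableT_comp => //; exact/measurable_EFinP.
  move=> k; have [b1 b2 e] := trunc k sgn bsgn.
  have -> : (\int[push m p]_(y in T k) `|(EFin \o Psi) y| =
      (\int[push m p]_y (Psi y * (\1_(T k) y * sgn y)))%:E)%E.
    rewrite bint_EFin// integral_mkcond; apply: eq_integral => y _.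
    rewrite patchE indicE; case: ifPn => Ty /=; last by rewrite mul0r mulr0.
    by rewrite mul1r sgnE.
  rewrite -e lee_fin; apply: le_Rintegral => //; first exact: bmf_integrable.
  move=> x _; apply: (le_trans (ler_norm _)); rewrite !normrM sgn1 mulr1 ler_piMr//.
  by rewrite indicE; case: (_ \in _); rewrite ?normr1 ?normr0.
split => //.
have c1 := cvg_exhaust iPsi mT TT.
have mTp k : measurable (p @^-1` T k).
  by rewrite -[X in measurable X]setTI; exact: (@measurable_funPT _ _ _ _ p).
have c2 := cvg_exhaust (T := fun k => p @^-1` T k) iPhi mTp (fun x => TT (p x)).
have b1 : bmf (cst 1 : Y -> R) by exact: bmf_cst.
apply: (cvg_unique (@Rhausdorff R) c2); apply: cvg_trans c1; apply: near_eq_cvg.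
apply: nearW => k; have [_ _ e] := trunc k _ b1.
transitivity (\int[push m p]_y (Psi y * (\1_(T k) y * cst 1 y))).
  by apply: eq_Rintegral => y _; rewrite mulr1.
by rewrite -e; apply: eq_Rintegral => x _; rewrite mulr1.
Qed.

End affine_average.

(** * Integrals over the levels *)

Section nonmeasurable_integral.
Context d (T : measurableType d) {R : realType} (m : {measure set T -> \bar R}).
Local Open Scope ereal_scope.
Implicit Types f g : T -> \bar R.
Import HBNNSimple.

Let ge0_integral_mono f g : (forall x, 0 <= f x) -> (forall x, f x <= g x) ->
  \int[m]_x f x <= \int[m]_x g x.
Proof.
move=> f0 fg; have g0 x : 0 <= g x by exact: le_trans (fg x).
rewrite !ge0_integralTE//; apply: ge_ereal_sup => _ [h hf <-].
by apply: ereal_sup_ubound; exists h => // x; exact: le_trans (fg x).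
Qed.

Let ge0_integral_ae_eq f g : (forall x, 0 <= f x) -> (forall x, 0 <= g x) ->
  measurable_fun setT g -> {ae m, forall x, f x = g x} -> \int[m]_x f x = \int[m]_x g x.
Proof.
move=> f0 g0 mg fg; apply/le_anti/andP; split.
  rewrite [leLHS]ge0_integralTE//; apply: ge_ereal_sup => _ [h hf <-].
  rewrite -integralT_nnsfun; apply: ae_ge0_le_integral => //.
  - by move=> x _; rewrite lee_fin.
  - exact/measurable_EFinP.
  - by apply: filterS fg => x fgx _; rewrite -fgx.
have [N [mN N0 fgN]] := fg.
apply: (@le_trans _ _ (\int[m]_x (g \_ (~` N)) x)).
  rewrite (@ae_eq_integral _ _ _ m setT (g \_ (~` N)) g)//.
    apply/(measurable_restrictT _ (measurableC mN)).
    exact: measurable_funS mg.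
  exists N; split => // x /= /existsNP[_ gx]; apply: contrapT => nN; apply: gx.
  by rewrite patchE mem_set.
apply: ge0_integral_mono => x; first by apply: erestrict_ge0.
rewrite patchE; case: ifPn => //; rewrite inE => xN.
by have -> : f x = g x by [apply: contrapT => nfg; apply: xN; exact: fgN].
Qed.

(** A simple function below f is, up to a null set, below g, so it sees f only
    through g. Needed because the family of gradients is chosen level by level,
    with no joint measurability. *)
Lemma ae_eq_integral_nonmeasurable f g : measurable_fun setT g -> {ae m, forall x, f x = g x} ->
  \int[m]_x f x = \int[m]_x g x.
Proof.
move=> mg fg; rewrite integralE [RHS]integralE; congr (_ - _).
  apply: ge0_integral_ae_eq => //; first exact: measurable_funepos.
  by apply: filterS fg => x fgx; rewrite !funeposE fgx.
apply: ge0_integral_ae_eq => //; first exact: measurable_funeneg.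
by apply: filterS fg => x fgx; rewrite !funenegE fgx.
Qed.

End nonmeasurable_integral.

(** The coefficients of an affine function are its values at 0 and at the basis
    vectors, hence measurable in (x, y). *)
Lemma affine_in_z_coords (R : realType) n (D : set 'rV[R]_n) phi :
  affine_in_z D phi -> forall x y z, D x ->
  phi (x, y, z) = phi (x, y, 0) +
    \sum_i (phi (x, y, delta_mx ord0 i) - phi (x, y, 0)) * z ord0 i.
Proof.
move=> aff x y z Dx; have [l [c E]] := aff x y Dx.
rewrite !E linear0 add0r addrC; congr (_ + _).
rewrite {1}(row_sum_delta z) linear_sum; apply: eq_bigr => i _.
by rewrite linearZ /= E addrK mulrC.
Qed.

Section fubini_levels.
Context d1 d2 (T1 : measurableType d1) (T2 : measurableType d2) {R : realType}.
Variables (m1 : {finite_measure set T1 -> \bar R}) (m2 : {finite_measure set T2 -> \bar R}).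
Variable f : T1 * T2 -> \bar R.
Hypothesis intf : (finite_prod m1 m2).-integrable setT f.
Local Open Scope ereal_scope.

Lemma integrable_partial_integral : m2.-integrable setT (fun y => \int[m1]_x f (x, y)).
Proof.
have mf : measurable_fun setT f by exact: measurable_int intf.
have mG : measurable_fun setT (fun y => \int[m1]_x f (x, y)).
  exact: (@measurable_fubini_G _ _ _ _ _ m1 m2 f intf).
apply/integrableP; split => //.
apply: (@le_lt_trans _ _ (\int[m2]_y \int[m1]_x `|f (x, y)|)); last first.
  exact: ((integrable21ltyP m1 m2 mf).1 intf).
apply: ge0_le_integral => //.
- exact: measurableT_comp.
- apply: (@measurable_fun_fubini_tonelli_G _ _ _ _ _ m1 (fun z => `|f z|)) => //.
  exact: measurableT_comp.
- move=> y _; apply: le_abse_integral => //.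
  exact: (measurableT_comp mf (measurable_pair2 y)).
Qed.

End fubini_levels.

(** * Disintegration *)

Section disintegration.
Context {R : realType} {n : nat} (Omega : set 'rV[R]_n).
Notation E := 'rV[R]_n.
Notation ER := ('rV[R]_n * R)%type.
Notation X := ('rV[R]_n * R * 'rV[R]_n)%type.
Variables (mu : {finite_measure set X -> \bar R}) (M : R).
Variables (mO : measurable Omega) (fO : (leb n Omega < +oo)%E).
Variable mD : measurable (Omega `*` setT `*` setT : set X).
Hypothesis M0 : 0 < M.
Hypothesis muM : mu.-negligible [set p : X | M < `|p|].
Variable mz : 'I_n -> ER -> R.
Hypothesis mz_bounded : forall i, measurable_fun setT (mz i) /\ forall q, `|mz i q| <= M.
Hypothesis moment : forall i h, bmf h ->
  \int[base_measure mu mD]_p (clamp M (p.2 ord0 i) * h p.1) =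
  \int[base_law mu mD]_q (mz i q * h q).
Variable lev : {finite_measure set R -> \bar R}.
Notation lam := (base mO fO).
Notation P := (finite_prod lam lev).
Variable w : ER -> R.
Hypothesis mw : measurable_fun setT w.
Hypothesis law : forall A, measurable A ->
  base_law mu mD A = push P (mfun_of (measurable_graph mw)) A.
Variable Du : R -> E -> E.
Hypothesis weakDu : forall r, is_weak_gradient Omega (fun x => w (x, r)) (Du r).
Hypothesis gradDu : {ae lev, forall r,
  {ae leb n, forall x, Omega x -> forall i, Du r x ord0 i = mz i (graph w (x, r))}}.
Variable phi : X -> R.
Hypothesis iphi : mu.-integrable (closure Omega `*` setT `*` setT) (EFin \o phi).
Hypothesis affphi : affine_in_z (closure Omega) phi.

Let D0 : set X := Omega `*` setT `*` setT.
Let S : set ER := Omega `*` setT.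

Let mS : measurable S. Proof. exact: measurableX. Qed.

Let iphi0 : mu.-integrable D0 (EFin \o phi).
Proof.
apply: integrableS iphi => //.
  apply: measurableX => //; apply: measurableX => //.
  by apply: closed_measurable_rV; exact: closed_closure.
by move=> [[x y] z] [[/= Ox _] _]; split => //; split => //; exact: subset_closure.
Qed.

Let mphi0 : measurable_fun D0 phi.
Proof. by apply/measurable_EFinP; exact: measurable_int iphi0. Qed.

Let slice (z : E) : ER -> R := (fun q => phi (q, z)) \_ S.

Let mslice z : measurable_fun setT (slice z).
Proof.
apply/(measurable_restrictT _ mS).
apply: (measurable_comp mD _ mphi0); first by move=> _ [[x y] [/= Ox _] <-].
by apply: measurable_funTS; apply: measurable_fun_pair => //; exact: measurable_cst.
Qed.

Let a : ER -> R := slice 0.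
Let b (i : 'I_n) : ER -> R := fun q => slice (delta_mx ord0 i) q - slice 0 q.

Let ma : measurable_fun setT a. Proof. exact: mslice. Qed.
Let mb i : measurable_fun setT (b i). Proof. by apply: measurable_funB; exact: mslice. Qed.

Let phiE q z : S q -> phi (q, z) = a q + \sum_i b i q * z ord0 i.
Proof.
case: q => x y [/= Ox _].
rewrite (affine_in_z_coords affphi y z (subset_closure Ox)).
have sE z' : slice z' (x, y) = phi (x, y, z') by rewrite /slice patchE mem_set.
by rewrite /a sE; congr (_ + _); apply: eq_bigr => i _; rewrite /b !sE.
Qed.

Notation Phi := (fun p : X => a p.1 + \sum_i b i p.1 * clamp M (p.2 ord0 i)).
Notation Psi := (fun q : ER => a q + \sum_i b i q * mz i q).

Let mPhi : measurable_fun setT Phi.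
Proof.
apply: measurable_funD; first exact: (measurableT_comp ma measurable_fst).
apply: measurable_sum => i; apply: measurable_funM; last exact: measurable_clamp.
exact: (measurableT_comp (mb i) measurable_fst).
Qed.

Let mPsi : measurable_fun setT Psi.
Proof.
apply: measurable_funD => //; apply: measurable_sum => i; apply: measurable_funM => //.
by case: (mz_bounded i).
Qed.

Let phi_Phi : {ae mu, forall p, D0 p -> phi p = Phi p}.
Proof.
apply: (negligibleS _ muM) => -[q z] /= np; rewrite ltNge; apply/negP => qM; apply: np.
move=> [Sq _]; rewrite phiE//; congr (_ + _); apply: eq_bigr => i _.
rewrite clampE//; apply: le_trans qM; apply: (le_trans (norm_rV_le z i)).
by rewrite prod_normE /= le_max lexx orbT.
Qed.

Let ae_phi_Phi : ae_eq mu D0 (EFin \o phi) (EFin \o Phi).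
Proof. by apply: filterS phi_Phi => p h Dp /=; rewrite h. Qed.

Let mPhiE : measurable_fun setT (EFin \o Phi). Proof. exact/measurable_EFinP. Qed.

Let iPhi : (base_measure mu mD).-integrable setT (EFin \o Phi).
Proof.
apply: (proj2 (@integrable_mrestr _ _ _ mu _ mD _ mPhiE)).
have [mphi fphi] := integrableP _ _ _ iphi0.
apply/integrableP; split; first exact: measurable_funTS.
apply: le_lt_trans fphi; rewrite le_eqVlt; apply/orP; left; apply/eqP.
apply: ae_eq_integral => //.
- by apply: measurableT_comp => //; exact: measurable_funTS.
- exact: measurableT_comp.
- by apply: filterS ae_phi_Phi => p h Dp; exact: (congr1 abse (esym (h Dp))).
Qed.

Let bmz i : bmf (mz i).
Proof. by have [? ?] := mz_bounded i; split => //; exists M. Qed.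

Let average : (base_law mu mD).-integrable setT (EFin \o Psi) /\
  \int[base_measure mu mD]_p Phi p = \int[base_law mu mD]_q Psi q.
Proof.
apply: (affine_average (zeta := fun i (p : X) => clamp M (p.2 ord0 i)) (mean := mz)) => //.
move=> i; split; first exact: measurable_clamp.
by exists M => p; exact: clamp_le.
Qed.

Let Psig (p : ER) : \bar R := (Psi (graph w p))%:E.

Let mPsiE : measurable_fun setT (EFin \o Psi). Proof. exact/measurable_EFinP. Qed.

Let iPsig : P.-integrable setT Psig.
Proof.
have [iPsi _] := average.
have [_ fPsi] := integrableP _ _ _ iPsi.
have mg := measurable_graph mw.
apply/integrableP; split; first exact: (measurableT_comp mPsiE mg).
apply: le_lt_trans fPsi; rewrite le_eqVlt; apply/orP; left; apply/eqP.
rewrite (@eq_measure_integral _ _ _ setT (push P (mfun_of mg)) (base_law mu mD)); last first.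
  by move=> A mA _; exact: law.
by rewrite [RHS](ge0_integral_pushforward mg)//; exact: measurableT_comp.
Qed.

Let total : (\int[mu]_(p in D0) (phi p)%:E = \int[P]_p Psig p)%E.
Proof.
have [iPsi ePsi] := average.
have mg := measurable_graph mw.
transitivity (\int[mu]_(p in D0) (Phi p)%:E)%E.
  apply: ae_eq_integral => //; first exact: measurable_int iphi0.
  exact: measurable_funTS.
rewrite -(@integral_mrestr _ _ _ mu _ mD _ mPhiE).
transitivity (\int[base_law mu mD]_q (Psi q)%:E)%E.
  rewrite -[LHS]fineK; last exact: (integrable_fin_num measurableT iPhi).
  rewrite -[RHS]fineK; last exact: (integrable_fin_num measurableT iPsi).
  by congr EFin; exact: ePsi.
rewrite (@eq_measure_integral _ _ _ setT (push P (mfun_of mg)) (base_law mu mD)); last first.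
  by move=> A mA _; exact: law.
by rewrite [LHS](integral_pushforward mg).
Qed.

Let Fr (r : R) : \bar R := (\int[lam]_x Psig (x, r))%E.

Let good_level : {ae lev, forall r,
  lam.-integrable setT (fun x => Psig (x, r)) /\
  {ae leb n, forall x, Omega x -> phi (x, w (x, r), Du r x) = Psi (graph w (x, r))}}.
Proof.
have h1 := ae_integrable2 iPsig.
apply: filterS2 h1 gradDu => r ir gr; split => //.
apply: filterS gr => x gx Ox; rewrite phiE//; congr (_ + _).
by apply: eq_bigr => i _; rewrite gx.
Qed.

Let mlevel r : measurable_fun Omega (fun x => phi (x, w (x, r), Du r x)).
Proof.
apply: (measurable_comp mD _ mphi0); first by move=> _ [x Ox <-].
have [_ lG _] := weakDu r.
pose G (x : E) : E := \row_i ((fun x => Du r x ord0 i) \_ Omega) x.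
have mG : measurable_fun setT G.
  apply: measurable_fun_rV => i.
  have -> : (fun x => G x ord0 i) = (fun x => Du r x ord0 i) \_ Omega.
    by apply/funext => x; rewrite mxE.
  by apply/(measurable_restrictT _ mO); case: (lG i).
apply: (eq_measurable_fun (fun x => (x, w (x, r), G x))).
  by move=> x xO; congr pair; apply/rowP => i; rewrite mxE patchE xO.
apply: measurable_funTS; apply: measurable_fun_pair => //.
apply: measurable_fun_pair => //.
exact: (measurableT_comp mw (measurable_pair2 r)).
Qed.

Let mPsigr r : measurable_fun setT (fun x => Psig (x, r)).
Proof.
exact: (measurableT_comp (measurableT_comp mPsiE (measurable_graph mw)) (measurable_pair2 r)).
Qed.

Let level_integral r : lam.-integrable setT (fun x => Psig (x, r)) /\
  {ae leb n, forall x, Omega x -> phi (x, w (x, r), Du r x) = Psi (graph w (x, r))} ->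
  (leb n).-integrable Omega (fun x => (phi (x, w (x, r), Du r x))%:E) /\
  (\int[leb n]_(x in Omega) (phi (x, w (x, r), Du r x))%:E = Fr r)%E.
Proof.
move=> [ir er].
have ir' := proj1 (@integrable_mrestr _ _ _ (leb n) _ mO _ (mPsigr r)) ir.
have mp : measurable_fun Omega (fun x => (phi (x, w (x, r), Du r x))%:E).
  by apply/measurable_EFinP; exact: mlevel.
have mq : measurable_fun Omega (fun x => Psig (x, r)) by exact: measurable_funTS.
split.
  have [_ fr] := integrableP _ _ _ ir'.
  apply/integrableP; split => //.
  apply: le_lt_trans fr; rewrite le_eqVlt; apply/orP; left; apply/eqP.
  apply: ae_eq_integral => //; [exact: measurableT_comp|exact: measurableT_comp|].
  by apply: filterS er => x ex Ox; rewrite ex.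
rewrite /Fr [RHS](@integral_mrestr _ _ _ (leb n) _ mO _ (mPsigr r)).
apply: ae_eq_integral => //.
by apply: filterS er => x ex Ox; rewrite ex.
Qed.

Lemma disintegration :
  [/\ {ae lev, forall r, (leb n).-integrable Omega
        (fun x => (phi (x, w (x, r), Du r x))%:E)},
      ae_integrable lev setT
        (fun r => \int[leb n]_(x in Omega) (phi (x, w (x, r), Du r x))%:E)%E
    & (\int[mu]_(p in Omega `*` setT `*` setT) (phi p)%:E =
       \int[lev]_r \int[leb n]_(x in Omega) (phi (x, w (x, r), Du r x))%:E)%E].
Proof.
have iF : lev.-integrable setT Fr by exact: integrable_partial_integral iPsig.
have aeF : {ae lev, forall r,
    (\int[leb n]_(x in Omega) (phi (x, w (x, r), Du r x))%:E = Fr r)%E}.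
  by apply: filterS good_level => r /level_integral[].
split.
- by apply: filterS good_level => r /level_integral[].
- by exists Fr => //; apply: filterS aeF => r h _.
rewrite total -(fubini2 iPsig).
have mF : measurable_fun setT Fr by exact: measurable_int iF.
by rewrite (ae_eq_integral_nonmeasurable mF aeF).
Qed.

End disintegration.

Theorem theorem2p2 (R : realType) (n : nat) (n_gt0 : (0 < n)%N)
    (Omega : set 'rV[R]_n)
    (mu : {finite_measure set ('rV[R]_n * R * 'rV[R]_n)%type -> \bar R}) :
  bounded_set Omega -> connected Omega -> open Omega ->
  piecewise_C1_boundary Omega ->
  is_radon mu -> compactly_supported mu ->
  mu (~` (closure Omega `*` setT `*` setT)) = 0%E ->
  (forall phi : 'rV[R]_n * R -> R, test_function (Omega `*` setT) phi ->
    forall i : 'I_n,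
      \int[mu]_(p in Omega `*` setT `*` setT)
        ('D_(delta_mx ord0 i, 0) phi p.1 + 'D_(0, 1) phi p.1 * p.2 ord0 i)
      = 0) ->
  exists (nu : {finite_measure set R -> \bar R}) (u : R -> 'rV[R]_n -> R),
    [/\ is_radon nu,
        compactly_supported nu,
        forall r, W1infty Omega (u r),
        (forall (phi : 'rV[R]_n * R * 'rV[R]_n -> R)
                (Du : R -> 'rV[R]_n -> 'rV[R]_n),
          mu.-integrable (closure Omega `*` setT `*` setT) (EFin \o phi) ->
          affine_in_z (closure Omega) phi ->
          (forall r, is_weak_gradient Omega (u r) (Du r)) ->
          [/\ {ae nu, forall r, (leb n).-integrable Omega
                (fun x => (phi (x, u r x, Du r x))%:E)},
              ae_integrable nu setT
                (fun r => \int[leb n]_(x in Omega)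
                   (phi (x, u r x, Du r x))%:E)%E
            & (\int[mu]_(p in Omega `*` setT `*` setT) (phi p)%:E =
               \int[nu]_r \int[leb n]_(x in Omega)
                 (phi (x, u r x, Du r x))%:E)%E])
      & forall r r' : R, r' <= r -> forall x, Omega x -> u r x <= u r' x].
Proof.
move=> bO cO oO _ _ cmu _ weq.
have mO : measurable Omega by exact: open_measurable_rV.
have fO : (leb n Omega < +oo)%E.
  have [N [_ hN]] := bO.
  have r0 : 0 < `|N| + 2 by rewrite ltr_wpDl.
  apply: (@le_lt_trans _ _ (leb n (ball (0 : 'rV[R]_n) (`|N| + 2)))).
    apply: le_measure; rewrite ?inE//; first exact: ball_measurable.
    move=> x Ox; apply/ball_normP; rewrite sub0r normrN.
    have := hN (`|N| + 1) _ x Ox; rewrite /= => h.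
    by apply: (le_lt_trans (h _)); [rewrite (le_lt_trans (ler_norm _))// ltrDl|rewrite ltrD2l ltr1n].
  by rewrite leb_ball// ltry.
have mD : measurable (Omega `*` setT `*` setT : set ('rV[R]_n * R * 'rV[R]_n)).
  by apply: measurableX => //; exact: measurableX.
have [M M0 muM] := compact_support_bound cmu.
have [mz [tr moment]] := transport_of_measure mD M0 muM oO weq.
have [c [c0 densc]] := dens_constant tr cO.
have [U [UU oU]] := @ultraFilterLemma nat \oo _.
pose sg := base_law mu mD.
pose u := quantile Omega sg M c.
pose w (p : ('rV[R]_n * R)%type) := u p.2 p.1.
have mw : measurable_fun setT w by exact: (measurable_quantile tr densc).
have wM p : `|w p| <= M by exact: (quantile_bounded tr).
have bw : bmf w by split => //; exists M.
have L0 : 0 <= @speed R n M by exact: (speed_ge0 tr).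
have decw x r r' : r' <= r -> w (x, r) <= w (x, r').
  exact: (quantile_decreasing tr c x).
have lipw x0 rho x x' r : ball x0 rho `<=` Omega -> ball x0 rho x -> ball x0 rho x' ->
    `|w (x, r) - w (x', r)| <= @speed R n M * `|x - x'|.
  exact: (quantile_lipschitz tr densc r).
have law A : measurable A ->
    sg A = push (finite_prod (base mO fO) (levels c)) (mfun_of (measurable_graph mw)) A.
  exact: (quantile_law tr densc c0 mO fO).
have [_ _ _ mzb _] := tr.
have bg i : bmf (fun p => mz i (graph w p)).
  by apply: (bmf_comp _ (measurable_graph mw)); exact: (bmz tr).
have grad := weak_gradient_levels oO bw bg
  (fun i => weak_derivative_graph tr wM L0 decw lipw law i UU oU).
exists (levels c), u; split.
- exact: levels_is_radon.
- exact: levels_compactly_supported.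
- move=> r; apply: (lipschitz_W1infty mO fO oO _ L0) => [|x0 rho x x'].
    exact: (bmf_section2 r bw).
  exact: lipw.
- move=> phi Du iphi aphi weakDu.
  have gradDu : {ae levels c, forall r, {ae leb n, forall x, Omega x ->
      forall i, Du r x ord0 i = mz i (graph w (x, r))}}.
    by apply: filterS grad => r gr; exact: (gr _ (weakDu r)).
  exact: (disintegration M0 muM mzb moment law weakDu gradDu iphi aphi).
- by move=> r r' rr x _; exact: (quantile_decreasing tr c x rr).
Qed.
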